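(* Let $1<p<\infty$ and let $E$ be a bounded domain with $\overline E\subset\Omega$ that satisfies the Boman chain condition. Suppose that for some $w\in A_p$ and some constants $\Lambda>\lambda>0$ the matrix function $Q$ satisfies $$\lambda\, w(x)^{2/p}|\xi|^2\le \xi^tQ(x)\xi\le\Lambda\, w(x)^{2/p}|\xi|^2\qquad\text{for a.e. }x\in\Omega\text{ and all }\xi\in\mathbb{R}^n.$$ Then the quadratic form $\mathcal{Q}(x,\xi)=\xi^tQ(x)\xi$ has the $p$-Neumann property on $E$ with respect to the weight $v=w$; in particular, the Neumann problem $$\operatorname{div}\big(|\sqrt{Q}\nabla u|^{p-2}Q\nabla u\big)=|f|^{p-2}f\,w\ \text{ in }E,\qquad \mathbf n^t\cdot Q\nabla u=0\ \text{ on }\partial E$$ has a weak solution for every $f\in L^p(w;E)$.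
   Context: Setting: $\Omega\subset\mathbb{R}^n$ is a domain; $Q$ is a function on $\Omega$ with values in the real symmetric positive semi-definite $n\times n$ matrices, with Lebesgue measurable entries; $\sqrt{Q(x)}$ is the positive semi-definite square root. A weight is a non-negative locally integrable function. For $1<p<\infty$, $w\in A_p$ means $w$ is a weight on $\mathbb{R}^n$ (positive a.e.) with $\sup_B\big(\frac{1}{|B|}\int_B w\,dx\big)\big(\frac{1}{|B|}\int_B w^{1-p'}\,dx\big)^{p-1}<\infty$, the supremum being over all balls $B$, where $1/p+1/p'=1$. Boman chain condition: a domain $E$ satisfies it if there are constants $\tau\ge1$, $M>1$ and a family $W$ of open balls with $E=\bigcup_{B\in W}B$ such that (i) $\sum_{B\in W}\chi_{\tau B}\le M\chi_E$; (ii) there is $B_0\in W$ such that every $B\in W$ can be joined to $B_0$ by a finite chain $B_0,B_1,\dots,B_k=B$ of elements of $W$ with $B\subset MB_j$ for all $j=0,\dots,k$; (iii) for consecutive balls in the chain, $B_j\cap B_{j+1}$ contains a ball $R_j$ with $B_j\cup B_{j+1}\subset MR_j$. (Here $cB$ is the ball concentric with $B$ with radius multiplied by $c$.) Spaces, for a weight $v$ (here $v=w$): $\|f\|_{L^p(v;E)}=(\int_E|f|^pv\,dx)^{1/p}$. $\mathcal{L}^p_Q(E)$ is the space of measurable $\mathbf{f}:E\to\mathbb{R}^n$ with $\|\mathbf{f}\|_{\mathcal{L}^p_Q(E)}=(\int_E|\sqrt{Q}\,\mathbf{f}|^p\,dx)^{1/p}<\infty$, modulo elements of zero norm. $H^{1,p}_Q(v;E)$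 is the completion of the set of $f\in C^1(\overline{E})$ of finite norm with respect to $\|f\|_{H^{1,p}_Q(v;E)}=\|f\|_{L^p(v;E)}+\|\nabla f\|_{\mathcal{L}^p_Q(E)}$. Each of its elements is represented by the unique pair $(u,\mathbf{g})\in L^p(v;E)\times\mathcal{L}^p_Q(E)$ that is the limit of $(f_k,\nabla f_k)$ for a Cauchy sequence $f_k$ representing it. $\tilde{H}^{1,p}_Q(v;E)=\{(u,\mathbf g)\in H^{1,p}_Q(v;E):\int_E u\,v\,dx=0\}$; a function $\varphi\in C^1(\overline E)$ of finite norm is identified with $(\varphi,\nabla\varphi)$. Weak solution: given $f\in L^p(v;E)$, a pair $(u,\mathbf g)\in\tilde{H}^{1,p}_Q(v;E)$ is a weak solution of the Neumann problem $\operatorname{div}(|\sqrt{Q}\nabla u|^{p-2}Q\nabla u)=|f|^{p-2}f\,v$ in $E$, $\mathbf n^t\cdot Q\nabla u=0$ on $\partial E$, if for all $\varphi\in C^1(\overline{E})\cap\tilde{H}^{1,p}_Q(v;E)$, $$\int_E|\sqrt{Q}\,\mathbf g|^{p-2}(\nabla\varphi)^tQ\,\mathbf g\,dx=-\int_E|f|^{p-2}f\,\varphi\,v\,dx$$ (expressions $|s|^{p-2}s$ are $0$ at $s=0$, and $|\sqrt Q\mathbf g|^{p-2}Q\mathbf g=0$ where $\sqrt Q\mathbf g=0$). No regularity of $\partial E$ is assumed. $p$-Neumann property on $E$ (with respect to $v$): (1) for every $f\in L^p(v;E)$ there exists a weak solution $(u,\mathbf g)_f\in\tilde{H}^{1,p}_Q(v;E)$;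 and (2) there is a constant $D_p>0$ such that for every $f\in L^p(v;E)$ every weak solution satisfies $\|u\|_{L^p(v;E)}\le D_p\|f\|_{L^p(v;E)}$. *)

(* Defs.v *)
From HB Require Import structures.
From mathcomp Require Import all_boot all_order all_algebra.
From mathcomp Require Import all_classical all_reals all_analysis.

Set Implicit Arguments.
Unset Strict Implicit.
Unset Printing Implicit Defensive.

Import Order.TTheory GRing.Theory Num.Theory.
Import numFieldTopology.Exports numFieldNormedType.Exports.

Local Open Scope classical_set_scope.
Local Open Scope ring_scope.

(* Points of R^(n+1) are row vectors, which carry the library's topology and
   differential calculus; gradients and vector fields are column vectors.  The
   library norm of a matrix is the max norm, hence the Euclidean norm here. *)
Definition enorm (R : realType) (m n : nat) (A : 'M[R]_(m, n)) : R :=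
  Num.sqrt (\sum_i \sum_j A i j ^+ 2).

Definition eball (R : realType) (n : nat) (c : 'rV[R]_n.+1) (r : R) :
    set 'rV[R]_n.+1 := [set x | enorm (x - c) < r].

Definition domain (R : realType) (n : nat) (D : set 'rV[R]_n.+1) : Prop :=
  [/\ open D, connected D & D !=set0].

(* Lebesgue measure on R^(n+1): the restriction, to the sets that are measurable
   in the sense of Caratheodory, of the outer measure given by countable covers
   by boxes.  The sigma-algebra is that of all Lebesgue measurable sets. *)
Definition box (R : realType) (n : nat) (ab : 'rV[R]_n.+1 * 'rV[R]_n.+1) :
    set 'rV[R]_n.+1 :=
  [set x | forall i, ab.1 0 i < x 0 i <= ab.2 0 i].

Definition box_volume (R : realType) (n : nat)
    (ab : 'rV[R]_n.+1 * 'rV[R]_n.+1) : R :=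
  \prod_i Num.max 0 (ab.2 0 i - ab.1 0 i).

Definition lebesgue_rV (R : realType) (n : nat) (A : set 'rV[R]_n.+1) :
    \bar R :=
  ereal_inf [set (\sum_(k <oo) (box_volume (F k))%:E)%E |
    F in [set F : nat -> 'rV[R]_n.+1 * 'rV[R]_n.+1 |
           A `<=` \bigcup_k box (F k)]].

Section lebesgue_rV_measure.
Context (R : realType) (n : nat).
Local Open Scope ereal_scope.
Local Notation mu := (@lebesgue_rV R n).

Let volE_ge0 (ab : 'rV[R]_n.+1 * 'rV[R]_n.+1) : 0 <= (box_volume ab)%:E.
Proof. by rewrite lee_fin prodr_ge0// => i _; rewrite le_max lexx. Qed.

Let mu_ge0 A : 0 <= mu A.
Proof.
by apply: le_ereal_inf_tmp => _ [F _ <-]; apply: nneseries_ge0 => k _ _.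
Qed.

Let mu0 : mu set0 = 0.
Proof.
apply/eqP; rewrite eq_le mu_ge0 andbT; apply: ereal_inf_lbound.
exists (fun=> (0%R, 0%R)) => //; apply: eseries0 => k _ _.
by congr EFin; rewrite /box_volume big_ord_recl/= mxE subrr maxxx mul0r.
Qed.

Let mu_subset : {homo mu : A B / A `<=` B >-> A <= B}.
Proof.
move=> A B AB; apply: ereal_inf_le_tmp => _ [F BF <-]; exists F => //.
exact: subset_trans AB BF.
Qed.

Let mu_sub : sigma_subadditive mu.
Proof.
move=> A; have [[i ioo]|] := pselect (exists i, mu (A i) = +oo).
  rewrite (eseries_pinfty _ _ ioo) ?leey// => k _.
  by rewrite gt_eqF// (lt_le_trans _ (mu_ge0 _))// ltNyr.
rewrite -forallNE => Aoo; apply/lee_addgt0Pr => _/posnumP[e].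
rewrite (le_trans _ (epsilon_trick _ _ _))//.
pose P i (F : nat -> 'rV[R]_n.+1 * 'rV[R]_n.+1) :=
  A i `<=` \bigcup_k box (F k) /\
  \sum_(k <oo) (box_volume (F k))%:E <= mu (A i) + (e%:num / (2 ^ i.+1)%:R)%:E.
have [G PG] : {G : nat -> nat -> _ & forall i, P i (G i)}.
  apply: (@choice _ _ P) => i.
  have fin : mu (A i) \is a fin_num.
    by rewrite ge0_fin_numE// lt_neqAle leey andbT; apply/eqP/Aoo.
  have e0 : (0 < e%:num / (2 ^ i.+1)%:R)%R by [].
  have [_ [F AF <-] lt] := lb_ereal_inf_adherent e0 fin.
  by exists F; split=> //; exact/ltW.
pose g (ij : nat * nat) := (box_volume (G ij.1 ij.2))%:E.
have g0 ij : 0 <= g ij by exact: volE_ge0.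
apply: (@le_trans _ _ (\esum_(ij in [set: nat * nat]) g ij)).
  have /card_esym/ppcard_eqP[f] := card_nat2.
  apply: ereal_inf_lbound; exists (fun k => G (f k).1 (f k).2).
    move=> x [i _ /(PG i).1[j _ xij]]; exists (f^-1%FUN (i, j)) => //=.
    by rewrite invK ?inE.
  rewrite nneseries_esumT; last by move=> k; exact: volE_ge0.
  by rewrite (reindex_esum [set: nat] [set: nat * nat] f).
have -> : [set: nat * nat] = [set: nat] `*`` (fun=> [set: nat]).
  by apply/seteqP; split.
rewrite -(@esum_esum _ _ _ setT (fun=> setT) (fun i j => g (i, j)))//.
rewrite -nneseries_esumT; last by move=> i; apply: esum_ge0.
apply: lee_nneseries => [i _ _|i _]; first exact: esum_ge0.
by rewrite -nneseries_esumT//; exact: (PG i).2.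
Qed.

HB.instance Definition _ := isOuterMeasure.Build R 'rV[R]_n.+1 mu
  mu0 mu_ge0 mu_subset mu_sub.

HB.instance Definition _ := @isMeasurable.Build (caratheodory_display mu)
  'rV[R]_n.+1 mu.-caratheodory
  (caratheodory_measurable_set0 mu)
  (@caratheodory_measurable_setC _ _ mu)
  (@caratheodory_measurable_bigcup _ _ mu).

HB.instance Definition _ := isMeasure.Build (caratheodory_display mu)
  'rV[R]_n.+1 R mu
  (@caratheodory_measure0 R 'rV[R]_n.+1 mu)
  (@caratheodory_measure_ge0 R 'rV[R]_n.+1 mu)
  (@caratheodory_measure_sigma_additive R 'rV[R]_n.+1 mu).

End lebesgue_rV_measure.

Arguments lebesgue_rV {R n}.

Definition quadform (R : realType) (n : nat) (A : 'M[R]_n) (xi : 'cV[R]_n) : R :=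
  (xi^T *m A *m xi) 0 0.

Definition psdmx (R : realType) (n : nat) (A : 'M[R]_n) : Prop :=
  A^T = A /\ forall xi, 0 <= quadform A xi.

(* The positive semi-definite square root, unique when A is positive
   semi-definite; the value is irrelevant otherwise. *)
Definition sqrtmx (R : realType) (n : nat) (A : 'M[R]_n) : 'M[R]_n :=
  xget 0 [set S | psdmx S /\ S *m S = A].

Definition grad (R : realType) (n : nat) (f : 'rV[R]_n.+1 -> R)
    (x : 'rV[R]_n.+1) : 'cV[R]_n.+1 :=
  \col_i 'D_(delta_mx 0 i) f x.

Definition weight (R : realType) (n : nat) (v : 'rV[R]_n.+1 -> R) : Prop :=
  [/\ forall x, 0 <= v x,
      measurable_fun setT v &
      forall K : set 'rV[R]_n.+1, compact K ->
        (\int[lebesgue_rV]_(x in K) (v x)%:E < +oo)%E].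

(* The solution p' of 1 / p + 1 / p' = 1. *)
Definition conjugate (R : realType) (p : R) : R := (1 - p^-1)^-1.

Definition average (R : realType) (n : nat) (B : set 'rV[R]_n.+1)
    (f : 'rV[R]_n.+1 -> R) : \bar R :=
  ((lebesgue_rV B)^-1 * \int[lebesgue_rV]_(x in B) (f x)%:E)%E.

Definition Ap_quotient (R : realType) (n : nat) (p : R) (w : 'rV[R]_n.+1 -> R)
    (B : set 'rV[R]_n.+1) : \bar R :=
  (average B w
     * average B (fun x => w x `^ (1 - conjugate p))%R `^ (p - 1))%E.

Definition Ap_weight (R : realType) (n : nat) (p : R) (w : 'rV[R]_n.+1 -> R) :
    Prop :=
  [/\ weight w,
      {ae lebesgue_rV, forall x, 0 < w x} &
      (ereal_sup [set Ap_quotient p w (eball cr.1 cr.2) |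
         cr in [set cr : 'rV[R]_n.+1 * R | (0 < cr.2)%R]] < +oo)%E].

(* Balls are given by their centre and radius. *)
Definition scaled_ball (R : realType) (n : nat) (c : R)
    (B : 'rV[R]_n.+1 * R) : set 'rV[R]_n.+1 :=
  eball B.1 (c * B.2).

Definition Boman_chain (R : realType) (n : nat) (M : R)
    (W : set ('rV[R]_n.+1 * R)) (B0 B : 'rV[R]_n.+1 * R) : Prop :=
  exists (k : nat) (C : nat -> 'rV[R]_n.+1 * R),
    [/\ C 0%N = B0, C k = B,
        forall j, (j <= k)%N ->
          W (C j) /\ scaled_ball 1 B `<=` scaled_ball M (C j) &
        forall j, (j < k)%N -> exists2 S : 'rV[R]_n.+1 * R, 0 < S.2 &
          scaled_ball 1 S `<=` scaled_ball 1 (C j) `&` scaled_ball 1 (C j.+1) /\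
          scaled_ball 1 (C j) `|` scaled_ball 1 (C j.+1) `<=` scaled_ball M S].

Definition Boman (R : realType) (n : nat) (E : set 'rV[R]_n.+1) : Prop :=
  exists (tau M : R) (W : set ('rV[R]_n.+1 * R)),
    [/\ 1 <= tau /\ 1 < M,
        (forall B, W B -> 0 < B.2) /\ E = \bigcup_(B in W) scaled_ball 1 B,
        forall x, (\esum_(B in W) (\1_(scaled_ball tau B) x)%:E
                     <= (M * \1_E x)%:E)%E &
        exists2 B0, W B0 & forall B, W B -> Boman_chain M W B0 B].

Section spaces.
Context (R : realType) (n : nat).
Implicit Types (p : R) (v u f : 'rV[R]_n.+1 -> R) (E : set 'rV[R]_n.+1)
  (Q : 'rV[R]_n.+1 -> 'M[R]_n.+1) (g : 'rV[R]_n.+1 -> 'cV[R]_n.+1).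
Local Open Scope ereal_scope.

Definition Lp_norm p v E u : \bar R :=
  (\int[lebesgue_rV]_(x in E) (`|u x| `^ p * v x)%:E) `^ p^-1%R.

(* Elements of the spaces are given by representatives: u and u' represent the
   same element when Lp_norm p v E (u - u') = 0, and likewise below. *)
Definition Lp p v E u : Prop := measurable_fun E u /\ Lp_norm p v E u < +oo.

Definition LQ_norm p Q E g : \bar R :=
  (\int[lebesgue_rV]_(x in E) (enorm (sqrtmx (Q x) *m g x) `^ p)%:E)
    `^ p^-1%R.

Definition LQ p Q E g : Prop :=
  (forall i, measurable_fun E (fun x => (g x i 0)%R)) /\ LQ_norm p Q E g < +oo.

(* C^1 on the closure of the open set E, with no regularity of the boundary:
   f is continuous on the closure, differentiable in E, and its gradient on E
   extends continuously to the closure.  Values of f off the closure of E are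
   irrelevant. *)
Definition C1_closure E f : Prop :=
  [/\ {within closure E, continuous f},
      forall x, E x -> differentiable f x &
      exists2 G : 'rV[R]_n.+1 -> 'cV[R]_n.+1,
        {within closure E, continuous G} & forall x, E x -> grad f x = G x].

Definition C1_finite p Q v E f : Prop :=
  C1_closure E f /\ Lp_norm p v E f + LQ_norm p Q E (grad f) < +oo.

(* The completion, described through the limits of Cauchy sequences: a pair in
   L^p(v; E) x LQ^p(E) that is the limit of some (f_k, grad f_k). *)
Definition H1 p Q v E u g : Prop :=
  [/\ Lp p v E u, LQ p Q E g &
      exists f_ : nat -> 'rV[R]_n.+1 -> R,
        [/\ forall k, C1_finite p Q v E (f_ k),
            Lp_norm p v E (f_ k \- u)%R @[k --> \oo] --> 0 &
            LQ_norm p Q E (grad (f_ k) \- g)%R @[k --> \oo] --> 0]].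

Definition H1tilde p Q v E u g : Prop :=
  H1 p Q v E u g /\ \int[lebesgue_rV]_(x in E) (u x * v x)%:E = 0.

(* Since 0 `^ s is 0 for s <> 0 and 1 for s = 0, and Q g = 0 wherever
   sqrt(Q) g = 0, both integrands vanish where sqrt(Q) g, respectively f, does,
   for every p. *)
Definition weak_solution p Q v E f u g : Prop :=
  H1tilde p Q v E u g /\
  forall phi : 'rV[R]_n.+1 -> R,
    C1_closure E phi -> H1tilde p Q v E phi (grad phi) ->
    \int[lebesgue_rV]_(x in E)
      (enorm (sqrtmx (Q x) *m g x) `^ (p - 2)
        * ((grad phi x)^T *m Q x *m g x) 0 0)%:E
    = - \int[lebesgue_rV]_(x in E)
          (`|f x| `^ (p - 2) * f x * phi x * v x)%:E.

Definition p_Neumann p Q v E : Prop :=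
  (forall f, Lp p v E f -> exists u g, weak_solution p Q v E f u g) /\
  (exists2 D : R, (0 < D)%R &
    forall f, Lp p v E f -> forall u g, weak_solution p Q v E f u g ->
      Lp_norm p v E u <= D%:E * Lp_norm p v E f).

End spaces.

(* Main.v *)
Require Import Defs.
From HB Require Import structures.
From mathcomp Require Import all_boot all_order all_algebra.
From mathcomp Require Import all_classical all_reals all_analysis.
From mathcomp Require Import measurable_realfun ring lra.
From mathcomp Require complex mxpoly sesquilinear spectral.
Set Implicit Arguments.
Unset Strict Implicit.
Unset Printing Implicit Defensive.
Import Order.TTheory GRing.Theory Num.Theory.
Import numFieldTopology.Exports numFieldNormedType.Exports.
Local Open Scope classical_set_scope.
Local Open Scope ring_scope.

(* The quadratic form controls [w^(2/p) |xi|^2], so everything rests on the weighted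
   Poincare inequality [int_E |f - b|^p w <= C int_E |grad f|^p w] for [f] of class C^1
   up to the boundary.  On one ball it is obtained by comparing the averages of [f]
   over the contractions [(1 - t) x + t B] at the dyadic scales [t = 2^-k]: consecutive
   averages differ by a local average of [|grad f|], which the [A_p] condition bounds in
   [L^p(w)], and the balls of each scale overlap boundedly.  On a Boman domain the local
   means are chained to the mean over the central ball; the radii of the balls [D] with
   [B] inside [M D] sum to at most a multiple of the size of [E], and doubling allows to
   sum over [B].

   Existence then follows by minimizing
   [int |sqrt(Q) grad phi|^p / p + int |f|^(p-2) f phi w] over the C^1 functions of mean
   zero: the functional is coercive by the Poincare inequality, minimizing sequences are
   Cauchy by uniform convexity, and the Euler-Lagrange equation of the limit is the weak
   formulation.  The estimate for an arbitrary weak solution comes from testing its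
   equation with the C^1 functions that approximate it. *)

(** * Euclidean norm and Lebesgue measure *)

(** On one ball no Riesz potential or maximal function occurs: the only tool besides Hoelder is the
    change of variables under a contraction. Finitely many scales suffice, because a bound for the
    gradient controls the last one. Regularity up to the boundary enters twice: the gradient is
    bounded, which makes all weighted integrals finite, and uniformly continuous, which allows
    differences of averages to be estimated in small steps of the scale. The net point near [x] at
    each scale depends on [x]; summing over a whole separated net removes this choice.

    On a Boman domain only finite families of balls are summed, with constants independent of the
    family, so that a compact part of [E] may grow to [E]. The constant [b] is then a Lebesgue mean
    over the central ball; passing to weighted mean zero costs a factor 2.

    The limit gradient is built componentwise in [L^p(w)], which ellipticity makes equivalent to the
    norm given by [Q]. Minimizers need not be of class C^1, so every comparison is made along the
    minimizing sequence and passed to the limit. *)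

Section euclidean_norm.
Context (R : realType) (m n : nat).
Implicit Types (A B C : 'M[R]_(m, n)) (t : R).

(** The Frobenius inner product; with general shapes it serves row points, column gradients and
    matrices alike. *)
Definition dot A B : R := \sum_i \sum_j A i j * B i j.

Lemma dotC A B : dot A B = dot B A.
Proof. by apply: eq_bigr => i _; apply: eq_bigr => j _; rewrite mulrC. Qed.

Lemma dotDl A B C : dot (A + B) C = dot A C + dot B C.
Proof.
rewrite /dot -big_split; apply: eq_bigr => i _; rewrite -big_split.
by apply: eq_bigr => j _; rewrite mxE mulrDl.
Qed.

Lemma dotZl t A B : dot (t *: A) B = t * dot A B.
Proof.
rewrite /dot mulr_sumr; apply: eq_bigr => i _; rewrite mulr_sumr.
by apply: eq_bigr => j _; rewrite mxE mulrA.
Qed.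

Lemma dotDr A B C : dot A (B + C) = dot A B + dot A C.
Proof. by rewrite dotC dotDl !(dotC A). Qed.

Lemma dotZr t A B : dot A (t *: B) = t * dot A B.
Proof. by rewrite dotC dotZl dotC. Qed.

Lemma dotNl A B : dot (- A) B = - dot A B.
Proof. by rewrite -scaleN1r dotZl mulN1r. Qed.

Lemma dotNr A B : dot A (- B) = - dot A B.
Proof. by rewrite -scaleN1r dotZr mulN1r. Qed.

Lemma dot_ge0 A : 0 <= dot A A.
Proof. by do 2!apply: sumr_ge0 => ? _; rewrite -expr2 sqr_ge0. Qed.

Lemma sqr_enorm A : enorm A ^+ 2 = dot A A.
Proof.
rewrite sqr_sqrtr; last by do 2!apply: sumr_ge0 => ? _; exact: sqr_ge0.
by apply: eq_bigr => i _; apply: eq_bigr => j _; rewrite expr2.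
Qed.

Lemma enorm_ge0 A : 0 <= enorm A. Proof. exact: sqrtr_ge0. Qed.

Lemma enormE A : enorm A = Num.sqrt (dot A A).
Proof. by rewrite -sqr_enorm sqrtr_sqr ger0_norm// enorm_ge0. Qed.

Lemma ler_coef_enorm A i j : `|A i j| <= enorm A.
Proof.
rewrite enormE -sqrtr_sqr ler_wsqrtr//.
rewrite /dot (bigD1 i)//= (bigD1 j)//= -expr2 -addrA lerDl.
by rewrite addr_ge0//; do ?[apply: sumr_ge0 => ? _]; rewrite -expr2 sqr_ge0.
Qed.

Lemma enorm_eq0 A : enorm A = 0 -> A = 0.
Proof.
move=> A0; apply/matrixP => i j; rewrite mxE; apply/eqP.
by rewrite -normr_le0 -A0 ler_coef_enorm.
Qed.

Lemma enorm0 : enorm (0 : 'M[R]_(m, n)) = 0.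
Proof. by rewrite enormE -(scale0r 0) dotZl mul0r sqrtr0. Qed.

Lemma enormZ t A : enorm (t *: A) = `|t| * enorm A.
Proof.
by rewrite !enormE dotZl dotZr mulrA -expr2 sqrtrM ?sqr_ge0// sqrtr_sqr.
Qed.

Lemma enormN A : enorm (- A) = enorm A.
Proof. by rewrite -scaleN1r enormZ normrN1 mul1r. Qed.

Lemma enormB A B : enorm (A - B) = enorm (B - A).
Proof. by rewrite -opprB enormN. Qed.

Lemma ler_dot_enorm A B : `|dot A B| <= enorm A * enorm B.
Proof.
have [B0|Bn0] := eqVneq (enorm B) 0.
  by rewrite (enorm_eq0 B0) -(scale0r B) dotZr mul0r normr0 enormZ normr0 mul0r mulr0.
have Bgt0 : 0 < dot B B.
  by rewrite -sqr_enorm exprn_gt0// lt_neqAle eq_sym Bn0 enorm_ge0.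
rewrite -(@ler_pXn2r _ 2)// ?nnegrE ?mulr_ge0 ?enorm_ge0//.
rewrite exprMn !sqr_enorm real_normK ?num_real// -subr_ge0.
(* This vector is [|B|^2] times the component of [A] orthogonal to [B]; its squared length is
   [b * (a * b - c ^ 2)] in the notation below. *)
have := dot_ge0 (dot B B *: A - dot A B *: B).
rewrite !(dotDl, dotDr, dotNl, dotNr, dotZl, dotZr) (dotC B A).
set a := dot A A; set b := dot B B; set c := dot A B.
rewrite -(pmulr_rge0 _ Bgt0) -/b => h; apply: le_trans h _.
by rewrite le_eqVlt; apply/orP; left; apply/eqP; ring.
Qed.

Lemma enormD A B : enorm (A + B) <= enorm A + enorm B.
Proof.
rewrite -(@ler_pXn2r _ 2)// ?nnegrE ?addr_ge0 ?enorm_ge0//.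
rewrite sqrrD !sqr_enorm dotDl !dotDr (dotC B A).
have := le_trans (ler_norm _) (ler_dot_enorm A B).
lra.
Qed.

Lemma enorm_triangle C A B : enorm (A - B) <= enorm (A - C) + enorm (C - B).
Proof. by rewrite (le_trans _ (enormD _ _))// addrA subrK. Qed.

Lemma enorm_le_sum A : enorm A <= \sum_i \sum_j `|A i j|.
Proof.
have s0 : 0 <= \sum_i \sum_j `|A i j| by do 2!apply: sumr_ge0 => ? _.
rewrite -(@ler_pXn2r _ 2)// ?nnegrE ?enorm_ge0// sqr_enorm expr2 mulr_suml.
apply: ler_sum => i _; rewrite mulr_suml; apply: ler_sum => j _.
rewrite (le_trans (ler_norm _))// normrM ler_wpM2l//.
rewrite (bigD1 i)//= (bigD1 j)//= -addrA lerDl.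
by rewrite addr_ge0//; do ?[apply: sumr_ge0 => ? _].
Qed.

Lemma mx_norm_le_enorm A : `|A| <= enorm A.
Proof.
rewrite [leLHS]mx_normrE; apply: bigmax_le => [|[i j] _]; first exact: enorm_ge0.
exact: ler_coef_enorm.
Qed.

Lemma coef_le_mx_norm A i j : `|A i j| <= `|A|.
Proof.
by rewrite [leRHS]mx_normrE; apply: (@le_bigmax _ _ _ 0 (fun ij => `|A ij.1 ij.2|) (i, j)).
Qed.

Lemma enorm_le_mx_norm A : enorm A <= (m * n)%:R * `|A|.
Proof.
rewrite (le_trans (enorm_le_sum A))//.
rewrite (@le_trans _ _ (\sum_(i < m) \sum_(j < n) `|A|))//.
  by do 2!apply: ler_sum => ? _; exact: coef_le_mx_norm.
by rewrite !sumr_const !card_ord -mulrnA mulnC mulr_natl.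
Qed.

End euclidean_norm.

(** * Lebesgue measure under translations and dilations *)

Section affine.
Context (R : realType) (n : nat).
Local Notation T := 'rV[R]_n.+1.
Local Notation mu := (@lebesgue_rV R n).
Local Notation phi a t := (fun y : T => (a + t *: y)%R).
Implicit Types (a : T) (t : R) (A : set T).

(** Caratheodory's criterion holds because each box of a cover is cut by the hyperplane into two
    boxes whose volumes add up to no more than its own. *)
Lemma measurable_halfspace (i : 'I_n.+1) (c : R) :
  measurable [set x : T | x 0 i <= c].
Proof.
apply: le_caratheodory_measurable => X; apply: le_ereal_inf_tmp => _ [F XF <-].
(* Boxes are open below and closed above, so both pieces are again boxes; if the hyperplane misses
   the box, one piece has a negative side and volume 0. *)
pose F1 k : T * T :=
  ((F k).1, \row_j if j == i then Num.min ((F k).2 0 i) c else (F k).2 0 j).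
pose F2 k : T * T :=
  (\row_j if j == i then Num.max ((F k).1 0 i) c else (F k).1 0 j, (F k).2).
have vol0 (ab : T * T) : (0 <= (box_volume ab)%:E)%E.
  by rewrite lee_fin prodr_ge0// => j _; rewrite le_max lexx.
have volF k : box_volume (F1 k) + box_volume (F2 k) <= box_volume (F k).
  rewrite /box_volume (bigD1 i)//= (bigD1 (F := fun j => Num.max 0 ((F2 k).2 0 j - (F2 k).1 0 j)) i)//=.
  rewrite [leRHS](bigD1 i)//= !mxE eqxx.
  rewrite (@eq_bigr _ _ _ _ _ (fun j => j != i) _
    (fun j => Num.max 0 ((F k).2 0 j - (F k).1 0 j))); last first.
    by move=> j /negbTE ji; rewrite mxE ji.
  rewrite [X in _ + _ * X](@eq_bigr _ _ _ _ _ (fun j => j != i) _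
    (fun j => Num.max 0 ((F k).2 0 j - (F k).1 0 j))); last first.
    by move=> j /negbTE ji; rewrite mxE ji.
  rewrite -mulrDl ler_wpM2r//.
    by apply: prodr_ge0 => j _; rewrite le_max lexx.
  set u := (F k).2 0 i; set l := (F k).1 0 i.
  rewrite /Num.min /Num.max /Order.min /Order.max.
  by repeat case: ifPn; rewrite -?leNgt; lra.
apply: (@le_trans _ _ (\sum_(k <oo) (box_volume (F1 k))%:E + \sum_(k <oo) (box_volume (F2 k))%:E)%E).
  apply: leeD; apply: ereal_inf_lbound.
    exists F1 => // x [/XF[k _ Fkx] xc]; exists k => // j /=; rewrite mxE.
    by have := Fkx j; case: eqP => // -> /andP[-> /=]; rewrite le_min => ->.
  exists F2 => // x [/XF[k _ Fkx] /negP xc]; exists k => // j /=; rewrite mxE.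
  by have := Fkx j; case: eqP => // -> /andP[+ ->]; rewrite gt_max (ltNge c) xc => ->.
rewrite -nneseriesD//; apply: lee_nneseries => [k _ _|k _].
  by rewrite adde_ge0.
by rewrite -EFinD lee_fin volF.
Qed.

(** The preimages of the boxes of a cover of [A] are boxes with sides divided by [t]. *)
Lemma lebesgue_affine_le a t A : 0 < t ->
  (mu ((phi a t) @^-1` A) <= (t ^- n.+1)%:E * mu A)%E.
Proof.
move=> t0; rewrite -lee_pdivrMl ?invr_gt0 ?exprn_gt0// invrK.
apply: le_ereal_inf_tmp => _ [F AF <-].
pose G k : T * T := (t^-1 *: ((F k).1 - a), t^-1 *: ((F k).2 - a)).
have vol0 (ab : T * T) : (0 <= (box_volume ab)%:E)%E.
  by rewrite lee_fin prodr_ge0// => j _; rewrite le_max lexx.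
have volG k : box_volume (F k) = t ^+ n.+1 * box_volume (G k).
  rewrite /box_volume -[X in t ^+ X](card_ord n.+1) -prodr_const -big_split/=.
  apply: eq_bigr => i _; rewrite !mxE maxr_pMr ?ltW// mulr0.
  by congr (Num.max _ _); field; rewrite gt_eqF.
under eq_eseriesr do rewrite volG EFinM.
rewrite nneseriesZl//; apply: lee_wpmul2l; first by rewrite lee_fin exprn_ge0// ltW.
apply: ereal_inf_lbound; exists G => // y /AF[k _ Fk]; exists k => // i.
have := Fk i; rewrite /= !mxE ler_pdivlMl// ltr_pdivrMl//.
by rewrite ltrBlDl lerBrDl.
Qed.

(** The missing inequality is the previous one for the inverse map. *)
Lemma lebesgue_affine a t A : 0 < t ->
  mu ((phi a t) @^-1` A) = ((t ^- n.+1)%:E * mu A)%E.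
Proof.
move=> t0; apply/eqP; rewrite eq_le lebesgue_affine_le//=.
have it0 : 0 < t^-1 by rewrite invr_gt0.
have := @lebesgue_affine_le (- (t^-1 *: a)) t^-1 ((phi a t) @^-1` A) it0.
rewrite -comp_preimage.
have -> : (phi a t) \o (phi (- (t^-1 *: a)) t^-1) = id.
  apply/funext => y /=; rewrite scalerDr scalerN !scalerA mulfV ?gt_eqF//.
  by rewrite !scale1r addrA subrr add0r.
rewrite preimage_id exprVn invrK -lee_pdivrMl ?exprn_gt0//.
Qed.

Lemma measurable_affine a t : 0 < t ->
  measurable_fun [set: T] (phi a t).
Proof.
move=> t0 _ Y mY; rewrite setTI.
change (mu.-caratheodory (phi a t @^-1` Y)) => X.
have it0 : 0 < t^-1 by rewrite invr_gt0.
pose psi (x : T) := - (t^-1 *: a) + t^-1 *: x.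
have phiK y : psi (a + t *: y) = y.
  by rewrite /psi scalerDr scalerA mulVf ?gt_eqF// scale1r addKr.
have eqX Z : X `&` (phi a t) @^-1` Z =
    (phi a t) @^-1` (psi @^-1` X `&` Z).
  by apply/seteqP; split => y /=; rewrite phiK.
rewrite preimage_setC !eqX !lebesgue_affine// -ge0_muleDr ?outer_measure_ge0//.
rewrite -((mY : mu.-caratheodory Y) (psi @^-1` X)) lebesgue_affine// muleA -EFinM exprVn invrK.
by rewrite mulVf ?mul1e// gt_eqF// exprn_gt0.
Qed.

Lemma integral_affine a t (D : set T) (f : T -> \bar R) : 0 < t ->
  measurable D -> measurable_fun D f -> (forall x, D x -> (0 <= f x)%E) ->
  (\int[mu]_(y in (phi a t) @^-1` D) f (a + t *: y)%R =
   (t ^- n.+1)%:E * \int[mu]_(x in D) f x)%E.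
Proof.
move=> t0 mD mf f0.
have mphi := measurable_affine a t0.
rewrite -(@ge0_integral_pushforward _ _ _ _ _ _ mphi mu D f)//; last first.
  by move=> x; rewrite inE => /f0.
have k0 : 0 <= t ^- n.+1 by rewrite invr_ge0 exprn_ge0// ltW.
rewrite (eq_measure_integral (mscale (NngNum k0) mu)); last first.
  by move=> A mA _; rewrite /= /pushforward lebesgue_affine.
by rewrite ge0_integral_mscale.
Qed.

End affine.

(** * Measurability of open sets and volumes of balls *)

Section topology_measure.
Context (R : realType) (n : nat).
Local Notation T := 'rV[R]_n.+1.
Local Notation mu := (@lebesgue_rV R n).

Lemma measurable_coord (i : 'I_n.+1) : measurable_fun [set: T] (fun x : T => x 0 i).
Proof.
apply: (measurability _ (RGenOInfty.measurableE R)).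
move=> _ [_ [c ->] <-]; rewrite setTI.
rewrite (_ : _ @^-1` _ = ~` [set x : T | x 0 i <= c]).
  exact/measurableC/measurable_halfspace.
by apply/seteqP; split => x /=; rewrite in_itv/= andbT ltNge => /negP.
Qed.

(** [A] is the union of the countably many cubes [F (q, m)] with rational centre and half-side [d m]
    that it contains. Two points of such a cube differ by less than [2 * d m] in the max norm, hence
    the choice [d m < e / 2]. *)
Lemma open_measurable_rV (A : set T) : open A -> measurable A.
Proof.
move=> oA.
pose d m : R := m.+1%:R^-1.
have d0 m : 0 < d m by rewrite invr_gt0.
have d_small (e : R) : 0 < e -> exists m, d m < e.
  move=> e0; exists (Num.truncn e^-1); rewrite invf_plt ?posrE//.
  exact: truncnS_gt.
clearbody d.
pose F (qm : 'rV[rat]_n.+1 * nat) : set T :=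
  [set x | forall i, ratr (qm.1 0 i) - d qm.2 < x 0 i /\
                     x 0 i < ratr (qm.1 0 i) + d qm.2].
pose G qm : set T := if `[< F qm `<=` A >] then F qm else set0.
have mF qm : measurable (F qm).
  rewrite (_ : F qm = \bigcap_(i in [set: 'I_n.+1])
     ((fun x : T => x 0 i) @^-1` `](ratr (qm.1 0 i) - d qm.2), (ratr (qm.1 0 i) + d qm.2)[)%classic).
    apply: fin_bigcap_measurable => // i _.
    by rewrite -[X in measurable X]setTI; exact: measurable_coord.
  apply/seteqP; split => [x Fx i _ /=|x Fx i].
    by rewrite in_itv /=; apply/andP.
  by have /= := Fx i I; rewrite in_itv /= => /andP.
rewrite (_ : A = \bigcup_qm G qm).
  apply: countable_bigcupT_measurable => // qm.
  by rewrite /G; case: ifPn => // _; exact: mF.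
apply/seteqP; split => [x Ax|x [qm _]]; last first.
  by rewrite /G; case: ifPn => // /asboolP; apply.
have /nbhs_ballP[e /= e0 xeA] := oA x Ax.
have [m me] := d_small (e / 2) ltac:(by rewrite divr_gt0).
have m0 := d0 m.
have q_ex (i : 'I_n.+1) : exists q : rat, `|x 0 i - ratr q| < d m.
  have [q] := @rat_in_itvoo R (x 0 i - d m) (x 0 i + d m) ltac:(lra).
  rewrite in_itv /= => /andP[q1 q2]; exists q; rewrite ltr_norml; apply/andP; split; lra.
pose q : 'rV[rat]_n.+1 := \row_i xchoose (q_ex i).
have Fx : F (q, m) x.
  move=> i; rewrite /q mxE; have := xchooseP (q_ex i).
  by rewrite ltr_norml => /andP[/= ? ?]; split; lra.
exists (q, m) => //; rewrite /G; case: ifPn => // /asboolP[] y Fy.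
apply: xeA; split=> // i j; rewrite (ord1 i) /ball /=.
have [/= ? ?] := Fx j; have [/= ? ?] := Fy j.
by rewrite ltr_norml; apply/andP; split; lra.
Qed.

Lemma closed_measurable_rV (A : set T) : closed A -> measurable A.
Proof.
by move=> cA; rewrite -[A]setCK; apply/measurableC/open_measurable_rV/closed_openC.
Qed.

Lemma continuous_measurable_rV (D : set T) (f : T -> R) : open D ->
  {in D, continuous f} -> measurable_fun D f.
Proof.
move=> oD cf; apply: (measurability _ (RGenOInfty.measurableE R)).
move=> _ [_ [c ->] <-]; apply: open_measurable_rV.
rewrite openE => x [Dx fx]; rewrite /interior.
apply: filterI; first exact: open_nbhs_nbhs.
have cfx := cf x (mem_set Dx).
apply: cfx; apply: open_nbhs_nbhs; split => //.
Qed.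

Lemma ler_enorm_dist m1 m2 (A B : 'M[R]_(m1, m2)) : `|enorm A - enorm B| <= enorm (A - B).
Proof.
rewrite ler_norml; apply/andP; split.
  by have := enormD A (B - A); rewrite addrC subrK (enormB B A); lra.
by have := enormD B (A - B); rewrite addrC subrK; lra.
Qed.

Lemma enorm_dist_continuous (c : T) : continuous (fun x : T => enorm (x - c) : R^o).
Proof.
move=> x.
apply/(@cvgrPdist_lt R R^o T (nbhs x) (nbhs_filter x)) => e e0; near=> y.
have d0 : 0 < (1 * n.+1)%:R + 1 :> R by rewrite ltr_wpDl.
apply: (@le_lt_trans _ _ (enorm (x - y))).
  by rewrite (le_trans (ler_enorm_dist _ _))// opprB addrA subrK.
rewrite (le_lt_trans (enorm_le_mx_norm _))//.
apply: (@le_lt_trans _ _ (((1 * n.+1)%:R + 1) * `|x - y|)).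
  by rewrite ler_wpM2r// lerDl.
rewrite mulrC -ltr_pdivlMr//; near: y.
by apply: cvgr_dist_lt => //; rewrite divr_gt0.
Unshelve. all: by end_near. Qed.

Lemma open_eball (c : T) r : open (eball c r).
Proof.
have /continuousP/(_ [set s | s < r]) := @enorm_dist_continuous c.
by apply; exact: (@open_lt R).
Qed.

Lemma measurable_eball (c : T) r : measurable (eball c r).
Proof. exact/open_measurable_rV/open_eball. Qed.

Lemma lebesgue_eball (c : T) r : 0 < r ->
  mu (eball c r) = ((r ^+ n.+1)%:E * mu (eball (0 : T) 1))%E.
Proof.
move=> r0; have := lebesgue_affine c (eball c r) r0.
rewrite (_ : _ @^-1` _ = eball (0 : T) 1); last first.
  apply/seteqP; split => y; rewrite /eball /= (addrC c) addrK subr0 enormZ gtr0_norm//.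
    by rewrite gtr_pMr.
  by rewrite gtr_pMr.
move=> ->; rewrite muleA -EFinM mulfV ?mul1e//.
by rewrite gt_eqF// exprn_gt0.
Qed.

Lemma lebesgue_box_lty (a b : T) : (mu (box (a, b)) < +oo)%E.
Proof.
pose F (k : nat) : T * T := if k == 0%N then (a, b) else (0, 0).
apply: (@le_lt_trans _ _ (\sum_(k <oo) (box_volume (F k))%:E)%E).
  by apply: ereal_inf_lbound; exists F => // x xab; exists 0%N.
rewrite (nneseries_split 0 1)//; last first.
  by move=> k _; rewrite lee_fin prodr_ge0// => j _; rewrite le_max lexx.
rewrite eseries0 ?adde0.
  by rewrite big_nat1 ltry.
move=> [//|k] _ _; congr EFin; rewrite /box_volume big_ord_recl/= mxE subrr maxxx mul0r //.
Qed.

Lemma lebesgue_eball_lty (c : T) r : (mu (eball c r) < +oo)%E.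
Proof.
apply: (le_lt_trans _ (lebesgue_box_lty (c - const_mx r) (c + const_mx r))).
apply: le_outer_measure => x; rewrite /eball /= => xr i /=.
have := le_lt_trans (ler_coef_enorm (x - c) 0 i) xr.
by rewrite !mxE ltr_norml => /andP[]; lra.
Qed.

(* If it vanishes, so does the measure ([unit_ball_null]), and everything is trivial. *)
Definition unit_ball_volume : R := fine (mu (eball (0 : T) 1)).
Local Notation kappa := unit_ball_volume.

Lemma unit_ball_volume_ge0 : 0 <= kappa.
Proof. exact/fine_ge0/outer_measure_ge0. Qed.

Lemma lebesgue_eballE (c : T) r : 0 < r ->
  mu (eball c r) = (r ^+ n.+1 * kappa)%:E.
Proof.
move=> r0; rewrite lebesgue_eball// EFinM fineK// ge0_fin_numE ?outer_measure_ge0//.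
exact: lebesgue_eball_lty.
Qed.

Lemma unit_ball_null : kappa = 0 -> forall A : set T, mu A = 0.
Proof.
move=> k0 A; apply/eqP; rewrite eq_le outer_measure_ge0 andbT.
have AT : A `<=` \bigcup_k eball (0 : T) k.+1%:R.
  move=> x _; exists (Num.truncn (enorm x)) => //.
  by rewrite /eball/= subr0; exact: truncnS_gt.
rewrite (le_trans (le_outer_measure mu _ _ AT))//.
rewrite (le_trans (outer_measure_sigma_subadditive mu _))//.
by rewrite eseries0// => k _ _ /=; rewrite lebesgue_eballE// k0 mulr0.
Qed.

End topology_measure.
Arguments unit_ball_volume : clear implicits.

(** * Power inequalities and uniform convexity *)

Section power_inequalities.
Context (R : realType).
Implicit Types (a b c p q r : R).

(** This is Young's inequality for [a ^ (p - 1)] and [b] with exponents [p / (p - 1)] and [p]; in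
    this form the endpoint 0 needs no separate treatment. *)
Lemma powR_tangent p a b : 1 < p -> 0 <= a -> 0 <= b ->
  a `^ p + p * a `^ (p - 1) * (b - a) <= b `^ p.
Proof.
move=> p1 a0 b0; have p0 : 0 < p by lra.
have pB0 : 0 < p - 1 by lra.
have h : (p / (p - 1))^-1 + p^-1 = 1.
  by field; rewrite !gt_eqF.
have := @conjugate_powR R (a `^ (p - 1)) b (p / (p - 1)) p (powR_ge0 _ _) b0
  (divr_gt0 p0 pB0) p0 h.
rewrite -powRrM mulrCA divff ?gt_eqF// mulr1 => H.
have {}H : p * (a `^ (p - 1) * b) <= (p - 1) * a `^ p + b `^ p.
  have -> : (p - 1) * a `^ p + b `^ p = p * (a `^ p / (p / (p - 1)) + b `^ p / p).
    by field; rewrite !gt_eqF.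
  by rewrite ler_pM2l.
have := mulr_powRB1 a0 p0.
set x := a `^ (p - 1) in H *; set y := a `^ p in H *; set z := b `^ p in H * => xy.
rewrite -subr_ge0; have -> : z - (y + p * x * (b - a)) =
  ((p - 1) * y + z - p * (x * b)) + p * (a * x - y) by ring.
by rewrite xy subrr mulr0 addr0 subr_ge0.
Qed.

(** The tangent inequality at the weighted mean [m], summed with the weights: the linear terms
    cancel. The weights are not normalized, whence the power of their sum. *)
Lemma jensen_sum (I : eqType) (s : seq I) (P : pred I) (l c : I -> R) p : 1 < p ->
  (forall i, 0 <= l i) -> (forall i, 0 <= c i) ->
  (\sum_(i <- s | P i) l i * c i) `^ p <=
  (\sum_(i <- s | P i) l i) `^ (p - 1) * \sum_(i <- s | P i) l i * c i `^ p.
Proof.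
move=> p1 l0 c0; have p0 : 0 < p by lra.
set L := \sum_(i <- s | P i) l i; set A := \sum_(i <- s | P i) l i * c i.
have L0 : 0 <= L by apply: sumr_ge0.
have A0 : 0 <= A by apply: sumr_ge0 => i _; exact: mulr_ge0.
have [LE0|Lneq0] := eqVneq L 0.
  have -> : A = 0.
    have /eqP := LE0; rewrite /A /L psumr_eq0 => [/allP h|i _]; last exact: l0.
    elim: (s) h => [_|i s' IH h]; first by rewrite big_nil.
    rewrite big_cons IH => [|j js']; last by apply: h; rewrite in_cons js' orbT.
    case: ifPn => // Pi; have := h i; rewrite mem_head Pi => /(_ isT)/eqP ->.
    by rewrite mul0r addr0.
  by rewrite LE0 powR0 ?gt_eqF// mulr_ge0 ?powR_ge0// sumr_ge0// => i _; rewrite mulr_ge0// powR_ge0.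
have Lgt0 : 0 < L by rewrite lt_neqAle eq_sym Lneq0.
pose m := A / L; have m0 : 0 <= m by rewrite divr_ge0.
have -> : A `^ p = L `^ (p - 1) * (L * m `^ p).
  by rewrite mulrA (mulrC _ L) mulr_powRB1// -powRM// /m mulrCA divff ?mulr1.
rewrite ler_wpM2l ?powR_ge0//.
apply: (@le_trans _ _ (\sum_(i <- s | P i) l i * (m `^ p + p * m `^ (p - 1) * (c i - m)))).
  rewrite le_eqVlt; apply/orP; left; apply/eqP.
  under [RHS]eq_bigr do rewrite mulrDr mulrBr.
  rewrite big_split /= -mulr_suml -/L.
  under eq_bigr do rewrite mulrBr mulrCA (mulrCA (l _)).
  rewrite sumrB -!mulr_sumr -mulr_suml -/A -/L /m.
  by field.
by apply: ler_sum => i _; rewrite ler_wpM2l// powR_tangent.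
Qed.

Lemma powRD_le p a b : 1 < p -> 0 <= a -> 0 <= b ->
  (a + b) `^ p <= 2 `^ (p - 1) * (a `^ p + b `^ p).
Proof.
move=> p1 a0 b0.
have := @jensen_sum bool [:: true; false] xpredT (fun=> 1) (fun x => if x then a else b) p p1.
rewrite !big_cons !big_nil /= !mul1r !addr0; apply => //.
by case.
Qed.

Lemma powR_superadditive r a b : 1 <= r -> 0 <= a -> 0 <= b ->
  a `^ r + b `^ r <= (a + b) `^ r.
Proof.
move=> r1 a0 b0; have r0 : 0 < r by lra.
rewrite -!(@mulr_powRB1 _ _ r)// ?addr_ge0// mulrDl.
by apply: lerD; rewrite ler_wpM2l// ge0_ler_powR ?nnegrE ?subr_ge0 ?addr_ge0// ?lerDl ?lerDr.
Qed.

(** Subtracting [k * x ^ 2] reduces strong convexity to monotonicity of a derivative; [k = 0] is the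
    plain mean value theorem. *)
Lemma powR_quad_MVT r k a b : 0 < a -> a < b ->
  exists2 c, a < c < b & (b `^ r - k * b ^+ 2) - (a `^ r - k * a ^+ 2) =
    (r * c `^ (r - 1) - k * (2 * c)) * (b - a).
Proof.
move=> a0 ab.
have der (x : R) : 0 < x -> is_derive x 1 (fun x : R => x `^ r - k * x ^+ 2)
    (r * x `^ (r - 1) - k * (2 * x)).
  move=> x0; have h := is_derive1_powR r x0.
  apply: is_derive_eq.
  rewrite /GRing.scale /=; ring.
have [||c] := @MVT R (fun x => x `^ r - k * x ^+ 2) (fun c => r * c `^ (r - 1) - k * (2 * c)) a b ab.
- by move=> x; rewrite in_itv /= => /andP[ax _]; apply: der; apply: lt_trans ax.
- apply: derivable_within_continuous => x; rewrite in_itv /= => /andP[ax _].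
  by have [] := der x (lt_le_trans a0 ax).
by rewrite in_itv /= => acb ->; exists c.
Qed.

(** On [(0, 1]] the derivative [r * x ^ (r - 1)] is at least [r], the exponent being
    non-positive. *)
Lemma powR_slope_ge r a b : 0 < r <= 1 -> 0 <= a -> a <= b -> b <= 1 ->
  r * (b - a) <= b `^ r - a `^ r.
Proof.
move=> /andP[r0 r1] a0; rewrite le_eqVlt => /predU1P[-> _|ab b1].
  by rewrite !subrr mulr0.
move: a0; rewrite le_eqVlt => /predU1P[aE|a0].
  rewrite -aE powR0 ?gt_eqF// !subr0.
  have b0 : 0 < b by lra.
  have : b <= b `^ r by apply: ger1_powR; rewrite ?b0.
  by apply: le_trans; rewrite ler_piMl// ltW.
have [c /andP[ac cb]] := powR_quad_MVT r 0 a0 ab; rewrite !mul0r !subr0 => ->.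
have ba : 0 <= b - a by lra.
rewrite ler_wpM2r// ler_peMr ?(ltW r0)//.
have c0 : 0 < c <= 1 by apply/andP; split; lra.
have : c `^ 0 <= c `^ (r - 1) by apply: (@ger_powR _ c _ (r - 1) 0) => //; lra.
by rewrite powRr0.
Qed.

(* The second derivative of [x ^ p] is at least [p (p - 1)] on [0, 1]. *)
Lemma powR_tangent2 p a b : 1 < p <= 2 -> 0 <= a <= 1 -> 0 <= b <= 1 ->
  a `^ p + p * a `^ (p - 1) * (b - a) + p * (p - 1) / 2 * (b - a) ^+ 2 <= b `^ p.
Proof.
move=> /andP[p1 p2] /andP[a0 a1] /andP[b0 b1].
have sq (x : R) : 0 <= x <= 1 -> x ^+ 2 <= x `^ p.
  case/andP; rewrite le_eqVlt => /predU1P[<-|x0] x1.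
    by rewrite expr0n powR_ge0.
  rewrite -powR_mulrn ?(ltW x0)//; by apply: (@ger_powR _ x _ p 2%:R); rewrite ?x0 ?x1.
have r01 : 0 < p - 1 <= 1 by apply/andP; split; lra.
(* The derivative of [x ^ p - p * (p - 1) / 2 * x ^ 2] is nondecreasing on [(0, 1]], by the slope
   bound with exponent [p - 1]. The endpoint 0 is treated directly below. *)
have main (u v c : R) : 0 < u -> u < v -> v <= 1 -> u <= c <= v ->
    (p * u `^ (p - 1) - p * (p - 1) * u <= p * c `^ (p - 1) - p * (p - 1) * c) /\
    (p * c `^ (p - 1) - p * (p - 1) * c <= p * v `^ (p - 1) - p * (p - 1) * v).
  move=> u0 uv v1 /andP[uc cv]; split.
    have := powR_slope_ge r01 (ltW u0) uc (le_trans cv v1).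
    rewrite -(ler_pM2l (_ : 0 < p)); lra.
  have := powR_slope_ge r01 (le_trans (ltW u0) uc) cv v1.
  rewrite -(ler_pM2l (_ : 0 < p)); lra.
have pn0 : p != 0 by rewrite gt_eqF//; lra.
have pBn0 : p - 1 != 0 by rewrite gt_eqF//; lra.
move: a0; rewrite le_eqVlt => /predU1P[aE|a0].
   rewrite -aE !powR0 //.
  rewrite mulr0 mul0r subr0 !add0r (le_trans _ (sq b _)) ?b0//.
  rewrite ler_piMl ?sqr_ge0//; nra.
move: b0; rewrite le_eqVlt => /predU1P[bE|b0].
  rewrite -bE powR0 //.
  have -> : p * a `^ (p - 1) * (0 - a) = - (p * a `^ p).
    by rewrite -(@mulr_powRB1 _ a p)// ?(ltW a0)//; [ring|lra].
  rewrite sub0r sqrrN.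
  have := sq a ltac:(by rewrite a1 ltW); set y := a `^ p => h.
  have : p * (p - 1) / 2 * a ^+ 2 <= (p - 1) * y.
    rewrite (mulrC p) -2!mulrA ler_pM2l; last by lra.
    apply: le_trans h; rewrite mulrA ler_piMl ?sqr_ge0//; lra.
  lra.
have [ab|ba|->] := ltgtP a b; last by rewrite subrr expr0n !mulr0 !addr0.
- have [c /andP[ac cb] h] := powR_quad_MVT p (p * (p - 1) / 2) a0 ab.
  have [h1 _] := main a b c a0 ab b1 ltac:(by apply/andP; split; lra).
  have h2 : (p * a `^ (p - 1) - p * (p - 1) * a) * (b - a) <=
    (p * c `^ (p - 1) - p * (p - 1) * c) * (b - a) by rewrite ler_wpM2r//; lra.
  move: h h2; set x := a `^ p; set y := b `^ p; set x' := a `^ (p - 1); set c' := c `^ (p - 1).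
  move=> h h2; have : (p * x' - p * (p - 1) * a) * (b - a) <=
      y - p * (p - 1) / 2 * b ^+ 2 - (x - p * (p - 1) / 2 * a ^+ 2).
    by rewrite h; lra.
  by rewrite -subr_ge0 => {}h; rewrite -subr_ge0; apply: le_trans h _;
    rewrite le_eqVlt; apply/orP; left; apply/eqP; field.
- have [c /andP[bc ca] h] := powR_quad_MVT p (p * (p - 1) / 2) b0 ba.
  have [_ h1] := main b a c b0 ba a1 ltac:(by apply/andP; split; lra).
  have h2 : (p * c `^ (p - 1) - p * (p - 1) * c) * (a - b) <=
    (p * a `^ (p - 1) - p * (p - 1) * a) * (a - b) by rewrite ler_wpM2r//; lra.
  move: h h2; set x := a `^ p; set y := b `^ p; set x' := a `^ (p - 1); set c' := c `^ (p - 1).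
  move=> h h2; have : x - p * (p - 1) / 2 * a ^+ 2 - (y - p * (p - 1) / 2 * b ^+ 2) <=
      (p * x' - p * (p - 1) * a) * (a - b).
    by rewrite h; lra.
  by rewrite -subr_ge0 => {}h; rewrite -subr_ge0; apply: le_trans h _;
    rewrite le_eqVlt; apply/orP; left; apply/eqP; field.
Qed.

Lemma powR_mul_self a r : 0 <= a -> 0 < r -> a `^ (r - 1) * a = a `^ r.
Proof. by move=> a0 r0; rewrite mulrC mulr_powRB1. Qed.

End power_inequalities.

(** * Uniform convexity of powers of the Euclidean norm *)

Section uniform_convexity.
Context (R : realType) (m n : nat).
Implicit Types (A B : 'M[R]_(m, n)) (p : R).

Lemma parallelogram A B : enorm (2^-1 *: (A + B)) ^+ 2 =
  (enorm A ^+ 2 + enorm B ^+ 2) / 2 - enorm (A - B) ^+ 2 / 4.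
Proof.
rewrite !sqr_enorm !(dotZl, dotZr, dotDl, dotDr, dotNl, dotNr) (dotC B A).
by field.
Qed.

(** The defect of midpoint convexity of the [p]-th power of the norm. *)
Definition midpoint_gap p A B : R :=
  (enorm A `^ p + enorm B `^ p) / 2 - enorm (2^-1 *: (A + B)) `^ p.

(** Clarkson's inequality: with [q = p / 2 >= 1], superadditivity of the power [q] is applied to the
    two sides of the parallelogram law, then Jensen's inequality to the mean of the squares. *)
Lemma uniform_convexity_ge2 p A B : 2 <= p ->
  enorm (A - B) `^ p <= 2 `^ p * midpoint_gap p A B.
Proof.
move=> p2; pose q := p / 2; have q1 : 1 <= q by rewrite /q; lra.
have p0 : p != 0 by rewrite gt_eqF//; lra.
have powE (C : 'M[R]_(m, n)) : enorm C `^ p = (enorm C ^+ 2) `^ q.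
  by rewrite -powR_mulrn ?enorm_ge0// -powRrM /q mulrC divfK.
have -> : enorm (A - B) = 2 * enorm (2^-1 *: (A - B)).
  by rewrite enormZ gtr0_norm ?invr_gt0// mulrA divff// mul1r.
rewrite powRM ?enorm_ge0// ler_wpM2l ?powR_ge0// lerBrDr.
rewrite !powE; apply: le_trans (powR_superadditive q1 _ _) _; rewrite ?sqr_ge0//.
have -> : enorm (2^-1 *: (A - B)) ^+ 2 + enorm (2^-1 *: (A + B)) ^+ 2 =
    2^-1 * enorm A ^+ 2 + 2^-1 * enorm B ^+ 2.
  by rewrite !parallelogram enormN opprK !sqr_enorm !(dotDl, dotDr, dotNl, dotNr) (dotC B A); field.
have [q1'|] := ltP 1 q; last first.
  move=> q1'; have -> : q = 1 by apply/eqP; rewrite eq_le q1 q1'.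
  by rewrite !powRr1 ?addr_ge0 ?mulr_ge0 ?invr_ge0 ?enorm_ge0 ?sqr_ge0//; lra.
have := @jensen_sum R bool [:: true; false] xpredT (fun=> 2^-1)
  (fun x => if x then enorm A ^+ 2 else enorm B ^+ 2) q q1'.
rewrite !big_cons !big_nil /= !addr0 => h.
apply: (le_trans (h _ _)) => [//|[]|]; rewrite ?sqr_ge0//.
rewrite (_ : 2^-1 + 2^-1 = 1); last by field.
by rewrite powR1 mul1r mulrDl !(mulrC 2^-1).
Qed.

(** With [h] the mean of the norms and [z] the norm of the midpoint, the gap splits into
    [(x ^ p + y ^ p) / 2 - h ^ p] and [h ^ p - z ^ p]. Strong convexity on [[0, 1]] bounds both by
    quadratic terms, which add up to [enorm (A - B) ^ 2] by the parallelogram law. *)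
Lemma midpoint_gap_ball p A B : 1 < p <= 2 -> enorm A <= 1 -> enorm B <= 1 ->
  p * (p - 1) / 8 * enorm (A - B) ^+ 2 <= midpoint_gap p A B.
Proof.
move=> /[dup] p12 /andP[p1 p2] A1 B1.
set x := enorm A; set y := enorm B; set z := enorm (2^-1 *: (A + B)).
have x0 : 0 <= x by exact: enorm_ge0.
have y0 : 0 <= y by exact: enorm_ge0.
have z0 : 0 <= z by exact: enorm_ge0.
pose h := (x + y) / 2.
have zh : z <= h.
  rewrite /z enormZ gtr0_norm ?invr_gt0// /h mulrC ler_wpM2r ?invr_ge0//.
  exact: enormD.
have k0 : 0 < p * (p - 1) / 2 by rewrite divr_gt0// mulr_gt0//; lra.
have h01 : 0 <= h <= 1.
  by rewrite divr_ge0 ?addr_ge0//= /h ler_pdivrMr// mul1r; move: A1 B1; rewrite -/x -/y; lra.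
have x01 : 0 <= x <= 1 by rewrite x0.
have y01 : 0 <= y <= 1 by rewrite y0.
have z01 : 0 <= z <= 1 by rewrite z0 (le_trans zh)//; move: h01 => /andP[].
have Tx := powR_tangent2 p12 h01 x01.
have Ty := powR_tangent2 p12 h01 y01.
have Tz := powR_tangent2 p12 z01 h01.
(* Since [p - 1 <= 1], the linear term of the expansion at [z] is at least
   [p * (p - 1) * z * (h - z)], which completes the square to [h ^ 2 - z ^ 2]. *)
have zp : z <= z `^ (p - 1).
  have [->|zn0] := eqVneq z 0; first exact: powR_ge0.
  have zgt0 : 0 < z by rewrite lt_neqAle eq_sym zn0 z0.
  by apply: ger1_powR; [rewrite zgt0; case/andP: z01|lra].
have D : enorm (A - B) ^+ 2 = 2 * (x ^+ 2 + y ^+ 2) - 4 * z ^+ 2.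
  by rewrite /z parallelogram -/x -/y; field.
rewrite D /midpoint_gap -/x -/y -/z.
have Hzp : p * (p - 1) * z * (h - z) <= p * z `^ (p - 1) * (h - z).
  rewrite ler_wpM2r ?subr_ge0// -mulrA ler_pM2l; last by lra.
  by apply: le_trans zp; rewrite ler_piMl//; lra.
move: Tx Ty Tz Hzp; set k := p * (p - 1) in k0 *.
set X := x `^ p; set Y := y `^ p; set Z := z `^ p; set H := h `^ p.
set H' := p * h `^ (p - 1); set Z' := p * _.
move=> Tx Ty Tz Hzp.
have Txy : H + k / 2 * ((x - h) ^+ 2 + (y - h) ^+ 2) / 2 <= (X + Y) / 2.
  have : H' * (x - h) + H' * (y - h) = 0 by rewrite /h; field.
  lra.
have Tz' : Z + k / 2 * (h ^+ 2 - z ^+ 2) <= H.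
  have : k / 2 * (h ^+ 2 - z ^+ 2) = k * z * (h - z) + k / 2 * (h - z) ^+ 2 by field.
  lra.
have : k / 8 * (2 * (x ^+ 2 + y ^+ 2) - 4 * z ^+ 2) =
    k / 2 * ((x - h) ^+ 2 + (y - h) ^+ 2) / 2 + k / 2 * (h ^+ 2 - z ^+ 2).
  by rewrite /h; field.
lra.
Qed.

Lemma midpoint_gapZ p t A B : 0 <= t ->
  midpoint_gap p (t *: A) (t *: B) = t `^ p * midpoint_gap p A B.
Proof.
move=> t0; rewrite /midpoint_gap -scalerDr scalerA (mulrC 2^-1) -scalerA.
rewrite ![enorm (t *: _)]enormZ ger0_norm// !powRM ?enorm_ge0//.
by field.
Qed.

(** For [p < 2] homogeneity reduces to the unit ball. There, either the distance [D] is at most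
    [d = e ^ (1 / p)] and the first term suffices, or [D ^ p <= d ^ (p - 2) * D ^ 2], which the
    quadratic bound controls. *)
Lemma uniform_convexity p e : 1 < p -> 0 < e -> exists2 C : R, 0 <= C &
  forall A B, enorm (A - B) `^ p <=
    e * (enorm A `^ p + enorm B `^ p) + C * midpoint_gap p A B.
Proof.
move=> p1 e0; have [p2|p2] := leP 2 p.
  exists (2 `^ p); first exact: powR_ge0.
  move=> A B; apply: le_trans (uniform_convexity_ge2 A B p2) _.
  by rewrite lerDr mulr_ge0 ?addr_ge0 ?powR_ge0// ltW.
have p0 : 0 < p by lra.
have k0 : 0 < p * (p - 1) / 8 by rewrite divr_gt0// mulr_gt0//; lra.
pose d := e `^ p^-1; have d0 : 0 < d by exact: powR_gt0.
pose C := d `^ (p - 2) / (p * (p - 1) / 8).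
have C0 : 0 <= C by rewrite divr_ge0 ?powR_ge0// ltW.
exists C => // A B.
have [r [rA rB r_le]] : exists r, [/\ enorm A <= r, enorm B <= r &
    r `^ p <= enorm A `^ p + enorm B `^ p].
  have [AB|/ltW BA] := leP (enorm A) (enorm B).
    by exists (enorm B); rewrite lexx AB lerDr powR_ge0.
  by exists (enorm A); rewrite lexx BA lerDl powR_ge0.
have r0 : 0 <= r by exact: le_trans (enorm_ge0 A) rA.
move: r0; rewrite le_eqVlt => /predU1P[rE|r0].
  have A0 : A = 0 by apply/enorm_eq0/eqP; rewrite eq_le enorm_ge0 rE rA.
  have B0 : B = 0 by apply/enorm_eq0/eqP; rewrite eq_le enorm_ge0 rE rB.
  rewrite A0 B0 /midpoint_gap addr0 scaler0 subrr enorm0 powR0 ?gt_eqF//.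
  by rewrite !addr0 mul0r subrr !mulr0 addr0.
have scale (M : 'M[R]_(m, n)) : M = r *: (r^-1 *: M).
  by rewrite scalerA divff ?gt_eqF// scale1r.
pose A' := r^-1 *: A; pose B' := r^-1 *: B.
have unit M : enorm M <= r -> enorm (r^-1 *: M) <= 1.
  by move=> Mr; rewrite enormZ gtr0_norm ?invr_gt0// mulrC ler_pdivrMr// mul1r.
have gap0 : p * (p - 1) / 8 * enorm (A' - B') ^+ 2 <= midpoint_gap p A' B'.
  by apply: midpoint_gap_ball; rewrite ?unit// p1 ltW.
suff key : enorm (A' - B') `^ p <= e + C * midpoint_gap p A' B'.
  have eAB : enorm (A - B) = r * enorm (A' - B').
    by rewrite -scalerBr enormZ gtr0_norm ?invr_gt0// mulrA divff ?mul1r// gt_eqF.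
  have gAB : midpoint_gap p A B = r `^ p * midpoint_gap p A' B'.
    by rewrite -(midpoint_gapZ _ _ _ (ltW r0)) -!scale.
  rewrite eAB gAB powRM ?enorm_ge0 ?(ltW r0)//.
  apply: le_trans (ler_wpM2l (powR_ge0 r p) key) _.
  by rewrite mulrDr mulrCA lerD2r mulrC ler_pM2l.
set D := enorm (A' - B') in gap0 *.
have D0 : 0 <= D by exact: enorm_ge0.
have gap_ge0 : 0 <= midpoint_gap p A' B'.
  by apply: le_trans gap0; rewrite mulr_ge0 ?sqr_ge0// ltW.
have [Dd|dD] := leP D d.
  apply: (@le_trans _ _ e); last by rewrite lerDl mulr_ge0.
  have -> : e = d `^ p by rewrite /d -powRrM mulVf ?gt_eqF// powRr1// ltW.
  by apply: ge0_ler_powR; rewrite ?nnegrE ?(ltW p0) ?(ltW d0).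
apply: (@le_trans _ _ (C * midpoint_gap p A' B')); last by rewrite lerDr ltW.
apply: (@le_trans _ _ (C * (p * (p - 1) / 8 * D ^+ 2))); last by rewrite ler_wpM2l.
have Dgt0 : 0 < D by exact: lt_trans dD.
rewrite /C mulrA divfK ?gt_eqF// -powR_mulrn//.
have -> : D `^ p = D `^ (p - 2) * D `^ 2%:R.
  by rewrite -powRD ?(gt_eqF Dgt0) ?implybT// subrK.
rewrite ler_wpM2r ?powR_ge0//.
have -> : p - 2 = - (2 - p) by ring.
rewrite !powRN lef_pV2 ?posrE ?powR_gt0//.
by apply: ge0_ler_powR; rewrite ?nnegrE ?(ltW Dgt0) ?(ltW d0) ?(ltW dD)//; lra.
Qed.

End uniform_convexity.

(** * Square roots of positive semi-definite matrices *)

Section square_root.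
Import complex mxpoly sesquilinear spectral.
Context (R : realType).

Lemma interpolation (s : seq R) (g : R -> R) :
  exists r : {poly R}, {in s, forall x, r.[x] = g x}.
Proof.
elim: s => [|x s [r rg]]; first by exists 0.
have [xs|xs] := boolP (x \in s).
  by exists r => y; rewrite in_cons => /predU1P[->|]; exact: rg.
pose m := \prod_(y <- s) ('X - y%:P).
have mx : m.[x] != 0 by rewrite -rootE root_prod_XsubC.
exists (r + ((g x - r.[x]) / m.[x]) *: m) => y; rewrite in_cons hornerD hornerZ.
move=> /predU1P[->|ys]; first by rewrite divfK// addrC subrK.
have /rootP -> : root m y by rewrite root_prod_XsubC.
by rewrite mulr0 addr0 rg.
Qed.

Lemma quadform_sqr n (S : 'M[R]_n) (xi : 'cV[R]_n) : S^T = S ->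
  quadform (S *m S) xi = enorm (S *m xi) ^+ 2.
Proof.
move=> symS; rewrite sqr_enorm /quadform mulmxA -mulmxA -{1}symS -trmx_mul.
rewrite mxE /dot; apply: eq_bigr => i _.
by rewrite big_ord1 mxE.
Qed.

Lemma horner_conj_diag (F : fieldType) n (M P : 'M[F]_n.+1) (d e : 'rV[F]_n.+1) q :
  P \is a GRing.unit -> M = invmx P *m diag_mx d *m P ->
  (forall i, q.[d 0 i] = e 0 i) -> horner_mx M q = invmx P *m diag_mx e *m P.
Proof.
move=> uP -> qde; rewrite horner_mx_uconjC// horner_mx_diag.
by congr (_ *m diag_mx _ *m _); apply/rowP => i; rewrite mxE.
Qed.

Lemma conj_diag_pow4 (F : fieldType) n (M X P : 'M[F]_n.+1) (d e : 'rV[F]_n.+1) :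
  P \is a GRing.unit -> M = invmx P *m diag_mx d *m P ->
  X = invmx P *m diag_mx e *m P -> (forall i, e 0 i ^+ 4 = d 0 i) ->
  X *m X *m (X *m X) = M.
Proof.
move=> uP -> -> ed.
have conjM (A B : 'M[F]_n.+1) :
    invmx P *m A *m P *m (invmx P *m B *m P) = invmx P *m (A *m B) *m P.
  by rewrite !mulmxA mulmxK.
rewrite !conjM !mulmx_diag; congr (_ *m diag_mx _ *m _).
by apply/rowP => i; rewrite !mxE -ed -!expr2 -exprM.
Qed.

(* Interpolating [x ^ (1/4)] at the eigenvalues by a real polynomial [r] makes [r(A)]
   real and symmetric although the diagonalization is complex; its square is then
   positive semi-definite. *)
Lemma sqrtmx_exists n (A : 'M[R]_n.+1) : psdmx A ->
  exists S, psdmx S /\ S *m S = A.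
Proof.
move=> [symA psdA].
pose f := real_complex R.
pose Ac := map_mx f A.
have hA : Ac \is hermsymmx.
  apply/is_hermitianmxP; rewrite expr0 scale1r; apply/matrixP => i j.
  rewrite !mxE /= -{1}symA mxE.
  by apply/eqP; rewrite eq_complex /= oppr0 !eqxx.
have nA := hermitian_normalmx hA.
have /orthomx_spectralP AE := nA.
set P := spectralmx Ac in AE; set d := spectral_diag Ac in AE.
have uP : P \is unitarymx by exact: spectral_unitarymx.
have P_unit : P \is a GRing.unit by exact: spectral_unit.
have d_real i : f (complex.Re (d 0 i)) = d 0 i.
  by apply/RRe_real; have /mxOverP := hermitian_spectral_diag_real hA; apply.
(* The eigenvalue is the Hermitian form of [A] at the [i]-th row of the unitary [P]; its real part
   is the sum of the real form at the real and at the imaginary part of that row. *)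
have d_ge0 i : 0 <= complex.Re (d 0 i).
  have dE : diag_mx d = P *m Ac *m invmx P.
    by rewrite AE !mulmxA mulmxV// mul1mx mulmxK.
  have : d 0 i = (P *m Ac *m invmx P) i i by rewrite -dE mxE eqxx mulr1n.
  rewrite (invmx_unitary uP) => ->.
  have -> : complex.Re ((P *m Ac *m (P ^t*)%sesqui) i i) =
     quadform A (\col_j complex.Re (P i j)) + quadform A (\col_j complex.Im (P i j)).
    rewrite /quadform !mxE -big_split /= raddf_sum; apply: eq_bigr => j _.
    rewrite !mxE !mulr_suml raddf_sum -big_split; apply: eq_bigr => k _ /=.
    rewrite !mxE.
    case: (P i k) => a b; case: (P i j) => a' b' /=; ring.
  by rewrite addr_ge0.
have [r rE] := interpolation [seq complex.Re (d 0 i) | i : 'I_n.+1]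
  (fun x => Num.sqrt (Num.sqrt x)).
pose S0 := horner_mx A r.
pose e := map_mx (f \o (fun z => Num.sqrt (Num.sqrt (complex.Re z)))) d.
have S0E : map_mx f S0 = invmx P *m diag_mx e *m P.
  apply: etrans (map_horner_mx f A r) (horner_conj_diag P_unit AE _) => i.
  rewrite [RHS]mxE -{1}d_real horner_map /= rE//.
  by apply/mapP; exists i => //; rewrite mem_enum.
have symS0 : S0^T = S0.
  rewrite /S0; move: (r); elim/poly_ind => [|q c IH].
    by rewrite rmorph0 trmx0.
  rewrite rmorphD rmorphM /= horner_mx_X horner_mx_C linearD /= trmx_mul.
  by rewrite tr_scalar_mx symA IH; congr (_ + _); apply: comm_mx_horner.
exists (S0 *m S0); split.
  split; first by rewrite trmx_mul symS0.
  by move=> xi; rewrite quadform_sqr// sqr_ge0.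
apply: (@map_mx_inj _ _ f).
rewrite !map_mxM; apply: (conj_diag_pow4 P_unit AE S0E) => i.
rewrite mxE /= -rmorphXn /= (exprM _ 2 2) !sqr_sqrtr ?sqrtr_ge0//.
Qed.

Lemma sqrtmxP n (A : 'M[R]_n.+1) : psdmx A ->
  psdmx (sqrtmx A) /\ sqrtmx A *m sqrtmx A = A.
Proof. by move=> /sqrtmx_exists; exact: xgetPex. Qed.

Lemma sqr_enorm_sqrtmx n (A : 'M[R]_n.+1) xi : psdmx A ->
  enorm (sqrtmx A *m xi) ^+ 2 = quadform A xi.
Proof.
by move=> /sqrtmxP[[symS _] {2}<-]; rewrite quadform_sqr.
Qed.

End square_root.

(** * Integral inequalities and Muckenhoupt weights *)

Section integral_inequalities.
Context d (T : measurableType d) (R : realType) (mu : {measure set T -> \bar R}).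
Implicit Types (D : set T) (f g : T -> R) (p q : R).

Lemma measurable_powR_fun D f s :
  measurable_fun D f -> measurable_fun D (fun x => f x `^ s).
Proof. by move=> mf; exact: measurableT_comp (measurable_powR s) mf. Qed.

Lemma measurable_sqrt_fun D f : (forall x, 0 <= f x) ->
  measurable_fun D f -> measurable_fun D (fun x => Num.sqrt (f x)).
Proof.
move=> f0 mf; under eq_fun do rewrite -powR12_sqrt//.
exact: measurable_powR_fun.
Qed.

Lemma measurable_enorm n D (g : T -> 'cV[R]_n) :
  (forall i, measurable_fun D (fun x => g x i 0)) ->
  measurable_fun D (fun x => enorm (g x)).
Proof.
move=> mg; apply: measurable_sqrt_fun => [x|].
  by do 2!apply: sumr_ge0 => ? _; exact: sqr_ge0.
by do 2!apply: measurable_sum => ?; apply: measurable_funX; rewrite ord1.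
Qed.

(** Extension by zero carries the inequalities of Hoelder and Minkowski from the whole space to [D];
    [p] must not be 0, as [0 ^ 0 = 1]. *)
Lemma Lnorm_restrict D f p : p != 0 -> (forall x, D x -> 0 <= f x) ->
  Lnorm mu p%:E (EFin \o (f \_ D)) =
  ((\int[mu]_(x in D) (f x `^ p)%:E) `^ p^-1)%E.
Proof.
move=> p0 f0; rewrite unlock; congr (_ `^ _)%E.
rewrite [RHS]integral_mkcond; apply: eq_integral => x _ /=.
rewrite !patchE; case: ifPn => [|_]; last by rewrite normr0 powR0.
by rewrite inE => /f0 fx; rewrite ger0_norm.
Qed.

Lemma hoelder_set D f g p q : measurable D ->
  measurable_fun D f -> measurable_fun D g ->
  (forall x, D x -> 0 <= f x) -> (forall x, D x -> 0 <= g x) ->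
  0 < p -> 0 < q -> p^-1 + q^-1 = 1 ->
  (\int[mu]_(x in D) (f x * g x)%:E <=
   (\int[mu]_(x in D) (f x `^ p)%:E) `^ p^-1 *
   (\int[mu]_(x in D) (g x `^ q)%:E) `^ q^-1)%E.
Proof.
move=> mD mf mg f0 g0 p0 q0 pq.
have mfD : measurable_fun setT (f \_ D) by apply/(measurable_restrictT _ mD).
have mgD : measurable_fun setT (g \_ D) by apply/(measurable_restrictT _ mD).
have := hoelder mu mfD mgD p0 q0 pq.
rewrite (Lnorm_restrict (lt0r_neq0 p0) f0) (Lnorm_restrict (lt0r_neq0 q0) g0); apply: le_trans.
rewrite Lnorm1 [leLHS]integral_mkcond le_eqVlt; apply/orP; left; apply/eqP.
apply: eq_integral => x _ /=; rewrite !patchE; case: ifPn => [|_].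
  by rewrite inE => Dx; rewrite ger0_norm// mulr_ge0 ?f0 ?g0.
by rewrite mul0r normr0.
Qed.

Lemma minkowski_set D f g p : measurable D ->
  measurable_fun D f -> measurable_fun D g ->
  (forall x, D x -> 0 <= f x) -> (forall x, D x -> 0 <= g x) -> 1 <= p ->
  ((\int[mu]_(x in D) ((f x + g x) `^ p)%:E) `^ p^-1 <=
   (\int[mu]_(x in D) (f x `^ p)%:E) `^ p^-1 +
   (\int[mu]_(x in D) (g x `^ p)%:E) `^ p^-1)%E.
Proof.
move=> mD mf mg f0 g0 p1.
have p0 : 0 < p by exact: lt_le_trans p1.
have mfD : measurable_fun setT (f \_ D) by apply/(measurable_restrictT _ mD).
have mgD : measurable_fun setT (g \_ D) by apply/(measurable_restrictT _ mD).
have := minkowski_EFin mu mfD mgD p1.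
rewrite (Lnorm_restrict (lt0r_neq0 p0) f0) (Lnorm_restrict (lt0r_neq0 p0) g0); apply: le_trans.
have -> : (f \_ D \+ g \_ D)%R = (f \+ g)%R \_ D.
  by apply/funext => x /=; rewrite !patchE; case: ifPn => // _; rewrite addr0.
by rewrite (Lnorm_restrict (lt0r_neq0 p0))// => x Dx; rewrite addr_ge0 ?f0 ?g0.
Qed.

Lemma le_integral_nonneg D f g : measurable D ->
  measurable_fun D f -> measurable_fun D g ->
  (forall x, D x -> 0 <= f x <= g x) ->
  (\int[mu]_(x in D) (f x)%:E <= \int[mu]_(x in D) (g x)%:E)%E.
Proof.
move=> mD mf mg fg; apply: ge0_le_integral => //.
- by move=> x /fg/andP[? _]; rewrite lee_fin.
- exact/measurable_EFinP.
- exact/measurable_EFinP.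
- by move=> x /fg/andP[_ ?]; rewrite lee_fin.
Qed.

Lemma integralZl_nonneg D f k : measurable D -> measurable_fun D f ->
  (forall x, D x -> 0 <= f x) -> 0 <= k ->
  (\int[mu]_(x in D) (k * f x)%:E = k%:E * \int[mu]_(x in D) (f x)%:E)%E.
Proof.
move=> mD mf f0 k0; under eq_integral do rewrite EFinM.
rewrite ge0_integralZl_EFin//; exact/measurable_EFinP.
Qed.

Lemma integralD_nonneg D f g : measurable D ->
  measurable_fun D f -> measurable_fun D g ->
  (forall x, D x -> 0 <= f x) -> (forall x, D x -> 0 <= g x) ->
  (\int[mu]_(x in D) (f x + g x)%:E =
   \int[mu]_(x in D) (f x)%:E + \int[mu]_(x in D) (g x)%:E)%E.
Proof.
move=> mD mf mg f0 g0; under eq_integral do rewrite EFinD.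
by rewrite ge0_integralD//; exact/measurable_EFinP.
Qed.

Lemma integral_sum_nonneg (I : Type) (s : seq I) (F : I -> T -> R) D :
  measurable D -> (forall i, measurable_fun D (F i)) ->
  (forall i x, D x -> 0 <= F i x) ->
  (\int[mu]_(x in D) (\sum_(i <- s) F i x)%:E =
   \sum_(i <- s) \int[mu]_(x in D) (F i x)%:E)%E.
Proof.
move=> mD mF F0; rewrite -ge0_integral_sum//.
- by apply: eq_integral => x _; rewrite sumEFin.
- by move=> i; apply/measurable_EFinP.
Qed.

Lemma integral_setI_indic D A f : measurable D -> measurable A ->
  (\int[mu]_(x in A `&` D) (f x)%:E = \int[mu]_(x in D) (\1_A x * f x)%:E)%E.
Proof.
move=> mD mA; rewrite setIC integral_mkcondr.
apply: eq_integral => x _; rewrite patchE indicE.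
by case: (x \in A); rewrite ?mul1r ?mul0r.
Qed.

Lemma sum_integral_overlap (I : Type) (s : seq I) (A : I -> set T)
    D f (L : R) : measurable D -> (forall i, measurable (A i)) ->
  measurable_fun D f -> (forall x, D x -> 0 <= f x) ->
  (forall x, D x -> \sum_(i <- s) \1_(A i) x <= L) ->
  (\sum_(i <- s) \int[mu]_(x in A i `&` D) (f x)%:E <=
   L%:E * \int[mu]_(x in D) (f x)%:E)%E.
Proof.
move=> mD mA mf f0 AL.
have mAf i : measurable_fun D (fun x => \1_(A i) x * f x).
  by apply: measurable_funM => //; exact: measurable_indic.
under eq_bigr do rewrite integral_setI_indic//.
rewrite -integral_sum_nonneg//; last first.
  by move=> i x /f0 fx; rewrite mulr_ge0.
have [[y Dy]|D0] := pselect (exists y, D y); last first.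
  have -> : D = set0 by apply/seteqP; split => // x Dx; apply: D0; exists x.
  by rewrite !integral_set0 mule0.
have L0 : 0 <= L by apply: le_trans (AL y Dy); apply: sumr_ge0.
rewrite -integralZl_nonneg//; apply: le_integral_nonneg => //.
- by apply: measurable_sum => i; exact: mAf.
- by apply: measurable_funM => //.
- move=> x Dx; rewrite sumr_ge0 => [|i _]; last by rewrite mulr_ge0 ?f0.
  by rewrite -mulr_suml ler_wpM2r ?AL ?f0.
Qed.

End integral_inequalities.

Record Ap_bound (R : realType) (n : nat) (p : R) (w : 'rV[R]_n.+1 -> R) (K : R)
    : Prop := {
  Ap_gt1 : 1 < p;
  Ap_ge0 : forall x, 0 <= w x;
  Ap_measurable : measurable_fun setT w;
  Ap_gt0 : {ae (@lebesgue_rV R n), forall x, 0 < w x};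
  Ap_sup : forall c (r : R), 0 < r ->
    (Ap_quotient p w (eball c r) <= K%:E)%E }.

(** * Consequences of the A_p condition on a ball *)

Section Muckenhoupt.
Context (R : realType) (n : nat).
Local Notation T := 'rV[R]_n.+1.
Local Notation mu := (@lebesgue_rV R n).
Local Notation kappa := (unit_ball_volume R n).
Context (p : R) (w : T -> R) (K : R).
Hypothesis kappa0 : 0 < kappa.
Hypothesis pw : Ap_bound p w K.
Let p1 := Ap_gt1 pw.
Let w_ge0 := Ap_ge0 pw.
Let w_meas := Ap_measurable pw.
Let w_gt0 := Ap_gt0 pw.
Let w_Ap := Ap_sup pw.

Let p_gt0 : 0 < p. Proof. exact: lt_trans p1. Qed.

Lemma conjugate_gt0 : 0 < conjugate p.
Proof. by rewrite invr_gt0 subr_gt0 invf_lt1. Qed.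

Lemma conjugateD : p^-1 + (conjugate p)^-1 = 1.
Proof. by rewrite /conjugate invrK addrC subrK. Qed.

(** The dual weight, whose average is the second factor of the A_p quotient. *)
Let sigma x := w x `^ (1 - conjugate p).

Lemma measurable_weight (D : set T) : measurable_fun D w.
Proof. exact: measurable_funS w_meas. Qed.

Let b_gt0 r : 0 < r -> 0 < r ^+ n.+1 * kappa.
Proof. by move=> r0; rewrite mulr_gt0// exprn_gt0. Qed.

(** The A_p condition with the averages cleared: the volume occurs once in the first and [p - 1]
    times in the second factor. *)
Lemma Ap_product c (r : R) : 0 < r ->
  (\int[mu]_(x in eball c r) (w x)%:E *
   (\int[mu]_(x in eball c r) (sigma x)%:E) `^ (p - 1) <=
   (K * (r ^+ n.+1 * kappa) `^ p)%:E)%E.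
Proof.
move=> r0; have := w_Ap c r0; rewrite /Ap_quotient /average lebesgue_eballE//.
have b0 := b_gt0 r0; set b := _ * kappa in b0 *.
set W := (\int[_]_(x in _) (w x)%:E)%E; rewrite -/sigma.
set S := (\int[_]_(x in _) (sigma x)%:E)%E => h.
have W0 : (0 <= W)%E by apply: integral_ge0 => x _; rewrite lee_fin.
have S0 : (0 <= S)%E by apply: integral_ge0 => x _; rewrite lee_fin powR_ge0.
have bE : ((b%:E)^-1 = (b^-1)%:E)%E by rewrite inver gt_eqF.
have bi0 : 0 <= b^-1 by rewrite invr_ge0 ltW.
rewrite !bE poweRM ?lee_fin// poweR_EFin in h.
rewrite (_ : (K * b `^ p)%:E = ((b `^ p)%:E * K%:E)%E); last by rewrite -EFinM mulrC.
apply: le_trans (lee_wpmul2l _ h); last by rewrite lee_fin powR_ge0.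
rewrite le_eqVlt; apply/orP; left; apply/eqP.
rewrite muleACA -EFinM muleA -EFinM.
have -> : b `^ p * (b^-1 * b^-1 `^ (p - 1)) = 1.
  by rewrite mulr_powRB1// -powRM ?(ltW b0)// divff ?gt_eqF// powR1.
by rewrite mul1e.
Qed.

(* For [h = 1] this is the doubling property of [w]. *)
Lemma Ap_hoelder c (r : R) (A : set T) (h : T -> R) (a : R) : 0 < r ->
  measurable A -> A `<=` eball c r ->
  measurable_fun A h -> (forall x, A x -> 0 <= h x) ->
  (\int[mu]_(x in A) (h x)%:E)%E = a%:E ->
  ((a `^ p)%:E * \int[mu]_(x in eball c r) (w x)%:E <=
   (K * (r ^+ n.+1 * kappa) `^ p)%:E * \int[mu]_(x in A) (h x `^ p * w x)%:E)%E.
Proof.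
move=> r0 mA AB mh h0 ha.
set q := conjugate p; have q0 : 0 < q := conjugate_gt0.
have pq : p^-1 + q^-1 = 1 := conjugateD.
(* Hoelder for [h = f * g], valid where [w > 0]. As [q / p = q - 1], the power [g ^ q] is the dual
   weight, to which the A_p condition applies. *)
pose f x := h x * w x `^ p^-1; pose g x := w x `^ (- p^-1).
have mf : measurable_fun A f.
  exact: (measurable_funM mh (measurable_powR_fun _ (@measurable_weight A))).
have mg : measurable_fun A g by apply: measurable_powR_fun; exact: measurable_weight.
have f0 x : A x -> 0 <= f x by move=> Ax; rewrite mulr_ge0 ?h0 ?powR_ge0.
have g0 x : A x -> 0 <= g x by move=> Ax; exact: powR_ge0.
have H := hoelder_set mu mA mf mg f0 g0 p_gt0 q0 pq.
set B := (\int[mu]_(x in A) (h x `^ p * w x)%:E)%E.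
have fE : (\int[mu]_(x in A) (f x `^ p)%:E = B)%E.
  apply: eq_integral => x; rewrite inE => Ax; congr EFin.
  by rewrite powRM ?h0 ?powR_ge0// -powRrM mulVf ?gt_eqF// powRr1.
have gE : (\int[mu]_(x in A) (g x `^ q)%:E = \int[mu]_(x in A) (sigma x)%:E)%E.
  apply: eq_integral => x; rewrite inE => Ax; congr EFin.
  rewrite -powRrM /sigma -/q; congr (_ `^ _).
  have : q * (p^-1 + q^-1) = q * 1 by rewrite pq.
  by rewrite mulrDr divff ?gt_eqF// mulr1 mulNr mulrC; lra.
have fgE : (\int[mu]_(x in A) (f x * g x)%:E = a%:E)%E.
  rewrite -ha; apply: ae_eq_integral; first exact: mA.
  - by apply/measurable_EFinP; exact: (measurable_funM mf mg).
  - by apply/measurable_EFinP; exact: mh.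
  - move: w_gt0; apply: filterS => x wx _; congr EFin.
    by rewrite /f /g powRN -mulrA divff ?mulr1// gt_eqF// powR_gt0.
rewrite fE gE fgE in H.
set S := (\int[mu]_(x in A) (sigma x)%:E)%E in H.
have B0 : (0 <= B)%E.
  by apply: integral_ge0 => x Ax; rewrite lee_fin mulr_ge0 ?powR_ge0.
have S0 : (0 <= S)%E by apply: integral_ge0 => x Ax; rewrite lee_fin powR_ge0.
have a0 : 0 <= a.
  by rewrite -lee_fin -ha; apply: integral_ge0 => x Ax; rewrite lee_fin h0.
have H1 : ((a `^ p)%:E <= B * S `^ (p - 1))%E.
  have : (a%:E `^ p <= (B `^ p^-1 * S `^ q^-1) `^ p)%E.
    apply: gt0_ler_poweR; rewrite ?(ltW p_gt0)// in_itv/= ?leey ?andbT ?lee_fin//.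
    by rewrite mule_ge0 ?poweR_ge0.
  rewrite poweRM ?poweR_ge0// -!poweRrM mulVf ?gt_eqF// poweRe1// poweR_EFin.
  congr (_ <= _ * _ `^ _)%E.
  have -> : q^-1 = 1 - p^-1 by lra.
  by rewrite mulrBl mul1r mulVf ?gt_eqF.
set S' := (\int[mu]_(x in eball c r) (sigma x)%:E)%E.
have SS' : (S <= S')%E.
  apply: ge0_subset_integral; first exact: mA.
  - exact: measurable_eball.
  - by apply/measurable_EFinP/measurable_powR_fun; exact: measurable_weight.
  - by move=> x _; rewrite lee_fin powR_ge0.
  - exact: AB.
have W0 : (0 <= \int[mu]_(x in eball c r) (w x)%:E)%E.
  by apply: integral_ge0 => x _; rewrite lee_fin.
apply: (@le_trans _ _ ((B * S' `^ (p - 1)) * \int[mu]_(x in eball c r) (w x)%:E)%E).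
  apply: lee_wpmul2r => //; apply: le_trans H1 _; apply: lee_wpmul2l => //.
  apply: gt0_ler_poweR; rewrite ?subr_ge0 ?(ltW p1)// in_itv/= leey andbT//.
  exact: le_trans SS'.
rewrite -muleA [leRHS]muleC lee_wpmul2l// muleC.
exact: Ap_product.
Qed.

Lemma Ap_bound_ge0 : 0 <= K.
Proof.
have := @Ap_product 0 1 ltr01; set W := (\int[mu]_(x in _) _)%E.
set S := (_ `^ _)%E.
have W0 : (0 <= W)%E by apply: integral_ge0 => x _; rewrite lee_fin.
have S0 : (0 <= S)%E by exact: poweR_ge0.
move=> /(le_trans (mule_ge0 W0 S0)); rewrite lee_fin.
by rewrite pmulr_lge0// powR_gt0// b_gt0.
Qed.

Lemma Ap_doubling c (r : R) c' (r' : R) : 0 < r -> 0 < r' -> eball c r `<=` eball c' r' ->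
  (\int[mu]_(x in eball c' r') (w x)%:E <=
   (K * (r' / r) `^ (n.+1%:R * p))%:E * \int[mu]_(x in eball c r) (w x)%:E)%E.
Proof.
move=> r0 r'0 BB.
have E1 : (\int[mu]_(x in eball c r) (1 : R)%:E)%E = (r ^+ n.+1 * kappa)%:E.
  rewrite integral_cst; last exact: measurable_eball.
  by rewrite mul1e; exact: lebesgue_eballE.
have := Ap_hoelder r'0 (measurable_eball _ _) BB (measurable_cst (1 : R))
  (fun _ _ => ler01) E1.
under [X in (_ <= _ * X)%E -> _]eq_integral do rewrite powR1 mul1r.
set W' := (\int[mu]_(x in eball c' r') (w x)%:E)%E.
set W := (\int[mu]_(x in eball c r) (w x)%:E)%E.
rewrite -lee_pdivlMl; last by rewrite powR_gt0// b_gt0.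
move=> /le_trans; apply; rewrite muleA -EFinM le_eqVlt; apply/orP; left; apply/eqP.
congr (_%:E * _)%E.
rewrite mulrCA; congr (_ * _).
set b := r ^+ n.+1 * kappa; set b' := r' ^+ n.+1 * kappa.
have bb : b' / b = (r' / r) `^ n.+1%:R.
  rewrite powR_mulrn ?divr_ge0 ?(ltW r0) ?(ltW r'0)// exprMn exprVn /b /b'.
  by field; rewrite !gt_eqF ?exprn_gt0.
have b0 : 0 < b := b_gt0 r0; have b'0 : 0 < b' := b_gt0 r'0.
rewrite powRrM -bb powRM ?invr_ge0 ?(ltW b'0) ?(ltW b0)// mulrC; congr (_ * _).
have powRV (x : R) : 0 <= x -> (x `^ p)^-1 = x^-1 `^ p.
  by move=> x0; rewrite -powRN -(powR_inv1 x0) -powRrM mulN1r.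
exact: powRV (ltW b0).
Qed.

End Muckenhoupt.

(** * Packing of balls *)

Lemma sum_indic_count (T : Type) (R : realType) (I : Type) (s : seq I) (A : I -> set T) x :
  \sum_(i <- s) \1_(A i) x = (count (fun i => x \in A i) s)%:R :> R.
Proof.
rewrite -sum1_count natr_sum [RHS]big_mkcond; apply: eq_bigr => i _.
by rewrite indicE; case: (x \in A i).
Qed.

Section packing.
Context (R : realType) (n : nat).
Local Notation T := 'rV[R]_n.+1.
Local Notation mu := (@lebesgue_rV R n).
Local Notation kappa := (unit_ball_volume R n).
Hypothesis kappa0 : 0 < kappa.

(** A volume count: integrating the overlap bound over the big ball bounds the sum of the volumes,
    each at least that of radius [a]. *)
Lemma packing (I : eqType) (s : seq I) (c : I -> T) (r : I -> R) (z : T) (a b M : R) :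
  0 < a -> 0 < b ->
  {in s, forall i, a <= r i} -> {in s, forall i, eball (c i) (r i) `<=` eball z b} ->
  (forall x, \sum_(i <- s) \1_(eball (c i) (r i)) x <= M) ->
  (size s)%:R * a ^+ n.+1 <= M * b ^+ n.+1.
Proof.
move=> a0 b0 ar rb sM.
have := @sum_integral_overlap _ T R mu I s (fun i => eball (c i) (r i)) (eball z b) (fun=> 1 : R) M
  (measurable_eball _ _) (fun i => measurable_eball _ _) (measurable_cst (1 : R))
  (fun _ _ => ler01) (fun x _ => sM x).
have E c' r' : 0 < r' -> (\int[mu]_(x in eball c' r') (1 : R)%:E)%E = (r' ^+ n.+1 * kappa)%:E.
  move=> r'0; rewrite integral_cst; last exact: measurable_eball.
  by rewrite mul1e; exact: lebesgue_eballE.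
rewrite /= E// -EFinM.
rewrite (eq_big_seq (fun i => (r i ^+ n.+1 * kappa)%:E)); last first.
  by move=> i si; rewrite (setIidl (rb i si)) (E _ _ (lt_le_trans a0 (ar i si))).
rewrite sumEFin lee_fin => h.
rewrite -(ler_pM2r kappa0) -[leRHS]mulrA; apply: le_trans h.
rewrite -sum1_size natr_sum !mulr_suml big_seq [leRHS]big_seq; apply: ler_sum => i si.
by rewrite mul1r ler_pM2r// lerXn2r// ?nnegrE ?(ltW a0) ?ar// (le_trans (ltW a0))// ar.
Qed.

Definition spaced (d : R) (Z : seq T) : Prop :=
  uniq Z /\ {in Z &, forall x y, x != y -> d <= enorm (x - y)}.

Lemma spaced_overlap d (Z : seq T) x : spaced d Z ->
  \sum_(z <- Z) \1_(eball z (d / 2)) x <= 1 :> R.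
Proof.
move=> [uZ sZ]; rewrite sum_indic_count.
rewrite -size_filter; set Y := [seq _ <- _ | _].
have uY : uniq Y by exact: filter_uniq.
case YE : Y => [|y [|y' Y']] //=.
have : y \in Y by rewrite YE mem_head.
have : y' \in Y by rewrite YE !inE eqxx orbT.
rewrite !mem_filter => /andP[/set_mem y'x y'Z] /andP[/set_mem yx yZ].
have yy' : y != y' by move: uY; rewrite YE /= in_cons negb_or => /andP[/andP[]].
have := sZ _ _ yZ y'Z yy'; have := enorm_triangle x y y'.
by move: yx y'x; rewrite /eball /= (enormB x y); lra.
Qed.

Lemma spaced_sub d Z (P : pred T) : spaced d Z -> spaced d [seq z <- Z | P z].
Proof.
move=> [uZ sZ]; split; first exact: filter_uniq.
by move=> x y; rewrite !mem_filter => /andP[_ xZ] /andP[_ yZ]; exact: sZ.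
Qed.

Lemma spaced_size d Z c r : 0 < d -> 0 < r -> spaced d Z ->
  {in Z, forall z, eball c r z} ->
  (size Z)%:R * (d / 2) ^+ n.+1 <= (r + d / 2) ^+ n.+1.
Proof.
move=> d0 r0 sZ Zc; rewrite -[leRHS]mul1r.
apply: (@packing _ _ id (fun=> d / 2) c) => //; first by rewrite divr_gt0.
- by rewrite addr_gt0// divr_gt0.
- move=> z /Zc zc x; rewrite /eball /= => xz.
  by apply: le_lt_trans (enorm_triangle z x c) _; move: zc; rewrite /eball /=; lra.
- by move=> x; exact: spaced_overlap.
Qed.

Lemma spaced_net (A : set T) c r d : 0 < d -> 0 < r -> A `<=` eball c r ->
  exists Z : seq T, [/\ spaced d Z, {in Z, forall z, A z} &
    forall x, A x -> exists2 z, z \in Z & enorm (x - z) < d].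
Proof.
move=> d0 r0 Ac.
pose P k := `[< exists Z : seq T, [/\ spaced d Z, {in Z, forall z, A z} & size Z = k] >].
have exP : exists k, P k.
  by exists 0%N; apply/asboolP; exists [::]; split.
pose m := Num.truncn ((r + d / 2) ^+ n.+1 / (d / 2) ^+ n.+1).
have ubP k : P k -> (k <= m)%N.
  move=> /asboolP[Z [sZ ZA <-]]; rewrite truncn_ge_nat; last first.
    by rewrite divr_ge0 ?exprn_ge0 ?addr_ge0 ?divr_ge0 ?ltW.
  rewrite ler_pdivlMr ?exprn_gt0 ?divr_gt0//.
  by apply: (@spaced_size _ _ c) => // z /ZA/Ac.
have [_ /asboolP[Z [sZ ZA <-]] Zmax] := ex_maxnP exP ubP.
exists Z; split => // x Ax.
apply: contrapT => nx.
have far z : z \in Z -> d <= enorm (x - z).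
  by move=> zZ; rewrite leNgt; apply/negP => xz; apply: nx; exists z.
have : P (size (x :: Z)).
  apply/asboolP; exists (x :: Z); split => //; last first.
    by move=> z; rewrite in_cons => /predU1P[->//|/ZA].
  split=> /=.
    rewrite sZ.1 andbT; apply/negP => /far; rewrite subrr enorm0; lra.
  move=> y z; rewrite !in_cons => /predU1P[->|yZ] /predU1P[->|zZ]; rewrite ?eqxx//.
  - by move=> _; exact: far.
  - by move=> _; rewrite enormB far.
  - exact: sZ.2.
by move=> /Zmax /=; rewrite ltnn.
Qed.

(** The centres counted lie within [3 * d] of [x], and [3 * d + d / 2 <= 8 * (d / 2)]. *)
Lemma spaced_overlap3 d (Z : seq T) x : 0 < d -> spaced d Z ->
  \sum_(z <- Z) \1_(eball z (3 * d)) x <= 8 ^+ n.+1 :> R.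
Proof.
move=> d0 sZ; rewrite sum_indic_count -size_filter.
have d20 : 0 < d / 2 by rewrite divr_gt0.
rewrite -(ler_pM2r (exprn_gt0 n.+1 d20)) -exprMn.
apply: le_trans (@spaced_size d _ x (3 * d) d0 _ (spaced_sub _ sZ) _) _.
- by rewrite mulr_gt0.
- by move=> z; rewrite mem_filter /eball /= enormB => /andP[/set_mem].
- by apply: lerXn2r; rewrite ?nnegrE; lra.
Qed.

(* Balls of comparable radii are boundedly many by [packing]; the radii then sum
   up like a geometric series over the dyadic scales. *)
Lemma sum_radii (s : seq (T * R)) (x : T) (M L rho : R) :
  0 <= M -> 0 <= L -> 0 < rho ->
  {in s, forall D : T * R, [/\ 0 < D.2, D.2 <= rho & enorm (D.1 - x) < M * D.2]} ->
  (forall y, \sum_(D <- s) \1_(eball D.1 D.2) y <= L) ->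
  \sum_(D <- s) D.2 <= 2 * (L * (2 * (M + 1)) ^+ n.+1) * rho.
Proof.
move=> M0 L0 rho0.
set L' := L * _; have L'0 : 0 <= L' by rewrite mulr_ge0// exprn_ge0// mulr_ge0// addr_ge0.
have main k (t : seq (T * R)) (q : R) : 0 < q ->
    {in t, forall D : T * R, [/\ q / 2 ^+ k < D.2, D.2 <= q & enorm (D.1 - x) < M * D.2]} ->
    (forall y, \sum_(D <- t) \1_(eball D.1 D.2) y <= L) ->
    \sum_(D <- t) D.2 <= 2 * L' * q.
  elim: k t q => [|k IH] t q q0 tq tL.
    case: t tq tL => [|D t] tq _; first by rewrite big_nil mulr_ge0 ?(ltW q0)// mulr_ge0.
    by have [] := tq D (mem_head _ _); rewrite expr0 divr1; lra.
  have sub (P : pred (T * R)) y : \sum_(D <- [seq D <- t | P D]) \1_(eball D.1 D.2) y <= L.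
    apply: le_trans (tL y); rewrite big_filter [leRHS](bigID P)/= lerDl.
    exact: sumr_ge0.
  rewrite (bigID (fun D : T * R => q / 2 < D.2)) /=.
  (* Balls of radius above [q / 2] lie within [(M + 1) * q] of [x], so there are at most [L'] of
     them and they contribute at most [L' * q]; the rest is the induction hypothesis at [q / 2]. *)
  have -> : 2 * L' * q = L' * q + 2 * L' * (q / 2) by field.
  rewrite -[X in X + _ <= _]big_filter -[X in _ + X <= _]big_filter; apply: lerD.
    set t1 := [seq _ <- _ | _].
    apply: (@le_trans _ _ ((size t1)%:R * q)).
      rewrite -sum1_size natr_sum mulr_suml big_seq [leRHS]big_seq.
      by apply: ler_sum => D; rewrite mem_filter mul1r => /andP[_ /tq[_ ? _]].
    rewrite ler_pM2r// /L'.
    have q20 : 0 < q / 2 by rewrite divr_gt0.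
    have M1q : 0 < (M + 1) * q by rewrite mulr_gt0// ltr_wpDl.
    rewrite -(ler_pM2r (exprn_gt0 n.+1 q20)).
    have := @packing _ t1 fst snd x (q / 2) ((M + 1) * q) L q20 M1q _ _ (sub _).
    have -> : L * (2 * (M + 1)) ^+ n.+1 * (q / 2) ^+ n.+1 = L * ((M + 1) * q) ^+ n.+1.
      by rewrite -mulrA -exprMn; congr (_ * _ ^+ _); field.
    apply.
    - by move=> D; rewrite mem_filter => /andP[/ltW].
    - move=> D; rewrite mem_filter => /andP[_ /tq[_ Dq xD]] y; rewrite /eball /= => yD.
      apply: le_lt_trans (enorm_triangle D.1 y x) _.
      have : M * D.2 <= M * q by rewrite ler_wpM2l.
      lra.
  apply: IH; first by rewrite divr_gt0.
  - move=> D; rewrite mem_filter -leNgt => /andP[Dq /tq[qD _ xD]]; split => //.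
    by move: qD; rewrite exprS invfM mulrA.
  - exact: sub.
move=> sD sL.
(* Finitely many positive radii have a positive lower bound, which fixes the depth of the
   induction. *)
have [k kP] : exists k, {in s, forall D : T * R, rho / 2 ^+ k < D.2}.
  have : {in s, forall D : T * R, 0 < D.2} by move=> D /sD[].
  elim: (s) => [|D t IH] tP; first by exists 0%N.
  have [k kP] := IH (fun D' D't => tP D' (mem_behead (s := D :: t) D't)).
  have D0 := tP D (mem_head _ _).
  pose j := Num.truncn (rho / D.2).
  have mono i (y : R) : (i <= maxn k j)%N -> rho / 2 ^+ i < y -> rho / 2 ^+ maxn k j < y.
    move=> ik; apply: le_lt_trans; rewrite ler_pM2l// lef_pV2 ?posrE ?exprn_gt0//.
    by rewrite ler_eXn2l// ltr1n.
  exists (maxn k j) => D'; rewrite in_cons => /predU1P[->|/kP].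
    apply: (mono j); first exact: leq_maxr.
    rewrite ltr_pdivrMr ?exprn_gt0// mulrC -ltr_pdivrMr//.
    apply: lt_le_trans (truncnS_gt _) _; rewrite -natrX ler_nat; exact: ltn_expl.
  by apply: mono; exact: leq_maxl.
apply: (main k) => // D Ds; have [_ ? ?] := sD D Ds; split => //; exact: kP.
Qed.

End packing.

(** * Functions of class C^1 up to the boundary *)

Section continuity.
Context (R : realType) (n : nat).
Local Notation T := 'rV[R]_n.+1.

(** Relative continuity in the Euclidean distance, the one used by all estimates, instead of the max
    norm of the topology. *)
Definition cont_on (K : set T) (h : T -> R) : Prop :=
  forall x, K x -> forall e : R, 0 < e -> exists2 d : R, 0 < d &
    forall y, K y -> enorm (x - y) < d -> `|h x - h y| < e.

Lemma nbhs_eball (x : T) (d : R) : 0 < d -> nbhs x (eball x d).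
Proof.
move=> d0; apply: open_nbhs_nbhs; split; first exact: open_eball.
by rewrite /eball /= subrr enorm0.
Qed.

Lemma nbhs_eballP (x : T) (A : set T) : nbhs x A -> exists2 d : R, 0 < d & eball x d `<=` A.
Proof.
move=> /nbhs_ballP[d d0 xA]; exists d => // y /= xy; apply: xA.
rewrite -ball_normE /= distrC; exact: le_lt_trans (mx_norm_le_enorm _) xy.
Qed.

Lemma open_eballP (x : T) (A : set T) : open A -> A x ->
  exists2 d : R, 0 < d & eball x d `<=` A.
Proof. by move=> oA Ax; apply/nbhs_eballP/open_nbhs_nbhs. Qed.

Lemma within_cont_on a b (K : set T) (f : T -> 'M[R]_(a.+1, b.+1)) :
  {within K, continuous f} -> cont_on K (fun x => enorm (f x)).
Proof.
move=> /subspace_continuousP cf x Kx e e0.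
have d0 : 0 < (a.+1 * b.+1)%:R :> R by rewrite ltr0n muln_gt0.
have /cvgrPdist_lt/(_ _ (divr_gt0 e0 d0)) := cf x Kx.
rewrite near_withinE => /nbhs_eballP[d dgt0 xd]; exists d => // y Ky.
rewrite enormB => /xd/(_ Ky) /=; rewrite ltr_pdivlMr// mulrC => h.
apply: le_lt_trans h; apply: le_trans (ler_enorm_dist _ _) _.
exact: enorm_le_mx_norm.
Qed.

Lemma within_cont_onR (K : set T) (f : T -> R) :
  {within K, continuous f} -> cont_on K f.
Proof.
move=> /subspace_continuousP cf x Kx e e0.
have /cvgrPdist_lt/(_ _ e0) := cf x Kx.
rewrite near_withinE => /nbhs_eballP[d dgt0 xd]; exists d => // y Ky.
by rewrite enormB => /xd/(_ Ky).
Qed.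

(** Heine-Cantor: compactness turns a modulus valid near each point into one valid on [K]. *)
Lemma cont_on_uniform (K : set T) h : compact K -> cont_on K h ->
  forall e : R, 0 < e -> exists2 d : R, 0 < d &
    forall x y, K x -> K y -> enorm (x - y) < d -> `|h x - h y| < e.
Proof.
move=> cK ch e e0.
have e20 : 0 < e / 2 by rewrite divr_gt0.
pose P (d : R) (x : T) := forall y, K x -> K y -> enorm (x - y) < d -> `|h x - h y| < e.
have := (compact_near_coveringP K).1 cK R (0^'+) P _ _.
case=> [x Kx|d /= d0 dP].
  have [d d0 xd] := ch x Kx _ e20.
  have d20 : 0 < d / 2 by rewrite divr_gt0.
  exists (eball x (d / 2), [set s | s < d / 2]) => /=.
    by split; [exact: nbhs_eball|exact: nbhs_right_lt].
  move=> [z s] [/= zx sd] y Kz Ky zy.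
  apply: le_lt_trans (ler_distD (h x) _ _) _; rewrite (distrC (h z)).
  have xz : enorm (x - z) < d by rewrite enormB; move: zx; rewrite /eball/=; lra.
  have xy : enorm (x - y) < d.
    have := enorm_triangle z x y; rewrite (enormB x z).
    move: zx sd zy; rewrite /eball /=; set A := enorm (z - x); set B := enorm (z - y).
    by set C := enorm _; lra.
  by have := xd z Kz xz; have := xd y Ky xy; lra.
exists (d / 2); first by rewrite divr_gt0.
move=> x y Kx Ky xy; apply: (dP (d / 2)) => //=.
- by rewrite sub0r normrN gtr0_norm ?divr_gt0// ltr_pdivrMr// ltr_pMr// ltr1n.
- by rewrite divr_gt0.
Qed.

Lemma cont_on_bounded (K : set T) h : compact K -> cont_on K h ->
  exists2 M : R, 0 < M & forall x, K x -> `|h x| <= M.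
Proof.
move=> cK ch.
pose P (m : nat) (x : T) := K x -> `|h x| <= m%:R.
have := (compact_near_coveringP K).1 cK nat \oo P _ _.
case=> [x Kx|m /= _ mP].
  have [d d0 xd] := ch x Kx _ ltr01.
  exists (eball x d, [set m : nat | (Num.truncn (`|h x| + 1)).+1 <= m]%N) => /=.
    split; first exact: nbhs_eball.
    by exists (Num.truncn (`|h x| + 1)).+1.
  move=> [z m] [/= zx sm] Kz.
  have h1 := xd z Kz; rewrite enormB in h1; have {}h1 := h1 zx.
  have h2 : `|h x| + 1 < m%:R.
    by apply: lt_le_trans (truncnS_gt _) _; rewrite ler_nat.
  have := ler_normB (h x) (h x - h z); rewrite opprB addrC subrK; lra.
exists m.+1%:R; first by rewrite ltr0n.
move=> x Kx; apply: le_trans (mP m _ x _ _) _ => //=.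
by rewrite ler_nat.
Qed.

Lemma compact_closure (E : set T) : bounded_set E -> compact (closure E).
Proof.
move=> [M [Mr bE]]; apply: bounded_closed_compact; last exact: closed_closure.
exists (M + 1); split; first exact: num_real.
move=> s sM x cx /=.
have [y [Ey xy]] := cx _ (nbhs_eball x (ltr01 : 0 < (1 : R))); move: xy.
have sM1 : M < s - 1 by lra.
have := bE _ sM1 y Ey; rewrite /= => ys /=; rewrite /eball /= enormB => xy.
rewrite -(subrK y x) (le_trans (ler_normD _ _))//.
have := mx_norm_le_enorm (x - y); lra.
Qed.

Lemma bounded_eball (E : set T) : bounded_set E ->
  exists2 r : R, 0 < r & E `<=` eball 0 r.
Proof.
move=> /compact_closure cE.
have [|M M0 Mb] := @cont_on_bounded (closure E) (fun x => enorm x) cE.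
  move=> x _ e e0; exists e => // y _ xy.
  exact: le_lt_trans (ler_enorm_dist _ _) xy.
exists (M + 1); first by rewrite addr_gt0.
move=> x Ex; rewrite /eball /= subr0.
have := Mb x (subset_closure Ex); rewrite ger0_norm ?enorm_ge0//; lra.
Qed.

End continuity.

(** * Bounds, measurability and mean value theorem for C^1 functions *)

Section C1_functions.
Context (R : realType) (n : nat).
Local Notation T := 'rV[R]_n.+1.
Context (E : set T) (f : T -> R).
Hypothesis oE : open E.
Hypothesis bE : bounded_set E.
Hypothesis C1f : C1_closure E f.
Let h x := enorm (grad f x).

Lemma C1_bounded : exists2 M : R, 0 < M & forall x, E x -> `|f x| <= M.
Proof.
have [cf _ _] := C1f.
have [M M0 Mb] := cont_on_bounded (compact_closure bE) (within_cont_onR cf).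
by exists M => // x Ex; exact/Mb/subset_closure.
Qed.

Lemma C1_grad_bounded : exists2 M : R, 0 < M & forall x, E x -> h x <= M.
Proof.
have [_ _ [G cG Gf]] := C1f.
have [M M0 Mb] := cont_on_bounded (compact_closure bE) (within_cont_on cG).
exists M => // x Ex; rewrite /h Gf//; apply: le_trans (ler_norm _) _.
exact/Mb/subset_closure.
Qed.

Lemma C1_grad_uniform (e : R) : 0 < e -> exists2 d : R, 0 < d &
  forall x y, E x -> E y -> enorm (x - y) < d -> `|h x - h y| < e.
Proof.
have [_ _ [G cG Gf]] := C1f => e0.
have [d d0 dG] := cont_on_uniform (compact_closure bE) (within_cont_on cG) e0.
exists d => // x y Ex Ey xy; rewrite /h !Gf//.
by apply: dG => //; exact: subset_closure.
Qed.

Lemma C1_continuous x : E x -> {for x, continuous f}.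
Proof. by have [_ df _] := C1f => Ex; apply/differentiable_continuous/df. Qed.

Lemma C1_measurable : measurable_fun E f.
Proof. by apply: continuous_measurable_rV => // x /set_mem; exact: C1_continuous. Qed.

Lemma C1_measurable_pderiv i : measurable_fun E (fun x => grad f x i 0).
Proof.
have [_ _ [G /subspace_continuousP cG Gf]] := C1f.
apply: (@eq_measurable_fun _ _ _ _ E (fun x => G x i 0)).
  by move=> x /set_mem Ex; rewrite Gf.
apply: continuous_measurable_rV => // x /set_mem Ex.
apply/(@cvgrPdist_lt R R^o T (nbhs x) (nbhs_filter x)) => e e0.
have /cvgrPdist_lt/(_ _ e0) := cG x (subset_closure Ex).
rewrite near_withinE => near_x.
have nE : nbhs x E by exact: open_nbhs_nbhs.
near=> y.
have Ey : E y by near: y.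
have yG : `|G x - G y| < e.
  by apply: (near near_x y) => //; exact: subset_closure.
apply: le_lt_trans yG; have := coef_le_mx_norm (G x - G y) i 0.
by rewrite !mxE.
Unshelve. all: by end_near. Qed.

Lemma C1_measurable_grad : measurable_fun E h.
Proof.
apply: measurable_enorm; exact: C1_measurable_pderiv.
Qed.

Lemma grad_dot x v : differentiable f x -> 'D_v f x = dot v^T (grad f x).
Proof.
move=> df; rewrite deriveE// {1}(row_sum_delta v) linear_sum /dot.
apply: eq_bigr => i _; rewrite big_ord1 mxE linearZ /=.
by rewrite mxE deriveE.
Qed.

Lemma C1_MVT (x y : T) : (forall t : R, 0 <= t <= 1 -> E (x + t *: (y - x))) ->
  exists2 t : R, 0 <= t <= 1 &
    f y - f x = dot (y - x)^T (grad f (x + t *: (y - x))).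
Proof.
move=> seg; have [_ df _] := C1f.
pose g (t : R) := f (x + t *: (y - x)).
have der (t : R) : 0 <= t <= 1 ->
    is_derive t 1 g (dot (y - x)^T (grad f (x + t *: (y - x)))).
  move=> t01; have dft := df _ (seg t t01).
  have qE : (fun h : R => h^-1 *: ((g \o shift t) (h *: (1 : R)) - g t)) =
      (fun h : R => h^-1 *: ((f \o shift (x + t *: (y - x))) (h *: (y - x)) - f (x + t *: (y - x)))).
    apply/funext => s; rewrite /g /= /shift /= [s *: 1]mulr1.
    by rewrite scalerDl addrCA.
  have dv : derivable f (x + t *: (y - x)) (y - x) by exact: diff_derivable.
  split; first by rewrite /derivable qE.
  by rewrite /derive qE -grad_dot.
have [||t] := @MVT R g (fun t : R => dot (y - x)^T (grad f (x + t *: (y - x)))) 0 1 ltr01.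
- by move=> t; rewrite in_itv /= => /andP[t0 t1]; apply: der; rewrite !ltW.
- by apply: derivable_within_continuous => t; rewrite in_itv /= => t01; have [] := der t t01.
rewrite in_itv /= => /andP[t0 t1]; rewrite subr0 mulr1 /g scale1r scale0r addr0.
have -> : x + (y - x) = y by rewrite addrC subrK.
move=> ->; exists t => //.
by rewrite !ltW.
Qed.

End C1_functions.

(** * Local Poincare inequality *)

Lemma bounded_integrable d (T : measurableType d) (R : realType)
    (mu : {measure set T -> \bar R}) (D : set T) (f : T -> R) (M : R) :
  measurable D -> (mu D < +oo)%E -> measurable_fun D f ->
  (forall x, D x -> `|f x| <= M) -> mu.-integrable D (EFin \o f).
Proof.
move=> mD Doo mf fM; apply/integrableP; split; first exact/measurable_EFinP.
have [[y Dy]|D0] := pselect (exists y, D y); last first.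
  have -> : D = set0 by apply/seteqP; split => // x Dx; apply: D0; exists x.
  by rewrite integral_set0.
have M0 : 0 <= M by exact: le_trans (fM y Dy).
apply: (@le_lt_trans _ _ (\int[mu]_(x in D) M%:E)%E).
  apply: (@le_integral_nonneg _ _ _ mu D (fun x => `|f x|) (fun=> M)) => //.
    exact: measurableT_comp.
  by move=> x Dx; rewrite normr_ge0 fM.
by rewrite integral_cst// lte_mul_pinfty.
Qed.

(* A discrete mean value inequality: steps of length at most [d] suffice. *)
Lemma lipschitz_chain (R : realType) (g : R -> R) (a b L d : R) : 0 < d -> a <= b ->
  (forall s t, a <= s <= b -> a <= t <= b -> `|t - s| < d -> `|g t - g s| <= L * `|t - s|) ->
  `|g b - g a| <= L * (b - a).
Proof.
move=> d0 ab gL.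
pose m := (Num.truncn ((b - a) / d)).+1.
have m0 : 0 < m%:R :> R by rewrite ltr0n.
pose h := (b - a) / m%:R.
have h0 : 0 <= h by rewrite divr_ge0 ?subr_ge0// ltW.
have hd : h < d.
  by rewrite /h ltr_pdivrMr// mulrC -ltr_pdivrMr//; exact: truncnS_gt.
have mh : m%:R * h = b - a by rewrite /h mulrC divfK// gt_eqF.
have in_ab i : (i <= m)%N -> a <= a + i%:R * h <= b.
  move=> im; rewrite lerDl mulr_ge0//= -lerBrDl -mh ler_wpM2r//.
  by rewrite ler_nat.
suff step i : (i <= m)%N -> `|g (a + i%:R * h) - g a| <= L * (i%:R * h).
  by have := step m (leqnn m); rewrite mh (addrC a) subrK.
elim: i => [_|i IH im].
  by rewrite mul0r addr0 subrr normr0 mulr0.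
apply: le_trans (ler_distD (g (a + i%:R * h)) _ _) _.
have E : a + i.+1%:R * h - (a + i%:R * h) = h by rewrite -natr1; ring.
have := gL _ _ (in_ab i (ltnW im)) (in_ab i.+1 im).
rewrite E ger0_norm// => /(_ hd) s1; have s2 := IH (ltnW im).
apply: le_trans (lerD s1 s2) _.
by rewrite le_eqVlt -mulrDr -natr1 mulrDl mul1r (addrC h) eqxx.
Qed.

(* What the proof of the Poincare inequality uses of a function [f] of class C^1
   up to the boundary and of the length [h] of its gradient. *)
Record regular_pair (R : realType) (n : nat) (E : set 'rV[R]_n.+1)
    (f h : 'rV[R]_n.+1 -> R) : Prop := {
  rp_continuous : forall x, E x -> {for x, continuous f};
  rp_bounded : exists2 M : R, 0 < M & forall x, E x -> `|f x| <= M;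
  rp_ge0 : forall x, 0 <= h x;
  rp_measurable : measurable_fun E h;
  rp_grad_bounded : exists2 M : R, 0 < M & forall x, E x -> h x <= M;
  rp_uniform : forall e : R, 0 < e -> exists2 d : R, 0 < d &
    forall x y, E x -> E y -> enorm (x - y) < d -> `|h x - h y| < e;
  rp_mean_value : forall x y : 'rV[R]_n.+1,
    (forall t : R, 0 <= t <= 1 -> E (x + t *: (y - x))) ->
    exists2 t : R, 0 <= t <= 1 &
      `|f y - f x| <= enorm (y - x) * h (x + t *: (y - x)) }.

Lemma C1_regular_pair (R : realType) (n : nat) (E : set 'rV[R]_n.+1)
    (f : 'rV[R]_n.+1 -> R) : open E -> bounded_set E -> C1_closure E f ->
  regular_pair E f (fun x => enorm (grad f x)).
Proof.
move=> oE bE C1f; split.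
- exact: C1_continuous C1f.
- exact: C1_bounded bE C1f.
- by move=> x; exact: enorm_ge0.
- exact: C1_measurable_grad oE C1f.
- exact: C1_grad_bounded bE C1f.
- exact: C1_grad_uniform bE C1f.
- move=> x y /(C1_MVT C1f)[t t01 ->]; exists t => //.
  apply: le_trans (ler_dot_enorm _ _) _; rewrite ler_wpM2r ?enorm_ge0//.
  rewrite !enormE /dot exchange_big le_eqVlt; apply/orP; left; apply/eqP.
  congr Num.sqrt; apply: eq_bigr => i _; apply: eq_bigr => j _.
  by rewrite mxE.
Qed.

(** * Averages over contractions of a ball *)

Section ball_averages.
Context (R : realType) (n : nat).
Local Notation T := 'rV[R]_n.+1.
Local Notation mu := (@lebesgue_rV R n).
Local Notation kappa := (unit_ball_volume R n).
Hypothesis kappa0 : 0 < kappa.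
Context (E : set T) (f h : T -> R).
Hypothesis oE : open E.
Hypothesis fh : regular_pair E f h.
Let f_cont := rp_continuous fh.
Let f_bounded := rp_bounded fh.
Let h_ge0 := rp_ge0 fh.
Let h_meas := rp_measurable fh.
Let h_bounded := rp_grad_bounded fh.
Let h_uniform := rp_uniform fh.
Let f_MVT := rp_mean_value fh.
Context (c : T) (r : R).
Hypothesis r0 : 0 < r.
Let B := eball c r.
Hypothesis BE : B `<=` E.
Let z (x y : T) (t : R) : T := x + t *: (y - x).
Let volB := r ^+ n.+1 * kappa.

Let volB0 : 0 < volB. Proof. by rewrite mulr_gt0// exprn_gt0. Qed.
Let mB : measurable B. Proof. exact: measurable_eball. Qed.
Let muB : mu B = volB%:E. Proof. exact: lebesgue_eballE. Qed.
Let muBoo : (mu B < +oo)%E. Proof. by rewrite muB ltry. Qed.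

Let B_convex (x y : T) (t : R) : B x -> B y -> 0 <= t <= 1 -> B (z x y t).
Proof.
rewrite /B /eball /= => Bx By /andP[t0 t1].
have -> : z x y t - c = (1 - t) *: (x - c) + t *: (y - c).
  by apply/rowP => i; rewrite /z !mxE; ring.
rewrite (le_lt_trans (enormD _ _))// !enormZ !ger0_norm ?subr_ge0//.
have [t00|tpos] := leP t 0.
  have -> : t = 0 by apply/eqP; rewrite eq_le t0 t00.
  by rewrite subr0 mul1r mul0r addr0.
have : (1 - t) * enorm (x - c) <= (1 - t) * r by rewrite ler_wpM2l ?subr_ge0// ltW.
have : t * enorm (y - c) < t * r by rewrite ltr_pM2l.
lra.
Qed.

Let B_diam x y : B x -> B y -> enorm (y - x) <= 2 * r.
Proof.
rewrite /B /eball /= => Bx By; have := enorm_triangle c y x.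
rewrite (enormB c x); lra.
Qed.

Let z_dist (x y : T) (s t : R) : z x y t - z x y s = (t - s) *: (y - x).
Proof. by apply/rowP => i; rewrite /z !mxE; ring. Qed.

Let z_seg (x y : T) (s t u : R) : z x y s + u *: (z x y t - z x y s) = z x y (s + u * (t - s)).
Proof. by apply/rowP => i; rewrite /z !mxE; ring. Qed.

Let step_E (x y : T) (s t u : R) : B x -> B y -> 0 <= s <= 1 -> 0 <= t <= 1 -> 0 <= u <= 1 ->
  E (z x y s + u *: (z x y t - z x y s)).
Proof.
move=> Bx By /andP[s0 s1] /andP[t0 t1] /andP[u0 u1]; rewrite z_seg.
by apply/BE/B_convex => //; apply/andP; split; nra.
Qed.

Let z_MVT (G : R) (x y : T) (s t : R) : B x -> B y -> 0 <= s <= 1 -> 0 <= t <= 1 ->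
  (forall u : R, 0 <= u <= 1 -> h (z x y (s + u * (t - s))) <= G) ->
  `|f (z x y t) - f (z x y s)| <= 2 * r * G * `|t - s|.
Proof.
move=> Bx By s01 t01 hG.
have [u u01] := f_MVT (fun u u01 => step_E Bx By s01 t01 u01).
move=> /le_trans; apply.
have h1 := hG u u01; rewrite -z_seg in h1; have h2 := B_diam Bx By.
rewrite {1}z_dist enormZ -[leLHS]mulrA [leRHS]mulrC ler_wpM2l//.
by apply: ler_pM => //; exact: enorm_ge0.
Qed.

Let comp_cont (x : T) (t : R) (y : T) : B x -> 0 <= t <= 1 -> B y ->
  {for y, continuous (fun y => f (z x y t))}.
Proof.
move=> Bx t01 By; apply: continuous_comp.
  have dz : differentiable (fun y : T => x + t *: (y - x)) y by [].
  exact: differentiable_continuous.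
by apply: f_cont; exact/BE/B_convex.
Qed.

Let comp_meas (x : T) (t : R) : B x -> 0 <= t <= 1 -> measurable_fun B (fun y => f (z x y t)).
Proof.
move=> Bx t01; apply: continuous_measurable_rV; first exact: open_eball.
by move=> y /set_mem By; exact: comp_cont.
Qed.

Let comp_int (x : T) (t : R) : B x -> 0 <= t <= 1 ->
  mu.-integrable B (EFin \o (fun y => f (z x y t))).
Proof.
move=> Bx t01; have [M M0 Mb] := f_bounded.
apply: (bounded_integrable mB muBoo (comp_meas Bx t01) (M := M)).
by move=> y By; exact/Mb/BE/B_convex.
Qed.

(** The average of [f] over the contraction of [B] towards [x] with ratio [t], parametrized by [B]
    so that the domain of integration does not move with [t]. *)
Let Phi (x : T) (t : R) := (\int[mu]_(y in B) f (z x y t)) / volB.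

Let Phi_diff (x : T) (s t : R) (g : T -> R) : B x -> 0 <= s <= 1 -> 0 <= t <= 1 ->
  mu.-integrable B (EFin \o g) ->
  (forall y, B y -> `|f (z x y t) - f (z x y s)| <= g y) ->
  `|Phi x t - Phi x s| <= (\int[mu]_(y in B) g y) / volB.
Proof.
move=> Bx s01 t01 ig fg.
rewrite /Phi -mulrBl normrM (gtr0_norm (_ : 0 < volB^-1)) ?invr_gt0//.
rewrite ler_pM2r ?invr_gt0// -RintegralB//; [|exact: comp_int..].
have ifB : mu.-integrable B (EFin \o (fun y => f (z x y t) - f (z x y s))).
  exact: (integrableB mB (comp_int Bx t01) (comp_int Bx s01)).
apply: le_trans (le_normr_Rintegral _ ifB) _ => //.
by apply: le_Rintegral => //; exact: integrable_norm.
Qed.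

(** The normalization is by the volume of [B], not of the small ball; the factors
    [(2 ^+ k.+1) ^+ n.+1] below compensate for this at scale [k]. *)
Definition local_mean (d : R) (z : T) : R :=
  fine (\int[mu]_(y in eball z (3 * d) `&` B) (h y)%:E) / volB.


Let mE : measurable E. Proof. exact: open_measurable_rV. Qed.

Let h_int (A : set T) : measurable A -> A `<=` B -> mu.-integrable A (EFin \o h).
Proof.
move=> mA AB; have [M M0 Mb] := h_bounded.
apply: (@bounded_integrable _ _ _ mu A h M) => //.
- by apply: le_lt_trans muBoo; apply: le_measure; rewrite ?inE.
- by apply: measurable_funS h_meas => //; exact: subset_trans AB BE.
- by move=> x Ax; rewrite ger0_norm//; exact/Mb/BE/AB.
Qed.

Let affE (x y : T) (t : R) : z x y t = (x - t *: x) + t *: y.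
Proof. by apply/rowP => i; rewrite /z !mxE; ring. Qed.

Let hz_meas (x : T) (t : R) : B x -> 0 < t <= 1 -> measurable_fun B (fun y => h (z x y t)).
Proof.
move=> Bx /andP[t0 t1].
have -> : (fun y => h (z x y t)) = h \o (fun y => (x - t *: x) + t *: y).
  by apply/funext => y /=; rewrite affE.
apply: (measurable_comp mE _ h_meas).
- by move=> _ [y By <-]; rewrite -affE; apply/BE/B_convex; rewrite ?(ltW t0).
- exact: measurable_funS (measurable_affine _ t0).
Qed.

Let hz_int (x : T) (t : R) : B x -> 0 < t <= 1 ->
  mu.-integrable B (EFin \o (fun y => h (z x y t))).
Proof.
move=> Bx t01; have [M M0 Mb] := h_bounded.
apply: (bounded_integrable mB muBoo (hz_meas Bx t01) (M := M)).
move=> y By; rewrite ger0_norm//; apply/Mb/BE/B_convex => //.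
by case/andP: t01 => t0 ->; rewrite ltW.
Qed.

(** The contraction moves points of [B] to within [2 * t * r <= 2 * d] of [x], hence to within
    [3 * d] of [w]; the change of variables produces [t ^- n.+1]. *)
Let contraction_average (x w : T) (t d : R) : B x -> 0 < t <= 1 -> 0 < d ->
  t * r <= d -> enorm (x - w) < d ->
  (\int[mu]_(y in B) h (z x y t)) / volB <= t ^- n.+1 * local_mean d w.
Proof.
move=> Bx /[dup] t01 /andP[t0 t1] d0 trd xw.
set V := eball w (3 * d) `&` B.
have mV : measurable V by apply: measurableI => //; exact: measurable_eball.
have VB : V `<=` B by move=> y [].
rewrite /local_mean mulrA ler_pM2r ?invr_gt0// -lee_fin EFinM.
rewrite (_ : (\int[mu]_(y in B) h (z x y t))%:E = \int[mu]_(y in B) (h (z x y t))%:E)%E; last first.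
  by rewrite fineK//; apply: integrable_fin_num => //; exact: hz_int.
rewrite fineK; last by apply: integrable_fin_num => //; exact: h_int.
have mhV : measurable_fun V (EFin \o h).
  by apply/measurable_EFinP; apply: measurable_funS h_meas; [exact: mE|exact: subset_trans VB BE].
have hV0 y : V y -> (0 <= (h y)%:E)%E by rewrite lee_fin.
rewrite -(integral_affine (x - t *: x) t0 mV mhV hV0).
under eq_integral do rewrite affE.
have mphi := measurable_affine (x - t *: x) t0.
apply: (ge0_subset_integral _ mB).
- by rewrite -[X in measurable X]setTI; exact: mphi.
- apply/measurable_EFinP.
  apply: (measurable_comp mE _ h_meas).
  + by move=> _ [y [_ By] <-]; exact: BE.
  + exact: measurable_funS mphi.
- by move=> y _; rewrite lee_fin.
- move=> y By; split => /=; rewrite -affE; last by apply: B_convex; rewrite ?(ltW t0).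
  rewrite /eball /=; apply: le_lt_trans (enorm_triangle x _ _) _.
  have : enorm (z x y t - x) <= 2 * d.
    rewrite /z addrC addKr enormZ gtr0_norm//.
    have := B_diam Bx By; rewrite -(ler_pM2l t0); lra.
  lra.
Qed.

(** Between the two scales [Phi x] is Lipschitz over short steps: the mean value theorem bounds the
    difference by [h] at an intermediate point, uniform continuity moves that point to parameter [t]
    at cost [e'], and the average of [h] over the contraction is a local mean. The steps are then
    chained and [e] is arbitrary. *)
Let Phi_step (k : nat) (x w : T) : B x -> enorm (x - w) < 2 ^- k * r ->
  `|Phi x (2 ^- k) - Phi x (2 ^- k.+1)| <=
    2 ^- k * r * ((2 ^+ k.+1) ^+ n.+1 * local_mean (2 ^- k * r) w).
Proof.
move=> Bx xw; set a := 2 ^- k.+1; set b := 2 ^- k.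
have b0 : 0 < b by rewrite invr_gt0 exprn_gt0.
have b1 : b <= 1 by rewrite invf_le1 ?exprn_gt0// exprn_ege1// ler1n.
have ab : b = 2 * a by rewrite /a /b exprS invfM mulrA divff ?mul1r.
have a0 : 0 < a by rewrite invr_gt0 exprn_gt0.
have -> : 2 ^+ k.+1 = a^-1 by rewrite invrK.
set m := local_mean _ _.
apply/ler_addgt0Pr => e e0.
(* The error [e'] gets multiplied by the diameter [2 * r] and by [b - a = b / 2], which gives
   [e]. *)
pose e' := e / (b * r); have e'0 : 0 < e' by rewrite divr_gt0// mulr_gt0.
have [d d0 hd] := h_uniform e'0.
(* A change of parameter below [d / (2 * r)] moves a point of a segment in [B] by less than [d]. *)
have d'0 : 0 < d / (2 * r) by rewrite divr_gt0// mulr_gt0.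
have := @lipschitz_chain R (Phi x) a b (2 * r * (a^-1 ^+ n.+1 * m + e')) _ d'0.
move=> /(_ ltac:(lra)) H; apply: (le_trans (H _)); last first.
  rewrite ab; have -> : e = e' * (b * r) by rewrite /e' divfK// gt_eqF// mulr_gt0.
  by rewrite ab; lra.
move=> {H} s t /andP[as_ sb] /andP[at_ tb] std.
have s01 : 0 <= s <= 1 by apply/andP; split; lra.
have t01 : 0 <= t <= 1 by apply/andP; split; lra.
have t01' : 0 < t <= 1 by apply/andP; split; lra.
have ih := hz_int Bx t01'.
have ie : mu.-integrable B (EFin \o (fun=> e')).
  by apply: (@bounded_integrable _ _ _ mu B _ e') => // y _; rewrite gtr0_norm.
have ihe : mu.-integrable B (EFin \o (fun y => h (z x y t) + e')).
  exact: (integrableD mB ih ie).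
pose g y := (2 * r * `|t - s|) * (h (z x y t) + e').
have ig : mu.-integrable B (EFin \o g).
  exact: (integrableZl mB (2 * r * `|t - s|) ihe).
have fg y : B y -> `|f (z x y t) - f (z x y s)| <= g y.
  move=> By; rewrite /g mulrAC; apply: z_MVT => // u /andP[u0 u1].
  have us : 0 <= s + u * (t - s) <= 1 by apply/andP; split; nra.
  rewrite -lerBlDl (le_trans (ler_norm _))// ltW//; apply: hd.
  - exact/BE/B_convex.
  - exact/BE/B_convex.
  - rewrite z_dist enormZ.
    have -> : s + u * (t - s) - t = (1 - u) * (s - t) by ring.
    have u1' : 0 <= 1 - u <= 1 by apply/andP; split; lra.
    case/andP: u1' => u1' u1''.
    rewrite normrM (ger0_norm u1') (distrC s).
    move: std; rewrite ltr_pdivlMr ?mulr_gt0//; apply: le_lt_trans.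
    by apply: ler_pM; rewrite ?mulr_ge0 ?enorm_ge0 ?B_diam// ler_piMl.
apply: le_trans (Phi_diff Bx s01 t01 ig fg) _.
have -> : \int[mu]_(y in B) g y =
    2 * r * `|t - s| * (\int[mu]_(y in B) h (z x y t) + e' * volB).
  rewrite (RintegralZl _ mB ihe) (RintegralD mB ih ie) (Rintegral_cst mu mB e').
  by have -> : fine (mu B) = volB by rewrite muB.
have trb : t * r <= b * r by rewrite ler_pM2r.
have dr0 : 0 < b * r by rewrite mulr_gt0.
have C := contraction_average Bx t01' dr0 trb xw; rewrite -/m in C.
have m0 : 0 <= m.
  apply: divr_ge0; last exact: ltW.
  by apply/fine_ge0/integral_ge0 => y _; rewrite lee_fin.
have t_a : t ^- n.+1 <= a^-1 ^+ n.+1.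
  rewrite -exprVn; apply: lerXn2r; rewrite ?nnegrE ?invr_ge0 ?(ltW a0)//; first by lra.
  by rewrite lef_pV2 ?posrE//; lra.
have C' : (\int[mu]_(y in B) h (z x y t)) / volB <= a^-1 ^+ n.+1 * m.
  by apply: le_trans C _; rewrite ler_wpM2r.
set I := \int[mu]_(y in B) _ in C' *.
have -> : 2 * r * `|t - s| * (I + e' * volB) / volB =
    2 * r * (I / volB + e') * `|t - s|.
  by field; rewrite gt_eqF.
by rewrite ler_wpM2r// ler_pM2l ?mulr_gt0// lerD2r.
Qed.

(** The mean of [f] over [B]: at ratio 1 the contraction is the identity, whatever its centre. *)
Definition ball_mean := Phi c 1.

Let Phi1 x : Phi x 1 = ball_mean.
Proof.
rewrite /ball_mean /Phi; congr (_ / volB); apply: eq_Rintegral => y _.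
by rewrite /z !scale1r !(addrC _ (y - _)) !subrK.
Qed.

(** The average at ratio 0 is [f x] and at ratio 1 the mean. From 0 to [2 ^- m] the crude bound [G]
    is used, from [2 ^- m] to 1 the dyadic differences telescope. *)
Lemma sub_ball_mean (m : nat) (x : T) (w : nat -> T) (G : R) : B x ->
  (forall y, E y -> h y <= G) ->
  (forall k, (k < m)%N -> enorm (x - w k) < 2 ^- k * r) ->
  `|f x - ball_mean| <= 2 ^- m * (2 * r * G) +
    \sum_(k < m) 2 ^- k * (r * ((2 ^+ k.+1) ^+ n.+1 * local_mean (2 ^- k * r) (w k))).
Proof.
move=> Bx hG xw.
have pow01 k : 0 < (2 ^- k : R) <= 1.
  by rewrite invr_gt0 exprn_gt0//= invf_le1 ?exprn_gt0// exprn_ege1// ler1n.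
apply: le_trans (ler_distD (Phi x (2 ^- m)) _ _) _; apply: lerD.
  set t := 2 ^- m; have t01 : 0 < t <= 1 := pow01 m.
  have t01' : 0 <= t <= 1 by case/andP: t01 => /ltW-> ->.
  have O01 : 0 <= (0 : R) <= 1 by rewrite lexx ler01.
  have ic : mu.-integrable B (EFin \o (fun=> f x)).
    by apply: (bounded_integrable mB muBoo (measurable_cst (f x)) (M := `|f x|)).
  have ig : mu.-integrable B (EFin \o (fun=> t * (2 * r * G))).
    by apply: (bounded_integrable mB muBoo (measurable_cst (t * (2 * r * G))) (M := `|t * (2 * r * G)|)).
  have Phi0 : Phi x 0 = f x.
    rewrite /Phi (_ : \int[mu]_(y in B) f (z x y 0) = \int[mu]_(y in B) (cst (f x)) y); last first.
      by apply: eq_Rintegral => y _; rewrite /z scale0r addr0.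
    rewrite (Rintegral_cst mu mB (f x)).
    have -> : fine (mu B) = volB by rewrite muB.
    by rewrite mulfK// gt_eqF.
  rewrite -Phi0 distrC; apply: le_trans (Phi_diff Bx O01 t01' ig _) _.
    move=> y By; apply: le_trans (z_MVT (G := G) Bx By O01 t01' _) _.
      move=> u /andP[u0 u1]; rewrite add0r subr0.
      apply/hG/BE/B_convex => //; case/andP: t01' => t0 t1.
      by rewrite mulr_ge0//= mulr_ile1.
    by rewrite subr0 ger0_norm 1?mulrC//; case/andP: t01'.
  rewrite (Rintegral_cst mu mB).
  have -> : fine (mu B) = volB by rewrite muB.
  by rewrite mulfK// gt_eqF.
elim: m xw => [_|m IH xw].
  by rewrite big_ord0 expr0 invr1 Phi1 subrr normr0.
rewrite big_ord_recr /=; apply: le_trans (ler_distD (Phi x (2 ^- m)) _ _) _.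
rewrite [leRHS]addrC; apply: lerD; last by apply: IH => k km; apply: xw; rewrite ltnS ltnW.
rewrite distrC; apply: le_trans (Phi_step Bx (xw m (ltnSn m))) _.
by rewrite !mulrA.
Qed.

End ball_averages.

(** * The weighted Poincare inequality on one ball *)

Section local_Poincare.
Context (R : realType) (n : nat).
Local Notation T := 'rV[R]_n.+1.
Local Notation mu := (@lebesgue_rV R n).
Local Notation kappa := (unit_ball_volume R n).
Context (p : R) (w : T -> R) (K : R).
Hypothesis kappa0 : 0 < kappa.
Hypothesis pw : Ap_bound p w K.
Context (E : set T) (f h : T -> R).
Hypothesis oE : open E.
Hypothesis fh : regular_pair E f h.

Let p1 : 1 < p := Ap_gt1 pw.
Let p0 : 0 < p. Proof. exact: lt_trans p1. Qed.
Let w0 : forall x, 0 <= w x := Ap_ge0 pw.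
Let h0 : forall x, 0 <= h x := rp_ge0 fh.
Let mE : measurable E. Proof. exact: open_measurable_rV. Qed.
Let mw (A : set T) : measurable_fun A w. Proof. exact: (measurable_weight pw). Qed.
Let mh (A : set T) : measurable A -> A `<=` E -> measurable_fun A h.
Proof. by move=> mA AE; apply: measurable_funS (rp_measurable fh). Qed.
Let mhw (A : set T) : measurable A -> A `<=` E ->
  measurable_fun A (fun x => h x `^ p * w x).
Proof.
move=> mA AE; apply: measurable_funM; last exact: mw.
by apply: measurable_powR_fun; exact: mh.
Qed.
Let hw0 x : 0 <= h x `^ p * w x. Proof. by rewrite mulr_ge0 ?powR_ge0. Qed.
Let mf : measurable_fun E f.
Proof. by apply: continuous_measurable_rV => // x /set_mem; exact: rp_continuous fh _. Qed.

Context (c : T) (r : R).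
Hypothesis r0 : 0 < r.
Hypothesis BE : eball c r `<=` E.
Hypothesis wB : (\int[mu]_(x in eball c r) (w x)%:E < +oo)%E.

Let B := eball c r.
Let mB : measurable B. Proof. exact: measurable_eball. Qed.
Let a (k : nat) : R := 2 ^- k.
Let a0 k : 0 < a k. Proof. by rewrite invr_gt0 exprn_gt0. Qed.
Let ar0 k : 0 < a k * r. Proof. by rewrite mulr_gt0. Qed.
(* Near [z], the averages of [f] over the contractions at the scales [2 ^ -k] and
   [2 ^ -(k + 1)] differ by at most [2 ^ -k r theta k z]. *)
Let theta k z := (2 ^+ k.+1) ^+ n.+1 * local_mean h c r (a k * r) z.
Let theta0 k z : 0 <= theta k z.
Proof.
rewrite mulr_ge0 ?exprn_ge0// divr_ge0//; last by rewrite ltW// mulr_gt0// exprn_gt0.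
by apply/fine_ge0/integral_ge0 => y _; rewrite lee_fin.
Qed.
Let H := (\int[mu]_(x in B) (h x `^ p * w x)%:E)%E.
(** The 6 is [2 ^ (k + 1) * 3 * 2 ^ -k]: the normalization of [theta k] times the relative radius of
    the ball on which the A_p condition is used. *)
Let K6 := K * (6 ^+ n.+1) `^ p.
Let K6_ge0 : 0 <= K6.
Proof. by rewrite mulr_ge0 ?powR_ge0// (Ap_bound_ge0 kappa0 pw). Qed.

Let geometric m : \sum_(k < m) a k <= 2.
Proof.
suff -> : \sum_(k < m) a k = 2 - 2 * a m.
  by rewrite gerBl mulr_ge0// ltW.
elim: m => [|m IH]; first by rewrite big_ord0 /a expr0 invr1 mulr1 subrr.
rewrite big_ord_recr /= IH /a exprS invfM.
by set b := 2 ^- m; field.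
Qed.

Let theta_bound k z :
  ((theta k z `^ p)%:E * \int[mu]_(x in eball z (a k * r)) (w x)%:E <=
   K6%:E * \int[mu]_(x in eball z (3 * (a k * r)) `&` B) (h x `^ p * w x)%:E)%E.
Proof.
set d := a k * r; have d0 : 0 < d by exact: ar0.
set V := eball z (3 * d) `&` B.
have d30 : 0 < 3 * d by rewrite mulr_gt0.
have mV : measurable V by apply: measurableI => //; exact: measurable_eball.
have VE : V `<=` E by move=> x [_ /BE].
have V3 : V `<=` eball z (3 * d) by move=> x [].
have [M M0 hM] := rp_grad_bounded fh.
have iV : mu.-integrable V (EFin \o h).
  apply: (bounded_integrable mV _ (mh mV VE) (M := M)).
    apply: le_lt_trans (lebesgue_eball_lty z (3 * d)).
    by apply: le_outer_measure.
  by move=> x /VE Ex; rewrite ger0_norm// hM.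
have DE := fineK (integrable_fin_num mV iV).
have := Ap_hoelder kappa0 pw d30 mV V3 (mh mV VE) (fun x _ => h0 x) (esym DE).
set D := fine _; set HV := (\int[mu]_(x in V) _)%E => X.
set b := r ^+ n.+1 * kappa; have b0 : 0 < b by rewrite mulr_gt0// exprn_gt0.
set q := (2 ^+ k.+1) ^+ n.+1 / b.
have q0 : 0 < q by rewrite divr_gt0// !exprn_gt0.
have D0 : 0 <= D by apply/fine_ge0/integral_ge0 => y _; rewrite lee_fin.
have -> : theta k z = q * D.
  rewrite /theta /local_mean (_ : fine _ = D)// /q -/b.
  by field; rewrite gt_eqF.
rewrite powRM ?(ltW q0)// EFinM -muleA.
have sub : (\int[mu]_(x in eball z d) (w x)%:E <= \int[mu]_(x in eball z (3 * d)) (w x)%:E)%E.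
  apply: ge0_subset_integral.
  - exact: measurable_eball.
  - exact: measurable_eball.
  - by apply/measurable_EFinP; exact: mw.
  - by move=> x _; rewrite lee_fin.
  - by move=> x; rewrite /eball /=; lra.
apply: (@le_trans _ _ ((q `^ p)%:E * ((D `^ p)%:E * \int[mu]_(x in eball z (3 * d)) (w x)%:E))%E).
  by rewrite lee_wpmul2l ?lee_fin ?powR_ge0// lee_wpmul2l// lee_fin powR_ge0.
apply: (@le_trans _ _ ((q `^ p)%:E * ((K * ((3 * d) ^+ n.+1 * kappa) `^ p)%:E * HV))%E).
  by rewrite lee_wpmul2l ?lee_fin ?powR_ge0.
rewrite muleA -EFinM le_eqVlt; apply/orP; left; apply/eqP; congr (_%:E * _)%E.
rewrite /K6 mulrCA; congr (K * _); rewrite -powRM ?(ltW q0)//; last first.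
  by rewrite mulr_ge0 ?exprn_ge0 ?(ltW d30) ?(ltW kappa0).
congr (_ `^ p); rewrite /q /b /d /a !exprMn exprVn -!exprM.
have -> : (6 : R) ^+ n.+1 = 2 ^+ n.+1 * 3 ^+ n.+1 by rewrite -exprMn -natrM.
rewrite mulSn exprD.
by field; rewrite !gt_eqF ?exprn_gt0.
Qed.

Let net_exists k : exists Z : seq T,
  [/\ spaced (a k * r) Z, {in Z, forall z, B z} &
    forall x, B x -> exists2 z, z \in Z & enorm (x - z) < a k * r].
Proof. exact: (spaced_net kappa0 (ar0 k) r0 (fun _ => id)). Qed.

Let net_sum k (Z : seq T) : spaced (a k * r) Z ->
  (\sum_(z <- Z) (theta k z `^ p)%:E * \int[mu]_(x in eball z (a k * r)) (w x)%:E <=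
   (K6 * 8 ^+ n.+1)%:E * H)%E.
Proof.
move=> sZ; apply: (@le_trans _ _ (\sum_(z <- Z) K6%:E *
    \int[mu]_(x in eball z (3 * (a k * r)) `&` B) (h x `^ p * w x)%:E)%E).
  by apply: lee_sum => z _; exact: theta_bound.
rewrite -ge0_sume_distrr; last first.
  by move=> z _; apply: integral_ge0 => x _; rewrite lee_fin.
rewrite (EFinM K6) -[leRHS]muleA; apply: lee_wpmul2l; first by rewrite lee_fin.
apply: (sum_integral_overlap mu mB (fun z => measurable_eball z (3 * (a k * r))) (mhw mB BE)).
  by move=> x _; exact: hw0.
by move=> x _; exact: (spaced_overlap3 kappa0).
Qed.

(** The three constants of the second term come from separating off the remainder [eta], from
    Jensen's inequality with the weights [a k], whose sum is at most 2, and from summing the scales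
    with these weights. *)
Let Poincare_approx m (G : R) : (forall y, E y -> h y <= G) ->
  (\int[mu]_(x in B) (`|f x - ball_mean f c r| `^ p * w x)%:E <=
   (2 `^ (p - 1) * (a m * (2 * r * G)) `^ p)%:E * \int[mu]_(x in B) (w x)%:E +
   (2 `^ (p - 1) * (2 `^ (p - 1) * (2 * (r `^ p * (K6 * 8 ^+ n.+1)))))%:E * H)%E.
Proof.
move=> hG; have /choice[Z ZP] := net_exists.
(* Whichever net point lies near [x], its term occurs in this sum, so the bound to be integrated
   involves no choice depending on [x]. *)
pose S k x := \sum_(z <- Z k) theta k z `^ p * (\1_(eball z (a k * r)) x * w x).
have m1 k z : measurable_fun B (fun x => \1_(eball z (a k * r)) x * w x).
  apply: measurable_funM; last exact: mw.
  by apply: measurable_indic; exact: measurable_eball.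
have m2 k z : measurable_fun B (fun x => theta k z `^ p * (\1_(eball z (a k * r)) x * w x)).
  by apply: measurable_funM; [exact: measurable_cst|exact: m1].
have mS k : measurable_fun B (S k) by apply: measurable_sum => z; exact: m2.
have ind0 k z x : 0 <= \1_(eball z (a k * r)) x * w x by rewrite mulr_ge0.
have th0 k z x : 0 <= theta k z `^ p * (\1_(eball z (a k * r)) x * w x).
  exact: mulr_ge0 (powR_ge0 _ _) (ind0 _ _ _).
have S0 k x : 0 <= S k x.
  by apply: sumr_ge0 => z _; exact: th0.
have intS k : (\int[mu]_(x in B) (S k x)%:E <= (K6 * 8 ^+ n.+1)%:E * H)%E.
  have [sZ _ _] := ZP k.
  apply: le_trans (net_sum sZ).
  rewrite (integral_sum_nonneg _ _ mB (m2 k) (fun z x _ => th0 k z x)).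
  apply: lee_sum => z _.
  rewrite (integralZl_nonneg _ mB (m1 k z) (fun x _ => ind0 k z x) (powR_ge0 _ _)).
  apply: lee_wpmul2l; first by rewrite lee_fin powR_ge0.
  rewrite -(integral_setI_indic _ _ mB (measurable_eball z (a k * r))).
  apply: ge0_subset_integral.
  - by apply: measurableI => //; exact: measurable_eball.
  - exact: measurable_eball.
  - by apply/measurable_EFinP; exact: mw.
  - by move=> x _; rewrite lee_fin.
  - by move=> x [].
pose eta := a m * (2 * r * G).
pose F x := 2 `^ (p - 1) * eta `^ p * w x +
  2 `^ (p - 1) * (2 `^ (p - 1) * r `^ p) * \sum_(k < m) a k * S k x.
have mF1 : measurable_fun B (fun x => 2 `^ (p - 1) * eta `^ p * w x).
  by apply: measurable_funM; [exact: measurable_cst|exact: mw].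
have msum : measurable_fun B (fun x => \sum_(k < m) a k * S k x).
  apply: measurable_sum => k.
  by apply: measurable_funM; [exact: measurable_cst|exact: mS].
have mF2 : measurable_fun B (fun x => 2 `^ (p - 1) * (2 `^ (p - 1) * r `^ p) * \sum_(k < m) a k * S k x).
  by apply: measurable_funM; [exact: measurable_cst|exact: msum].
have sum0 x : 0 <= \sum_(k < m) a k * S k x.
  by apply: sumr_ge0 => k _; rewrite mulr_ge0// ltW.
have le_F x : B x -> `|f x - ball_mean f c r| `^ p * w x <= F x.
  move=> Bx.
  have /choice[u uP] : forall k, exists z, z \in Z k /\ enorm (x - z) < a k * r.
    by move=> k; have [_ _ /(_ x Bx)[z zZ xz]] := ZP k; exists z.
  have := sub_ball_mean kappa0 oE fh r0 BE Bx hG (fun k (_ : (k < m)%N) => (uP k).2).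
  rewrite -/(a m) -/eta => X.
  have G0 : 0 <= G by exact: le_trans (hG x (BE Bx)).
  have eta0 : 0 <= eta by rewrite mulr_ge0 ?(ltW (a0 m))// mulr_ge0// mulr_ge0// ltW.
  set Y := \sum_(k < m) _ in X.
  have Y0 : 0 <= Y by apply: sumr_ge0 => k _; rewrite mulr_ge0 ?(ltW (a0 k))// mulr_ge0 ?(ltW r0)// theta0.
  have X1 : `|f x - ball_mean f c r| `^ p <= 2 `^ (p - 1) * (eta `^ p + Y `^ p).
    apply: le_trans (powRD_le p1 eta0 Y0).
    by apply: ge0_ler_powR; rewrite ?nnegrE ?addr_ge0 ?(ltW p0).
  have X2 : Y `^ p <= 2 `^ (p - 1) * \sum_(k < m) a k * (r * theta k (u k)) `^ p.
    apply: le_trans (jensen_sum _ _ p1 _ _) _.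
    - by move=> k; exact: ltW.
    - by move=> k; rewrite mulr_ge0 ?(ltW r0)// theta0.
    rewrite ler_wpM2r//.
      by apply: sumr_ge0 => k _; rewrite mulr_ge0 ?powR_ge0 ?(ltW (a0 k)).
    apply: ge0_ler_powR; rewrite ?nnegrE ?subr_ge0 ?(ltW p1) ?geometric//.
    by apply: sumr_ge0 => k _; exact: ltW.
  have X3 k : theta k (u k) `^ p * w x <= S k x.
    rewrite /S (big_rem _ (uP k).1) /=.
    have -> : \1_(eball (u k) (a k * r)) x = 1 :> R by rewrite indicE mem_set//; exact: (uP k).2.
    rewrite mul1r lerDl; apply: sumr_ge0 => z _.
    exact: th0.
  have X4 : (\sum_(k < m) a k * (r * theta k (u k)) `^ p) * w x <=
      r `^ p * \sum_(k < m) a k * S k x.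
    rewrite mulr_suml mulr_sumr; apply: ler_sum => k _.
    rewrite powRM ?theta0 ?(ltW r0)//.
    have -> : a k * (r `^ p * theta k (u k) `^ p) * w x =
      r `^ p * (a k * (theta k (u k) `^ p * w x)) by ring.
    by rewrite ler_wpM2l ?powR_ge0// ler_wpM2l ?(ltW (a0 k))// X3.
  have c0 : 0 <= 2 `^ (p - 1) by exact: powR_ge0.
  apply: le_trans (ler_wpM2r (w0 x) X1) _.
  rewrite /F; set cc := 2 `^ (p - 1) in c0 X2 *.
  rewrite mulrDr mulrDl lerD2l -!mulrA ler_wpM2l//.
  apply: le_trans (ler_wpM2r (w0 x) X2) _.
  by rewrite -mulrA ler_wpM2l.
have mL : measurable_fun B (fun x => `|f x - ball_mean f c r| `^ p * w x).
  apply: measurable_funM; last exact: mw.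
  apply: measurable_powR_fun; apply: measurableT_comp; first exact: normr_measurable.
  by apply: measurable_funB; [exact: measurable_funS mf|exact: measurable_cst].
have mF : measurable_fun B F := measurable_funD mF1 mF2.
apply: (@le_trans _ _ (\int[mu]_(x in B) (F x)%:E)%E).
  apply: (le_integral_nonneg _ mB mL mF) => x Bx.
  by rewrite le_F// andbT mulr_ge0 ?powR_ge0.
have cc0 : 0 <= 2 `^ (p - 1) * eta `^ p by rewrite mulr_ge0 ?powR_ge0.
have cc1 : 0 <= 2 `^ (p - 1) * (2 `^ (p - 1) * r `^ p) by rewrite !mulr_ge0 ?powR_ge0.
rewrite (integralD_nonneg _ mB mF1 mF2); last 2 first.
- by move=> x _; exact: mulr_ge0.
- by move=> x _; exact: mulr_ge0.
rewrite (integralZl_nonneg _ mB (@mw B) (fun x _ => w0 x) cc0).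
rewrite (integralZl_nonneg _ mB msum (fun x _ => sum0 x) cc1).
apply: leeD2l.
have maS (k : 'I_m) : measurable_fun B (fun x => a k * S k x).
  by apply: measurable_funM; [exact: measurable_cst|exact: mS].
rewrite (integral_sum_nonneg _ _ mB maS); last first.
  by move=> k x _; exact: mulr_ge0 (ltW (a0 k)) (S0 k x).
set cK := K6 * 8 ^+ n.+1 in intS *.
have H0 : (0 <= H)%E by apply: integral_ge0 => x _; rewrite lee_fin.
have cK0 : 0 <= cK by rewrite mulr_ge0 ?exprn_ge0.
have sumle : (\sum_(k < m) \int[mu]_(x in B) (a k * S k x)%:E <= (2 * cK)%:E * H)%E.
  apply: (@le_trans _ _ (\sum_(k < m) (a k)%:E * (cK%:E * H))%E).
    apply: lee_sum => k _.
    rewrite (integralZl_nonneg _ mB (mS k) (fun x _ => S0 k x) (ltW (a0 k))).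
    by apply: lee_wpmul2l; [rewrite lee_fin ltW|exact: intS].
  rewrite -ge0_sume_distrl; last by move=> k _; rewrite lee_fin ltW.
  rewrite sumEFin (EFinM 2) -[leRHS]muleA; apply: lee_wpmul2r.
    by rewrite mule_ge0 ?lee_fin.
  by rewrite lee_fin geometric.
apply: le_trans (lee_wpmul2l _ sumle) _; first by rewrite lee_fin !mulr_ge0 ?powR_ge0.
rewrite muleA -EFinM le_eqVlt; apply/orP; left; apply/eqP; congr (_%:E * _)%E.
ring.
Qed.

Definition Poincare_const : R :=
  2 `^ (p - 1) * (2 `^ (p - 1) * (2 * (K6 * 8 ^+ n.+1))).

Lemma local_Poincare :
  (\int[mu]_(x in B) (`|f x - ball_mean f c r| `^ p * w x)%:E <=
   (Poincare_const * r `^ p)%:E * H)%E.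
Proof.
have [G G0 hG] := rp_grad_bounded fh.
have W0 : (0 <= \int[mu]_(x in B) (w x)%:E)%E.
  by apply: integral_ge0 => x _; rewrite lee_fin.
have WE : (\int[mu]_(x in B) (w x)%:E)%E = (fine (\int[mu]_(x in B) (w x)%:E))%:E.
  by rewrite fineK// ge0_fin_numE.
set W := fine _ in WE.
have {}W0 : 0 <= W by rewrite -lee_fin -WE.
apply/lee_addgt0Pr => e e0.
set D := 2 `^ (p - 1) * (2 * r * G) `^ p * W.
have D0 : 0 <= D by rewrite !mulr_ge0 ?powR_ge0.
(* Then [D / e < m + 1 <= 2 ^ m]; the factor actually present is [a m ^ p], which is at most
   [a m]. *)
pose m := Num.truncn (D / e).
have am : a m * D <= e.
  rewrite /a mulrC ler_pdivrMr ?exprn_gt0// mulrC -ler_pdivrMr//.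
  apply: le_trans (ltW (truncnS_gt _)) _; rewrite -/m -natrX ler_nat.
  exact: ltn_expl.
apply: le_trans (Poincare_approx m hG) _; rewrite addeC; apply: leeD.
  rewrite le_eqVlt; apply/orP; left; apply/eqP; congr (_%:E * _)%E.
  rewrite /Poincare_const; ring.
rewrite WE -EFinM lee_fin; apply: le_trans am.
rewrite powRM ?(ltW (a0 m))//; last by rewrite !mulr_ge0 ?(ltW r0) ?(ltW G0).
rewrite /D -!mulrA mulrCA ler_wpM2r ?mulr_ge0 ?powR_ge0//.
apply: ge1r_powR; last exact: ltW.
by rewrite a0 /a /= invf_le1 ?exprn_gt0// exprn_ege1// ler1n.
Qed.

End local_Poincare.

(** * Poincare inequality on Boman domains *)

Lemma integral_cover d (T : measurableType d) (R : realType)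
    (mu : {measure set T -> \bar R}) (I : Type) (s : seq I) (A : I -> set T)
    (D F : set T) (f : T -> R) :
  measurable D -> measurable F -> (forall i, measurable (A i)) ->
  F `<=` D -> measurable_fun D f -> (forall x, D x -> 0 <= f x) ->
  (forall x, F x -> 1 <= \sum_(i <- s) \1_(A i) x :> R) ->
  (\int[mu]_(x in F) (f x)%:E <= \sum_(i <- s) \int[mu]_(x in A i `&` D) (f x)%:E)%E.
Proof.
move=> mD mF mA FD mf f0 cover.
have mfF : measurable_fun F f by exact: measurable_funS mf.
have mi i : measurable_fun F (fun x => \1_(A i) x * f x).
  by apply: measurable_funM => //; apply: measurable_indic.
apply: (@le_trans _ _ (\sum_(i <- s) \int[mu]_(x in A i `&` F) (f x)%:E)%E); last first.
  apply: lee_sum => i _; apply: ge0_subset_integral.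
  - exact: measurableI.
  - exact: measurableI.
  - by apply/measurable_EFinP; apply: measurable_funS mf => // x [].
  - by move=> x [_ /f0]; rewrite lee_fin.
  - by move=> x [? /FD].
under eq_bigr do rewrite (integral_setI_indic mu _ mF (mA _)).
rewrite -(integral_sum_nonneg mu _ mF mi); last first.
  by move=> i x /FD/f0 fx; rewrite mulr_ge0.
apply: le_integral_nonneg => //.
  by apply: measurable_sum => i; exact: mi.
move=> x Fx; have fx := f0 x (FD x Fx); apply/andP; split => //.
by rewrite -mulr_suml ler_peMl// cover.
Qed.

Section exhaustion.
Context (R : realType) (n : nat).
Local Notation T := 'rV[R]_n.+1.
Implicit Types E : set T.

(** The points at distance at least [1 / (m + 1)] from the complement: a compact exhaustion of a
    bounded open set. *)
Definition inner_part E (m : nat) : set T :=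
  [set x | forall y, enorm (y - x) < m.+1%:R^-1 -> E y].

Lemma inner_part_sub E m : inner_part E m `<=` E.
Proof. by move=> x; apply; rewrite subrr enorm0. Qed.

Lemma closed_inner_part E m : closed (inner_part E m).
Proof.
rewrite -[inner_part E m]setCK; apply: open_closedC; rewrite openE => x.
move=> /existsNP[y /not_implyP[yx nEy]].
have d0 : 0 < m.+1%:R^-1 - enorm (y - x) by rewrite subr_gt0.
apply: filterS (nbhs_eball x d0) => z; rewrite /eball /= => zx Ez; apply: nEy.
apply: Ez; apply: le_lt_trans (enorm_triangle x y z) _.
by rewrite (enormB x z) addrC -ltrBrDr.
Qed.

Lemma compact_inner_part E m : bounded_set E -> compact (inner_part E m).
Proof.
move=> [M [Mr bE]]; apply: bounded_closed_compact; last exact: closed_inner_part.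
by exists M; split => // s /bE Es x /inner_part_sub /Es.
Qed.

Lemma inner_part_nondecreasing E :
  {homo (inner_part E) : m k / (m <= k)%N >-> (m <= k)%O}.
Proof.
move=> m k mk; apply/subsetPset => x Ex y yx; apply: Ex; apply: lt_le_trans yx _.
by rewrite lef_pV2 ?posrE// ler_nat.
Qed.

Lemma bigcup_inner_part E : open E -> E = \bigcup_m inner_part E m.
Proof.
move=> oE; apply/seteqP; split => [x Ex|x [m _]]; last exact: inner_part_sub.
have [d d0 xd] := open_eballP oE Ex.
exists (Num.truncn d^-1) => // y yx; apply: xd; rewrite /eball /=.
apply: lt_le_trans yx _; rewrite invf_ple ?posrE//.
exact/ltW/truncnS_gt.
Qed.

End exhaustion.

(** * Chains of balls as duplicate-free lists *)

Section Boman_balls.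
Context (R : realType) (n : nat).
Local Notation T := 'rV[R]_n.+1.
Local Notation Bl := (fun D : T * R => eball D.1 D.2).

Lemma scaled_ball1 (D : T * R) : scaled_ball 1 D = Bl D.
Proof. by rewrite /scaled_ball mul1r. Qed.

Definition Boman_adjacent (M : R) (D D' : T * R) : bool :=
  `[< exists2 S : T * R, 0 < S.2 &
        Bl S `<=` Bl D `&` Bl D' /\ Bl D `|` Bl D' `<=` scaled_ball M S >].

(** Cutting loops out of a chain keeps adjacency and the condition on dilates. Without repetitions,
    a sum over the chain is dominated by one over any list containing it, and the overlap bound
    applies. *)
Lemma Boman_chain_uniq M (W : set (T * R)) (B0 B : T * R) : Boman_chain M W B0 B ->
  exists q : seq (T * R), [/\ uniq (B0 :: q), path (Boman_adjacent M) B0 q, last B0 q = B &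
    {in B0 :: q, forall D, W D /\ Bl B `<=` scaled_ball M D}].
Proof.
move=> [k [C [C0 Ck WC adjC]]].
pose q0 := [seq C i | i <- iota 1 k].
have lastq : last B0 q0 = B.
  have li m j : last m (iota m.+1 j) = (m + j)%N.
    by elim: j m => [|j IH] m /=; rewrite ?addn0// IH addnS.
  by rewrite -C0 -Ck /q0 last_map li.
have pathq : path (Boman_adjacent M) B0 q0.
  have gen j l : (forall i, (j <= i < j + l)%N -> Boman_adjacent M (C i) (C i.+1)) ->
      path (Boman_adjacent M) (C j) [seq C i | i <- iota j.+1 l].
    elim: l j => //= l IH j adj; rewrite adj ?leqnn ?addnS ?ltnS ?leq_addr//=.
    apply: IH => i /andP[ji il]; apply: adj.
    by rewrite (ltnW ji) addnS -addSn.
  rewrite -C0 /q0; apply: gen => i; rewrite add0n => /andP[_ ik].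
  have [S S0] := adjC i ik; rewrite !scaled_ball1 => h.
  by apply/asboolP; exists S.
have Wq : {in B0 :: q0, forall D, W D /\ Bl B `<=` scaled_ball M D}.
  move=> D; rewrite in_cons => /predU1P[->|].
    by have := WC 0%N (leq0n _); rewrite C0 scaled_ball1.
  rewrite /q0 => /seq.mapP[i]; rewrite mem_iota add1n ltnS => /andP[_ ik] ->.
  by have := WC i ik; rewrite scaled_ball1.
case/shortenP: pathq lastq => q pq uq sub lastq.
exists q; split => // D; rewrite in_cons => /predU1P[->|/sub Dq].
  by apply: Wq; exact: mem_head.
by apply: Wq; rewrite in_cons Dq orbT.
Qed.

(** A finite sum is a lower bound of the sum over [W], and [tau >= 1] puts each ball in its
    dilate. *)
Lemma Boman_overlap (E : set T) (tau M : R) (W : set (T * R)) (s : seq (T * R)) x :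
  1 <= tau -> (forall B, W B -> 0 < B.2) ->
  (\esum_(B in W) (\1_(scaled_ball tau B) x)%:E <= (M * \1_E x)%:E)%E ->
  uniq s -> {in s, forall D, W D} -> \sum_(D <- s) \1_(Bl D) x <= M * \1_E x.
Proof.
move=> tau1 W0 xM us sW; rewrite -lee_fin; apply: le_trans xM.
apply: esum_ge; exists [set` s].
  split; first exact: finite_seq.
  by move=> D /=; exact: sW.
rewrite -fsbig_seq// -sumEFin big_seq [leRHS]big_seq; apply: lee_sum => D Ds.
rewrite lee_fin !indicE ler_nat.
have sub : Bl D `<=` scaled_ball tau D.
  move=> y; rewrite /scaled_ball /eball /= => /lt_le_trans; apply.
  by rewrite ler_peMl// ltW//; exact: (W0 _ (sW _ Ds)).
case: (boolP (x \in Bl D)) => // /set_mem/sub xD.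
by rewrite mem_set.
Qed.

End Boman_balls.

(** * The weighted Poincare inequality on a Boman domain *)

Section global_Poincare.
Context (R : realType) (n : nat).
Local Notation T := 'rV[R]_n.+1.
Local Notation mu := (@lebesgue_rV R n).
Local Notation kappa := (unit_ball_volume R n).
Local Notation Bl := (fun D : T * R => eball D.1 D.2).
Context (p : R) (w : T -> R) (K : R).
Hypothesis kappa0 : 0 < kappa.
Hypothesis pw : Ap_bound p w K.
Context (E : set T) (rho : R).
Hypothesis oE : open E.
Hypothesis rho0 : 0 < rho.
Hypothesis Erho : E `<=` eball 0 rho.
Hypothesis wE : (\int[mu]_(x in E) (w x)%:E < +oo)%E.
Context (tau M : R) (W : set (T * R)) (B0 : T * R).
Hypothesis tau1 : 1 <= tau.
Hypothesis M1 : 1 < M.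
Hypothesis W_gt0 : forall B, W B -> 0 < B.2.
Hypothesis EW : E = \bigcup_(B in W) scaled_ball 1 B.
Hypothesis W_overlap : forall x,
  (\esum_(B in W) (\1_(scaled_ball tau B) x)%:E <= (M * \1_E x)%:E)%E.
Hypothesis W_chain : forall B, W B -> Boman_chain M W B0 B.
Context (f h : T -> R).
Hypothesis fh : regular_pair E f h.

Let p1 : 1 < p := Ap_gt1 pw.
Let p0 : 0 < p. Proof. exact: lt_trans p1. Qed.
Let w0 : forall x, 0 <= w x := Ap_ge0 pw.
Let h0 : forall x, 0 <= h x := rp_ge0 fh.
Let M0 : 0 < M. Proof. exact: lt_trans M1. Qed.
Let K0 : 0 <= K. Proof. exact: (Ap_bound_ge0 kappa0 pw). Qed.
Let mE : measurable E. Proof. exact: open_measurable_rV. Qed.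
Let mw (A : set T) : measurable_fun A w. Proof. exact: (measurable_weight pw). Qed.
Let hw x := h x `^ p * w x.
Let hw0 x : 0 <= hw x. Proof. by rewrite mulr_ge0 ?powR_ge0. Qed.
Let mhw : measurable_fun E hw.
Proof.
apply: measurable_funM; last exact: mw.
by apply: measurable_powR_fun; exact: (rp_measurable fh).
Qed.
Let mf : measurable_fun E f.
Proof. by apply: continuous_measurable_rV => // x /set_mem; exact: rp_continuous fh _. Qed.

Let Wsub D : W D -> Bl D `<=` E.
Proof. by move=> WD x xD; rewrite EW; exists D => //; rewrite scaled_ball1. Qed.

Let Wt A := fine (\int[mu]_(x in A) (w x)%:E).
Let Hh A := fine (\int[mu]_(x in A) (hw x)%:E).

Let sub_fin (g : T -> R) (A : set T) : measurable A -> A `<=` E ->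
  measurable_fun E g -> (forall x, 0 <= g x) ->
  (\int[mu]_(x in E) (g x)%:E < +oo)%E ->
  (\int[mu]_(x in A) (g x)%:E)%E = (fine (\int[mu]_(x in A) (g x)%:E))%:E.
Proof.
move=> mA AE mg g0 goo; rewrite fineK// ge0_fin_numE; last first.
  by apply: integral_ge0 => x _; rewrite lee_fin.
apply: le_lt_trans goo; apply: (ge0_subset_integral mu mA mE).
- exact/measurable_EFinP.
- by move=> x _; rewrite lee_fin.
- exact: AE.
Qed.

Let WtE A : measurable A -> A `<=` E -> (\int[mu]_(x in A) (w x)%:E)%E = (Wt A)%:E.
Proof. by move=> mA AE; apply: sub_fin. Qed.

Let hwE : (\int[mu]_(x in E) (hw x)%:E < +oo)%E.
Proof.
have [G G0 hG] := rp_grad_bounded fh.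
apply: (@le_lt_trans _ _ (\int[mu]_(x in E) (G `^ p * w x)%:E)%E).
  apply: (le_integral_nonneg _ mE mhw).
    by apply: measurable_funM; [exact: measurable_cst|exact: mw].
  move=> x Ex; rewrite hw0/= ler_wpM2r//; apply: ge0_ler_powR; rewrite ?nnegrE ?(ltW p0) ?(ltW G0)//.
  exact: hG.
rewrite (integralZl_nonneg _ mE (@mw E) (fun x _ => w0 x) (powR_ge0 _ _)).
by rewrite lte_mul_pinfty ?lee_fin ?powR_ge0.
Qed.

Let HhE A : measurable A -> A `<=` E -> (\int[mu]_(x in A) (hw x)%:E)%E = (Hh A)%:E.
Proof. by move=> mA AE; apply: sub_fin. Qed.

Let Wt_ge0 A : 0 <= Wt A.
Proof. by apply/fine_ge0/integral_ge0 => x _; rewrite lee_fin. Qed.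

Let Hh_ge0 A : 0 <= Hh A.
Proof. by apply/fine_ge0/integral_ge0 => x _; rewrite lee_fin. Qed.

Let mB (D : T * R) : measurable (Bl D). Proof. exact: measurable_eball. Qed.

(** If the weight of the ball vanished, [w] would be 0 almost everywhere on it, so by positivity of
    [w] the ball would be null, against [kappa0]. This permits the divisions by [Wt]. *)
Let Wt_gt0 D : W D -> 0 < Wt (Bl D).
Proof.
move=> WD; rewrite lt_neqAle Wt_ge0 andbT eq_sym; apply/eqP => WtD0.
have I0 : (\int[mu]_(x in Bl D) `|(w x)%:E| = 0)%E.
  rewrite -[RHS]/(0%:E) -WtD0 -WtE//; last exact: Wsub.
  by apply: eq_integral => x _; rewrite gee0_abs// lee_fin.
have mwD : measurable_fun (Bl D) (EFin \o w) by apply/measurable_EFinP; exact: mw.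
have ae0 := (ae_eq_integral_abs mu (mB D) mwD).1 I0.
have : mu.-negligible (Bl D).
  suff : {ae mu, forall x, ~ Bl D x}.
    by apply: negligibleS => x Dx; apply.
  apply: filterS2 ae0 (Ap_gt0 pw) => x wx0 wx Dx.
  by have := wx0 Dx => /= -[] wE0; rewrite wE0 ltxx in wx.
move=> negD; have : mu (eball D.1 D.2) = 0%E by apply/(negligibleP mu (mB D)).
rewrite lebesgue_eballE ?W_gt0// => -[].
by apply/eqP; rewrite gt_eqF// mulr_gt0// exprn_gt0// W_gt0.
Qed.

Let K' := K * M `^ (n.+1%:R * p).
Let K'0 : 0 <= K'. Proof. by rewrite mulr_ge0 ?powR_ge0. Qed.

Let doubling (D : T * R) : 0 < D.2 ->
  (\int[mu]_(x in scaled_ball M D) (w x)%:E <=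
    K'%:E * \int[mu]_(x in Bl D) (w x)%:E)%E.
Proof.
move=> D0; have MD0 : 0 < M * D.2 by rewrite mulr_gt0.
have sub : eball D.1 D.2 `<=` eball D.1 (M * D.2).
  by move=> x; rewrite /eball /= => /lt_le_trans; apply; rewrite ler_peMl// ltW.
have := Ap_doubling kappa0 pw D0 MD0 sub.
by rewrite mulfK ?gt_eqF.
Qed.

Let C1 := Poincare_const n p K.
Let C1_ge0 : 0 <= C1.
Proof. by rewrite !mulr_ge0 ?powR_ge0 ?exprn_ge0. Qed.

Let mean D := ball_mean f D.1 D.2.
Let osc (b : R) x := `|f x - b| `^ p * w x.
Let osc0 b x : 0 <= osc b x. Proof. by rewrite mulr_ge0 ?powR_ge0. Qed.
Let mosc b : measurable_fun E (osc b).
Proof.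
apply: measurable_funM; last exact: mw.
apply: measurable_powR_fun; apply: measurableT_comp; first exact: normr_measurable.
by apply: measurable_funB; [exact: mf|exact: measurable_cst].
Qed.

Let osc_ball D : W D ->
  (\int[mu]_(x in Bl D) (osc (mean D) x)%:E <= (C1 * D.2 `^ p * Hh (Bl D))%:E)%E.
Proof.
move=> WD.
have wD : (\int[mu]_(x in Bl D) (w x)%:E < +oo)%E by rewrite WtE ?ltry//; exact: Wsub.
have := local_Poincare kappa0 pw oE fh (W_gt0 WD) (Wsub WD) wD.
by rewrite -/hw HhE//; exact: Wsub.
Qed.

(** Up to a constant, the bound of the one-ball inequality for the weighted [L^p] average of the
    oscillation of [f] on [D]. *)
Let e D := D.2 * (Hh (Bl D) / Wt (Bl D)) `^ p^-1.
Let e0 D : W D -> 0 <= e D.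
Proof. by move=> WD; rewrite mulr_ge0 ?powR_ge0// ltW// W_gt0. Qed.

Let e_pow D : W D -> e D `^ p = D.2 `^ p * (Hh (Bl D) / Wt (Bl D)).
Proof.
move=> WD; rewrite /e powRM ?powR_ge0 ?(ltW (W_gt0 WD))//.
by rewrite -powRrM mulVf ?gt_eqF// powRr1// divr_ge0.
Qed.

Let osc_split (b b' : R) (x : T) :
  osc b x <= 2 `^ (p - 1) * (osc b' x + `|b' - b| `^ p * w x).
Proof.
rewrite /osc -mulrDl mulrA ler_wpM2r//; apply: le_trans (powRD_le p1 _ _) => //.
by apply: ge0_ler_powR; rewrite ?nnegrE ?addr_ge0 ?(ltW p0) ?ler_distD.
Qed.

Let C2 := (2 `^ (p - 1) * C1 * K') `^ p^-1.

(** The constant difference of the two means is integrated over the common ball [S], where it is at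
    most the sum of the oscillations about each mean. Doubling makes the weight of [S] comparable to
    those of [D] and [D']. *)
Let link D D' : W D -> W D' -> Boman_adjacent M D D' ->
  `|mean D - mean D'| <= C2 * (e D + e D').
Proof.
move=> WD WD' /asboolP[S S0 [SDD' DD'S]].
have SD : Bl S `<=` Bl D by move=> x /SDD'[].
have SD' : Bl S `<=` Bl D' by move=> x /SDD'[].
have SE : Bl S `<=` E by exact: subset_trans (Wsub WD).
have dist0 : 0 <= `|mean D - mean D'| by [].
set t := `|mean D - mean D'|.
have comp Y : W Y -> Bl Y `<=` scaled_ball M S -> Wt (Bl Y) <= K' * Wt (Bl S).
  move=> WY YS; rewrite -lee_fin EFinM -!WtE//; last exact: Wsub.
  apply: le_trans (doubling S0).
  apply: (ge0_subset_integral mu (mB Y) (measurable_eball _ _)).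
  - by apply/measurable_EFinP; exact: mw.
  - by move=> x _; rewrite lee_fin.
  - exact: YS.
have compD : Wt (Bl D) <= K' * Wt (Bl S) by apply: comp => // x Dx; apply: DD'S; left.
have compD' : Wt (Bl D') <= K' * Wt (Bl S) by apply: comp => // x Dx; apply: DD'S; right.
have step Y : W Y -> Bl S `<=` Bl Y ->
    (\int[mu]_(x in Bl S) (osc (mean Y) x)%:E <= (C1 * Y.2 `^ p * Hh (Bl Y))%:E)%E.
  move=> WY SY; apply: le_trans (osc_ball WY).
  apply: (ge0_subset_integral mu (mB S) (mB Y)).
  - by apply/measurable_EFinP; apply: measurable_funS (mosc _); [exact: mE|exact: Wsub].
  - by move=> x _; rewrite lee_fin.
  - exact: SY.
have moS b : measurable_fun (Bl S) (osc b) by apply: measurable_funS (mosc b).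
have moSS : measurable_fun (Bl S) (fun x => osc (mean D) x + osc (mean D') x).
  exact: measurable_funD.
have H : t `^ p * Wt (Bl S) <= 2 `^ (p - 1) *
    (C1 * D.2 `^ p * Hh (Bl D) + C1 * D'.2 `^ p * Hh (Bl D')).
  rewrite -lee_fin EFinM -WtE//.
  rewrite -(integralZl_nonneg _ (mB S) (@mw _) (fun x _ => w0 x) (powR_ge0 _ _)).
  apply: (@le_trans _ _ (\int[mu]_(x in Bl S) (2 `^ (p - 1) * (osc (mean D) x + osc (mean D') x))%:E)%E).
    apply: (le_integral_nonneg mu (mB S)).
    - by apply: measurable_funM; [exact: measurable_cst|exact: mw].
    - by apply: measurable_funM; [exact: measurable_cst|exact: moSS].
    - move=> x _; rewrite mulr_ge0 ?powR_ge0//=.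
      rewrite /osc -mulrDl mulrA ler_wpM2r//; apply: le_trans (powRD_le p1 _ _) => //.
      apply: ge0_ler_powR; rewrite ?nnegrE ?addr_ge0 ?(ltW p0)//.
      by rewrite /t (distrC (f x) (mean D)) ler_distD.
  have oo0 x : Bl S x -> 0 <= osc (mean D) x + osc (mean D') x.
    by move=> _; exact: addr_ge0.
  rewrite (integralZl_nonneg _ (mB S) moSS oo0 (powR_ge0 _ _)).
  rewrite EFinM lee_wpmul2l ?lee_fin ?powR_ge0//.
  rewrite (integralD_nonneg _ (mB S) (moS _) (moS _) (fun x _ => osc0 _ x) (fun x _ => osc0 _ x)).
  by rewrite EFinD leeD ?step.
have WtD := Wt_gt0 WD; have WtD' := Wt_gt0 WD'.
have WtS : 0 < Wt (Bl S).
  rewrite lt_neqAle Wt_ge0 andbT eq_sym; apply/eqP => S00.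
  by move: compD; rewrite S00 mulr0; lra.
have eD := e_pow WD; have eD' := e_pow WD'.
have H2 : t `^ p <= 2 `^ (p - 1) * C1 * K' * (e D `^ p + e D' `^ p).
  rewrite -(ler_pM2r WtS); apply: le_trans H _.
  have alg (a c k x y z : R) : a * c * k * (x + y) * z =
    a * (c * x * (k * z) + c * y * (k * z)) by ring.
  rewrite alg.
  rewrite ler_wpM2l ?powR_ge0//.
  have le1 Y : W Y -> Wt (Bl Y) <= K' * Wt (Bl S) ->
      C1 * Y.2 `^ p * Hh (Bl Y) <= C1 * e Y `^ p * (K' * Wt (Bl S)).
    move=> WY; rewrite -(ler_pM2l (Wt_gt0 WY)) => cY.
    have WtY := Wt_gt0 WY; rewrite e_pow//.
    have -> : C1 * Y.2 `^ p * Hh (Bl Y) =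
      C1 * (Y.2 `^ p * (Hh (Bl Y) / Wt (Bl Y))) * Wt (Bl Y) by field; rewrite gt_eqF.
    rewrite ler_wpM2l ?mulr_ge0 ?powR_ge0 ?invr_ge0//.
    by move: cY; rewrite ler_pM2l.
  by apply: lerD; apply: le1.
have t_pow : t `^ p <= (C2 * (e D + e D')) `^ p.
  rewrite powRM ?powR_ge0 ?addr_ge0 ?e0// /C2 -powRrM mulVf ?gt_eqF//.
  rewrite powRr1 ?mulr_ge0 ?powR_ge0//; apply: le_trans H2 _.
  rewrite ler_wpM2l ?mulr_ge0 ?powR_ge0// powR_superadditive ?e0// ltW//.
rewrite leNgt; apply/negP => lt_t.
have := @gt0_ltr_powR R p p0 _ _ _ _ lt_t; rewrite !nnegrE mulr_ge0 ?powR_ge0 ?addr_ge0 ?e0//.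
by move=> /(_ isT dist0); rewrite ltNge t_pow.
Qed.

(** Each ball takes part in at most two links, whence the factor 2. *)
Let chain_sum (q : seq (T * R)) D : {in D :: q, forall Y, W Y} ->
  path (Boman_adjacent M) D q ->
  `|mean D - mean (last D q)| <= 2 * C2 * \sum_(Y <- D :: q) e Y.
Proof.
have C20 : 0 <= C2 by exact: powR_ge0.
suff main : {in D :: q, forall Y, W Y} -> path (Boman_adjacent M) D q ->
  `|mean D - mean (last D q)| <= C2 * e D + 2 * C2 * \sum_(Y <- q) e Y.
  move=> WDq pq; apply: le_trans (main WDq pq) _.
  rewrite big_cons mulrDr lerD2r; apply: ler_wpM2r; last by rewrite ler_peMl// ler1n.
  by apply: e0; apply: WDq; exact: mem_head.
elim: q D => [|Y q IH] D WDq /=.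
  move=> _; rewrite subrr normr0 big_nil mulr0 addr0; apply: mulr_ge0 => //.
  by apply: e0; apply: WDq; exact: mem_head.
move=> /andP[adj pq]; apply: le_trans (ler_distD (mean Y) _ _) _.
have WD : W D by apply: WDq; rewrite mem_head.
have WY : W Y by apply: WDq; rewrite !inE eqxx orbT.
have l1 := link WD WY adj.
have l2 : `|mean Y - mean (last Y q)| <= C2 * e Y + 2 * C2 * \sum_(Y0 <- q) e Y0.
  by apply: IH => // Z Zq; apply: WDq; rewrite in_cons Zq orbT.
have alg (c x y z : R) : c * (x + y) + (c * y + 2 * c * z) = c * x + 2 * c * (y + z) by ring.
by rewrite big_cons -alg; exact: lerD.
Qed.

Let radius_le D : W D -> D.2 <= rho.
Proof.
move=> WD; rewrite leNgt; apply/negP => rD.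
have := @le_outer_measure _ _ mu (Bl D) (eball 0 rho) (subset_trans (Wsub WD) Erho).
rewrite /= !lebesgue_eballE ?W_gt0// lee_fin ler_pM2r// leNgt.
by rewrite ltrXn2r// ?nnegrE ?(ltW rho0)// ltW// W_gt0.
Qed.

Let overlap (s : seq (T * R)) x : uniq s -> {in s, forall D, W D} ->
  \sum_(D <- s) \1_(Bl D) x <= M.
Proof.
move=> us sW; apply: le_trans (Boman_overlap tau1 W_gt0 (W_overlap x) us sW) _.
by rewrite ler_piMr ?(ltW M0)// indicE; case: (x \in E).
Qed.

Let sum_Hh (s : seq (T * R)) : uniq s -> {in s, forall D, W D} ->
  \sum_(D <- s) Hh (Bl D) <= M * Hh E.
Proof.
move=> us sW; rewrite -lee_fin EFinM -sumEFin -(HhE mE (@subset_refl _ E)).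
apply: le_trans (sum_integral_overlap mu mE mB mhw (fun x _ => hw0 x) (fun x _ => overlap x us sW)).
rewrite big_seq [leRHS]big_seq; apply: lee_sum => D Ds.
by rewrite (setIidl (Wsub (sW D Ds))) -HhE//; exact: Wsub (sW D Ds).
Qed.

Let under (B D : T * R) : bool := `[< Bl B `<=` scaled_ball M D >].

(** The balls under [D] lie in its dilate, overlap at most [M] times there, and the dilate is
    controlled by doubling. *)
Let sum_Wt (s : seq (T * R)) D : uniq s -> {in s, forall D, W D} -> W D ->
  \sum_(B <- s | under B D) Wt (Bl B) <= M * (K' * Wt (Bl D)).
Proof.
move=> us sW WD; rewrite -big_filter.
set s' := [seq B <- s | under B D].
have us' : uniq s' by exact: filter_uniq.
have s'P : {in s', forall B, W B /\ Bl B `<=` scaled_ball M D}.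
  by move=> B; rewrite mem_filter => /andP[/asboolP ? /sW].
have mMD : measurable (scaled_ball M D) by exact: measurable_eball.
have s'W : {in s', forall B, W B} by move=> B /s'P[].
rewrite -lee_fin -sumEFin !EFinM -WtE//; last exact: Wsub.
apply: (@le_trans _ _ (M%:E * \int[mu]_(x in scaled_ball M D) (w x)%:E)%E).
  apply: le_trans (sum_integral_overlap mu mMD mB (@mw _) (fun x _ => w0 x) (fun x _ => overlap x us' s'W)).
  rewrite big_seq [leRHS]big_seq; apply: lee_sum => B Bs.
  by rewrite (setIidl (s'P B Bs).2) -WtE//; exact: Wsub (s'W B Bs).
apply: lee_wpmul2l; first by rewrite lee_fin ltW.
exact: doubling (W_gt0 WD).
Qed.

Let R1 := 2 * (M * (2 * (M + 1)) ^+ n.+1) * rho.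
Let R1_ge0 : 0 <= R1.
Proof. by rewrite !mulr_ge0 ?(ltW M0) ?(ltW rho0) ?exprn_ge0// mulr_ge0// addr_ge0// ltW. Qed.

Let sum_radii_under (U : seq (T * R)) B : uniq U -> {in U, forall D, W D} -> W B ->
  \sum_(D <- U | under B D) D.2 <= R1.
Proof.
move=> uU UW WB; rewrite -big_filter.
have sub : {in [seq D <- U | under B D], forall D, W D /\ Bl B `<=` scaled_ball M D}.
  by move=> D; rewrite mem_filter => /andP[/asboolP ? /UW].
apply: (sum_radii kappa0 (x := B.1)) => //; [exact: ltW|exact: ltW|..].
  move=> D /sub[WD BD]; split; [exact: W_gt0|exact: radius_le|].
  have : Bl B B.1 by rewrite /eball /= subrr enorm0 W_gt0.
  by move=> /BD; rewrite /scaled_ball /eball /= enormB.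
by move=> y; apply: overlap; [exact: filter_uniq|move=> D /sub[]].
Qed.

Let C3 := (2 * C2) `^ p * R1 `^ (p - 1).
Let C3_ge0 : 0 <= C3. Proof. by rewrite mulr_ge0 ?powR_ge0. Qed.

(* Only the balls [D] with [B] inside [M D] enter, and these do not depend on the
   chain; exchanging the sums over [B] and [D] then costs a doubling constant. *)
Let mean_diff (U : seq (T * R)) (q : seq (T * R)) B : W B -> uniq U ->
  {in U, forall D, W D} ->
  uniq (B0 :: q) -> path (Boman_adjacent M) B0 q -> last B0 q = B ->
  {in B0 :: q, forall D, W D /\ Bl B `<=` scaled_ball M D} ->
  {subset B0 :: q <= U} ->
  `|mean B0 - mean B| `^ p <=
    C3 * \sum_(D <- U | under B D) D.2 * (Hh (Bl D) / Wt (Bl D)).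
Proof.
move=> WB uU UW uq pq lq qP qU.
have qW : {in B0 :: q, forall D, W D} by move=> D /qP[].
have C20 : 0 <= C2 by exact: powR_ge0.
have := chain_sum qW pq; rewrite lq => h1.
(* The chain has no repetitions and all its balls lie in [U] and have [B] under them; the remaining
   terms on the right are non-negative. *)
have h2 : \sum_(Y <- B0 :: q) e Y <= \sum_(D <- U | under B D) e D.
  rewrite -[leRHS]big_filter.
  rewrite [leRHS](bigID (fun D => D \in B0 :: q)) /=.
  rewrite -[leLHS]addr0; apply: lerD.
    rewrite -[leRHS]big_filter le_eqVlt; apply/orP; left; apply/eqP.
    apply: perm_big; apply: uniq_perm => //; first by rewrite !filter_uniq.
    move=> D; rewrite !mem_filter; have [Dq|//] := boolP (D \in B0 :: q).
    by rewrite qU// andbT; symmetry; apply/asboolP; have [] := qP D Dq.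
  rewrite big_seq_cond; apply: sumr_ge0 => D; rewrite mem_filter => /andP[/andP[_ /UW WD] _].
  exact: e0.
have sum0 : 0 <= \sum_(D <- U | under B D) e D.
  by rewrite big_seq_cond; apply: sumr_ge0 => D /andP[/UW WD _]; exact: e0.
have h3 : `|mean B0 - mean B| <= 2 * C2 * \sum_(D <- U | under B D) e D.
  by apply: le_trans h1 _; rewrite ler_wpM2l// mulr_ge0.
apply: (@le_trans _ _ ((2 * C2 * \sum_(D <- U | under B D) e D) `^ p)).
  by apply: ge0_ler_powR; rewrite ?nnegrE ?(ltW p0)// !mulr_ge0.
rewrite powRM ?mulr_ge0// /C3 -mulrA ler_wpM2l ?powR_ge0//.
(* Jensen's inequality with the radii as weights, whose sum is at most [R1]; the maximum makes the
   weight non-negative for every pair and changes nothing on [U]. *)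
pose l (D : T * R) := Num.max 0 D.2.
pose b (D : T * R) := (Hh (Bl D) / Wt (Bl D)) `^ p^-1.
have lE D : D \in U -> l D = D.2.
  by move=> /UW/W_gt0 D0; rewrite /l; apply/max_idPr; exact: ltW.
have -> : \sum_(D <- U | under B D) e D = \sum_(D <- U | under B D) l D * b D.
  by rewrite big_seq_cond [RHS]big_seq_cond; apply: eq_bigr => D /andP[/lE ->].
apply: le_trans (jensen_sum _ _ p1 _ _) _.
- by move=> D; rewrite /l le_max lexx.
- by move=> D; exact: powR_ge0.
have -> : \sum_(D <- U | under B D) l D * b D `^ p =
    \sum_(D <- U | under B D) D.2 * (Hh (Bl D) / Wt (Bl D)).
  rewrite big_seq_cond [RHS]big_seq_cond; apply: eq_bigr => D /andP[/lE -> _].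
  by rewrite /b -powRrM mulVf ?gt_eqF// powRr1// divr_ge0.
have -> : \sum_(D <- U | under B D) l D = \sum_(D <- U | under B D) D.2.
  by rewrite big_seq_cond [RHS]big_seq_cond; apply: eq_bigr => D /andP[/lE ->].
apply: ler_wpM2r.
  rewrite big_seq_cond; apply: sumr_ge0 => D /andP[/UW/W_gt0 D0 _].
  by rewrite mulr_ge0 ?divr_ge0// ltW.
apply: ge0_ler_powR; rewrite ?nnegrE ?subr_ge0 ?(ltW p1)//.
  by rewrite big_seq_cond; apply: sumr_ge0 => D /andP[/UW/W_gt0 D0 _]; exact: ltW.
exact: sum_radii_under.
Qed.

(** The first summand comes from the oscillation of [f] about the mean over each ball, the second
    from the differences of these means to the central one. Neither [f] nor the compact set below
    enters. *)
Definition Boman_Poincare_const : R :=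
  2 `^ (p - 1) * (C1 * rho `^ p * M + C3 * (rho * (M * K') * M)).

Let compact_Poincare (F : set T) : measurable F -> compact F -> F `<=` E ->
  (\int[mu]_(x in F) (osc (mean B0) x)%:E <= (Boman_Poincare_const * Hh E)%:E)%E.
Proof.
move=> mF cF FE.
have [s0 s0W Fs0] : finite_subset_cover W Bl F.
  rewrite compact_cover in cF; apply: cF; first by move=> D _; exact: open_eball.
  by move=> x /FE; rewrite EW => -[D WD]; rewrite scaled_ball1; exists D.
pose s : seq (T * R) := finmap.enum_fset s0.
have us : uniq s by exact: finmap.fset_uniq.
have sW : {in s, forall D, W D} by move=> D Ds; exact/set_mem/s0W.
have chain_ex B : exists q : seq (T * R), W B -> [/\ uniq (B0 :: q),
    path (Boman_adjacent M) B0 q, last B0 q = B &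
    {in B0 :: q, forall D, W D /\ Bl B `<=` scaled_ball M D}].
  have [WB|nWB] := pselect (W B); last by exists [::].
  by have [q qP] := Boman_chain_uniq (W_chain WB); exists q.
have [q qP] := choice chain_ex.
(* One list containing the chains of all balls of the finite cover, so that the sums over [B] and
   [D] have fixed ranges. *)
pose U := undup (flatten [seq B0 :: q B | B <- s]).
have uU : uniq U by exact: undup_uniq.
have UW : {in U, forall D, W D}.
  move=> D; rewrite mem_undup => /flatten_mapP[B Bs Dq].
  by have [_ _ _ /(_ D Dq)[]] := qP B (sW B Bs).
have key B : B \in s -> (\int[mu]_(x in Bl B `&` E) (osc (mean B0) x)%:E <=
    (2 `^ (p - 1) * (C1 * rho `^ p * Hh (Bl B) +
      C3 * \sum_(D <- U | under B D) D.2 * (Hh (Bl D) / Wt (Bl D)) * Wt (Bl B)))%:E)%E.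
  move=> Bs; have WB := sW B Bs; rewrite (setIidl (Wsub WB)).
  have [uq pq lq qBP] := qP B WB.
  have qU : {subset B0 :: q B <= U}.
    by move=> D Dq; rewrite mem_undup; apply/flatten_mapP; exists B.
  have md := mean_diff WB uU UW uq pq lq qBP qU.
  set Sg := \sum_(D <- U | _) _ in md *.
  have moB b : measurable_fun (Bl B) (osc b).
    by apply: measurable_funS (mosc b); [exact: mE|exact: Wsub].
  pose cc := C3 * Sg.
  have cc0 : 0 <= cc by exact: le_trans (powR_ge0 _ _) md.
  have mccw : measurable_fun (Bl B) (fun x => cc * w x).
    by apply: measurable_funM; [exact: measurable_cst|exact: mw].
  have msum : measurable_fun (Bl B) (fun x => osc (mean B) x + cc * w x).
    exact: measurable_funD.
  have s0' x : Bl B x -> 0 <= osc (mean B) x + cc * w x.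
    by move=> _; rewrite addr_ge0 ?osc0// mulr_ge0.
  apply: (@le_trans _ _ (\int[mu]_(x in Bl B) (2 `^ (p - 1) * (osc (mean B) x + cc * w x))%:E)%E).
    apply: (le_integral_nonneg mu (mB B) (moB _)).
      by apply: measurable_funM; [exact: measurable_cst|exact: msum].
    move=> x _; rewrite osc0/=; apply: le_trans (osc_split _ (mean B) _) _.
    by rewrite ler_wpM2l ?powR_ge0// lerD2l ler_wpM2r// distrC.
  rewrite (integralZl_nonneg _ (mB B) msum s0' (powR_ge0 _ _)) EFinM.
  apply: lee_wpmul2l; first by rewrite lee_fin powR_ge0.
  rewrite (integralD_nonneg _ (mB B) (moB _) mccw (fun x _ => osc0 _ x)); last first.
    by move=> x _; exact: mulr_ge0.
  rewrite (integralZl_nonneg _ (mB B) (@mw _) (fun x _ => w0 x) cc0).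
  rewrite WtE//; last exact: Wsub.
  rewrite EFinD; apply: leeD.
    apply: le_trans (osc_ball WB) _; rewrite lee_fin ler_wpM2r// ler_wpM2l//.
    apply: ge0_ler_powR; rewrite ?nnegrE ?(ltW p0) ?(ltW rho0) ?(ltW (W_gt0 WB))//.
    exact: radius_le.
  by rewrite -EFinM lee_fin /cc -mulrA ler_wpM2l// mulr_suml.
have cov x : F x -> 1 <= \sum_(i <- s) \1_(Bl i) x :> R.
  move=> /Fs0[D /= Ds Dx]; rewrite (big_rem D)//= indicE mem_set//= lerDl.
  exact: sumr_ge0.
have := integral_cover mu mE mF mB FE (mosc (mean B0)) (fun x _ => osc0 _ x) cov.
move=> /le_trans; apply.
apply: (@le_trans _ _ (\sum_(B <- s) (2 `^ (p - 1) * (C1 * rho `^ p * Hh (Bl B) +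
      C3 * \sum_(D <- U | under B D) D.2 * (Hh (Bl D) / Wt (Bl D)) * Wt (Bl B)))%:E)%E).
  by rewrite big_seq [leRHS]big_seq; apply: lee_sum => B; exact: key.
rewrite sumEFin lee_fin -mulr_sumr /Boman_Poincare_const -mulrA ler_wpM2l ?powR_ge0//.
rewrite big_split /= -!mulr_sumr mulrDl; apply: lerD.
  by rewrite -[leRHS]mulrA ler_wpM2l ?sum_Hh// mulr_ge0 ?powR_ge0.
rewrite -mulrA ler_wpM2l//.
(* For fixed [D] the balls under it have total weight at most [M * K'] times [Wt (Bl D)], which
   cancels the denominator. *)
rewrite (exchange_big_dep predT)//=.
apply: (@le_trans _ _ (\sum_(D <- U) rho * (M * K') * Hh (Bl D))); last first.
  rewrite -mulr_sumr -[leRHS]mulrA; apply: ler_wpM2l; last exact: sum_Hh.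
  exact: mulr_ge0 (ltW rho0) (mulr_ge0 (ltW M0) K'0).
rewrite big_seq [leRHS]big_seq; apply: ler_sum => D DU; have WD := UW D DU.
rewrite -mulr_sumr.
have WtD := Wt_gt0 WD.
apply: (@le_trans _ _ (D.2 * (Hh (Bl D) / Wt (Bl D)) * (M * (K' * Wt (Bl D))))).
  by rewrite ler_wpM2l ?sum_Wt// mulr_ge0 ?divr_ge0// ltW// W_gt0.
have -> : D.2 * (Hh (Bl D) / Wt (Bl D)) * (M * (K' * Wt (Bl D))) =
    D.2 * (M * K') * Hh (Bl D) by field; rewrite gt_eqF.
by rewrite ler_wpM2r// ler_wpM2r ?radius_le// mulr_ge0// ltW.
Qed.

(** Monotone convergence along the compact exhaustion, the constant being the same on each part. *)
Lemma Boman_Poincare : bounded_set E ->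
  (\int[mu]_(x in E) (`|f x - ball_mean f B0.1 B0.2| `^ p * w x)%:E <=
   Boman_Poincare_const%:E * \int[mu]_(x in E) (h x `^ p * w x)%:E)%E.
Proof.
move=> bE; rewrite -/hw (HhE mE (@subset_refl _ E)) -EFinM.
have mI m : measurable (inner_part E m).
  by apply: closed_measurable_rV; exact: closed_inner_part.
have := @ge0_nondecreasing_set_cvg_integral _ T R (inner_part E)
  (fun x => (osc (mean B0) x)%:E) mu (@inner_part_nondecreasing _ _ E) mI.
rewrite -bigcup_inner_part// => H.
apply: (@cvge_le _ _ _ R _ _ _ _ (H _ _)).
- by apply: nearW => m; apply: compact_Poincare; [exact: mI|exact: compact_inner_part|exact: inner_part_sub].
- move=> m; apply/measurable_EFinP; apply: measurable_funS (mosc _); [exact: mE|exact: inner_part_sub].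
- by move=> m x _; rewrite lee_fin.
Qed.

End global_Poincare.

(** * Completeness of weighted Lebesgue spaces *)

Lemma geometric_steps_cvg (R : realType) (u : nat -> R) (C : R) : 0 <= C ->
  (forall k, `|u k.+1 - u k| <= C * 2 ^- k) -> cvgn u.
Proof.
move=> C0 uC.
have step k j : `|u (k + j)%N - u k| <= 2 * C * (2 ^- k - 2 ^- (k + j)).
  elim: j => [|j IH]; first by rewrite addn0 subrr normr0 subrr mulr0.
  rewrite addnS; apply: le_trans (ler_distD (u (k + j)%N) _ _) _.
  apply: le_trans (lerD (uC _) IH) _; rewrite le_eqVlt; apply/orP; left; apply/eqP.
  by rewrite exprS invfM; set a := 2 ^- (k + j); set b := 2 ^- k; field.
apply/cauchy_cvgP/cauchy_exP => _/posnumP[e].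
pose N := Num.truncn (2 * C / e%:num).
exists (u N); exists N => // n /= Nn.
rewrite -ball_normE /= distrC -(subnKC Nn).
apply: le_lt_trans (step N (n - N)%N) _.
apply: (@le_lt_trans _ _ (2 * C * 2 ^- N)).
  by rewrite ler_wpM2l ?mulr_ge0// gerBl invr_ge0 exprn_ge0.
rewrite ltr_pdivrMr ?exprn_gt0// [ltRHS]mulrC -ltr_pdivrMr//.
apply: lt_le_trans (truncnS_gt _) _; rewrite -/N -natrX ler_nat; exact: ltn_expl.
Qed.

Lemma powR_cvg_gt0 (R : realType) (a : nat -> R) (l q : R) : 0 < l ->
  a k @[k --> \oo] --> l -> a k `^ q @[k --> \oo] --> l `^ q.
Proof.
move=> l0 al.
have lcont : {for l, continuous ((@powR R)^~ q)}.
  apply/differentiable_continuous/derivable1_diffP.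
  by apply: derivable_powR; rewrite in_itv/= andbT.
exact: (cvg_comp _ _ al lcont).
Qed.

Lemma powR_cvg (R : realType) (a : nat -> R) (l q : R) : 0 < q ->
  (forall k, 0 <= a k) -> 0 <= l -> a k @[k --> \oo] --> l ->
  a k `^ q @[k --> \oo] --> l `^ q.
Proof.
move=> q0 a0; rewrite le_eqVlt => /orP[/eqP<- al|l0 al]; last exact: powR_cvg_gt0.
rewrite powR0 ?gt_eqF//; apply/cvgrPdist_lt => e e0.
have d0 : 0 < e `^ q^-1 by exact: powR_gt0.
move/cvgrPdist_lt : al => /(_ _ d0); apply: filterS => k.
rewrite !sub0r !normrN !ger0_norm ?powR_ge0// => h.
have -> : e = (e `^ q^-1) `^ q by rewrite -powRrM mulVf ?gt_eqF// powRr1 ?ltW.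
by apply: gt0_ltr_powR; rewrite ?nnegrE ?powR_ge0.
Qed.

(* Locked, since unification would otherwise unfold the integrals. *)
HB.lock Definition nrm d (T : measurableType d) (R : realType)
    (mu : {measure set T -> \bar R}) (D : set T) (p : R) (a : T -> R) : R :=
  fine (\int[mu]_(x in D) (a x `^ p)%:E) `^ p^-1.

Section Lp_seminorm.
Context d (T : measurableType d) (R : realType) (mu : {measure set T -> \bar R}).
Context (D : set T) (p : R).
Hypothesis mD : measurable D.
Hypothesis p1 : 1 < p.
Implicit Types a b c : T -> R.
Let p0 : 0 < p. Proof. exact: lt_trans p1. Qed.

(** Both norms of the problem are unweighted [L^p] norms of non-negative functions,
    [|u| * w ^ (1 / p)] and [|sqrt(Q) g|], so that one theory of such functions serves for both. *)
Record Lp_fun a : Prop := {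
  Lp_measurable : measurable_fun D a;
  Lp_nonneg : forall x, D x -> 0 <= a x;
  Lp_finite : (\int[mu]_(x in D) (a x `^ p)%:E < +oo)%E }.

Local Notation nrm := (nrm mu D p).

Lemma nrm_ge0 a : 0 <= nrm a. Proof. by rewrite unlock powR_ge0. Qed.

Let int_ge0 a : (0 <= \int[mu]_(x in D) (a x `^ p)%:E)%E.
Proof. by apply: integral_ge0 => x _; rewrite lee_fin powR_ge0. Qed.

Lemma nrm_pow a : Lp_fun a -> (\int[mu]_(x in D) (a x `^ p)%:E = (nrm a `^ p)%:E)%E.
Proof.
move=> La; rewrite unlock -powRrM mulVf ?gt_eqF// powRr1 ?fine_ge0//.
by rewrite fineK// ge0_fin_numE// Lp_finite.
Qed.

Lemma nrm_poweR a : Lp_fun a ->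
  ((\int[mu]_(x in D) (a x `^ p)%:E) `^ p^-1 = (nrm a)%:E)%E.
Proof.
move=> La; rewrite nrm_pow// poweR_EFin -powRrM mulfV ?gt_eqF// powRr1//.
exact: nrm_ge0.
Qed.

Lemma eq_nrm a b : (forall x, D x -> a x = b x) -> nrm a = nrm b.
Proof.
move=> ab; rewrite unlock (@eq_integral _ _ _ _ _ (fun x => (b x `^ p)%:E))//.
by move=> x /set_mem/ab ->.
Qed.

Lemma Lp_le a b : measurable_fun D a -> Lp_fun b ->
  (forall x, D x -> 0 <= a x <= b x) -> Lp_fun a.
Proof.
move=> ma Lb ab; split=> //; first by move=> x /ab/andP[].
apply: le_lt_trans (Lp_finite Lb); apply: (le_integral_nonneg mu mD).
- exact: measurable_powR_fun.
- exact: measurable_powR_fun (Lp_measurable Lb).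
- move=> x /ab/andP[ax abx]; rewrite powR_ge0/=.
  by apply: ge0_ler_powR; rewrite ?nnegrE ?(ltW p0)// (le_trans ax).
Qed.

Lemma le_nrm a b : measurable_fun D a -> Lp_fun b ->
  (forall x, D x -> 0 <= a x <= b x) -> nrm a <= nrm b.
Proof.
move=> ma Lb ab; have La := Lp_le ma Lb ab.
rewrite -lee_fin -(nrm_poweR La) -(nrm_poweR Lb); apply: gt0_ler_poweR.
- by rewrite invr_ge0 ltW.
- by rewrite in_itv/= leey int_ge0.
- by rewrite in_itv/= leey int_ge0.
- apply: (le_integral_nonneg mu mD).
  + exact: measurable_powR_fun.
  + exact: measurable_powR_fun (Lp_measurable Lb).
  + move=> x /ab/andP[ax abx]; rewrite powR_ge0/=.
    by apply: ge0_ler_powR; rewrite ?nnegrE ?(ltW p0)// (le_trans ax).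
Qed.

Lemma Lp_add a b : Lp_fun a -> Lp_fun b -> Lp_fun (fun x => a x + b x).
Proof.
move=> La Lb.
have [ma a0 _] := La; have [mb b0 _] := Lb.
split; first exact: measurable_funD.
  by move=> x Dx; rewrite addr_ge0 ?a0 ?b0.
have mpa : measurable_fun D (fun x => a x `^ p) by exact: measurable_powR_fun.
have mpb : measurable_fun D (fun x => b x `^ p) by exact: measurable_powR_fun.
apply: (@le_lt_trans _ _ (\int[mu]_(x in D) (2 `^ (p - 1) * (a x `^ p + b x `^ p))%:E)%E).
  apply: (le_integral_nonneg mu mD).
  - by apply: measurable_powR_fun; exact: measurable_funD.
  - by apply: measurable_funM; [exact: measurable_cst|exact: measurable_funD].
  - by move=> x Dx; rewrite powR_ge0/= powRD_le ?a0 ?b0.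
rewrite (integralZl_nonneg _ mD); last 3 first.
- exact: measurable_funD.
- by move=> x _; rewrite addr_ge0 ?powR_ge0.
- exact: powR_ge0.
rewrite (integralD_nonneg _ mD mpa mpb); last 2 first.
- by move=> x _; exact: powR_ge0.
- by move=> x _; exact: powR_ge0.
by rewrite (nrm_pow La) (nrm_pow Lb) -EFinD -EFinM ltry.
Qed.

Lemma nrm_triangle a b c : measurable_fun D c -> Lp_fun a -> Lp_fun b ->
  (forall x, D x -> 0 <= c x <= a x + b x) -> nrm c <= nrm a + nrm b.
Proof.
move=> mc La Lb cab; apply: le_trans (le_nrm mc (Lp_add La Lb) cab) _.
rewrite -lee_fin EFinD -(nrm_poweR La) -(nrm_poweR Lb) -(nrm_poweR (Lp_add La Lb)).
have [ma a0 _] := La; have [mb b0 _] := Lb.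
exact: minkowski_set (ltW p1).
Qed.

Lemma LpZ (k : R) a : 0 <= k -> Lp_fun a -> Lp_fun (fun x => k * a x).
Proof.
move=> k0 La; have [ma a0 _] := La; split.
- by apply: measurable_funM; [exact: measurable_cst|exact: ma].
- by move=> x Dx; rewrite mulr_ge0 ?a0.
have mpa : measurable_fun D (fun x => a x `^ p) by exact: measurable_powR_fun.
rewrite (eq_integral (fun x => (k `^ p * a x `^ p)%:E)); last first.
  by move=> x; rewrite inE => Dx; rewrite powRM ?a0.
rewrite (integralZl_nonneg _ mD mpa (fun x _ => powR_ge0 _ _) (powR_ge0 _ _)).
by rewrite (nrm_pow La) -EFinM ltry.
Qed.

Lemma nrmZ (k : R) a : 0 <= k -> Lp_fun a -> nrm (fun x => k * a x) = k * nrm a.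
Proof.
move=> k0 La; apply: EFin_inj; rewrite -(nrm_poweR (LpZ k0 La)).
have [ma a0 _] := La.
have mpa : measurable_fun D (fun x => a x `^ p) by exact: measurable_powR_fun.
rewrite (eq_integral (fun x => (k `^ p * a x `^ p)%:E)); last first.
  by move=> x; rewrite inE => Dx; rewrite powRM ?a0.
rewrite (integralZl_nonneg _ mD mpa (fun x _ => powR_ge0 _ _) (powR_ge0 _ _)).
rewrite (nrm_pow La) -EFinM poweR_EFin -powRM ?nrm_ge0//.
by rewrite -powRrM mulfV ?gt_eqF// powRr1// mulr_ge0// nrm_ge0.
Qed.

Lemma hoelder_nrm a b c : measurable_fun D c -> Lp_fun a -> Lp_fun b ->
  (forall x, D x -> 0 <= c x <= a x * b x `^ (p - 1)) ->
  (\int[mu]_(x in D) (c x)%:E <= (nrm a * nrm b `^ (p - 1))%:E)%E.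
Proof.
move=> mc La Lb cab; have [ma a0 _] := La; have [mb b0 _] := Lb.
pose q := p / (p - 1).
have pB0 : 0 < p - 1 by rewrite subr_gt0.
have q0 : 0 < q by rewrite divr_gt0.
have pq : p^-1 + q^-1 = 1 by rewrite /q; field; rewrite !gt_eqF.
have mb1 : measurable_fun D (fun x => b x `^ (p - 1)) by exact: measurable_powR_fun.
apply: (@le_trans _ _ (\int[mu]_(x in D) (a x * b x `^ (p - 1))%:E)%E).
  by apply: (le_integral_nonneg mu mD mc) => //; exact: measurable_funM.
apply: le_trans (hoelder_set mu mD ma mb1 a0 (fun x _ => powR_ge0 _ _) p0 q0 pq) _.
rewrite (nrm_poweR La) EFinM; apply: lee_wpmul2l; first by rewrite lee_fin nrm_ge0.
under eq_integral do rewrite -powRrM /q mulrCA divff ?gt_eqF// mulr1.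
rewrite (nrm_pow Lb) poweR_EFin -powRrM lee_fin.
have -> : p * q^-1 = p - 1 by rewrite /q; field; rewrite !gt_eqF.
by [].
Qed.

Lemma eq_Lp a b : (forall x, D x -> a x = b x) -> Lp_fun a -> Lp_fun b.
Proof.
move=> ab [ma a0 ai]; split.
- by apply: eq_measurable_fun ma => x /set_mem/ab.
- by move=> x Dx; rewrite -ab// a0.
- rewrite (eq_integral (fun x => (a x `^ p)%:E))// => x /set_mem/ab -> //.
Qed.

End Lp_seminorm.

(** * Riesz-Fischer theorem for rapidly Cauchy sequences *)

Section Lp_complete.
Context d (T : measurableType d) (R : realType) (mu : {measure set T -> \bar R}).
Context (D : set T) (p : R) (w : T -> R).
Hypothesis mD : measurable D.
Hypothesis p0 : 0 < p.
Hypothesis w0 : forall x, 0 <= w x.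
Hypothesis mw : measurable_fun D w.
Hypothesis w_gt0 : {ae mu, forall x, D x -> 0 < w x}.

Let dist_meas (u v : T -> R) : measurable_fun D u -> measurable_fun D v ->
  measurable_fun D (fun x => `|u x - v x| `^ p * w x).
Proof.
move=> mu_ mv; apply: measurable_funM => //; apply: measurable_powR_fun.
by apply: measurableT_comp; [exact: normr_measurable|exact: measurable_funB].
Qed.

(** Multiplied by [2 ^ (k * p)], the [p]-th powers of the increments still have summable integrals.
    Their sum is thus finite almost everywhere, and where also [w > 0] the increments are at most a
    constant times [2 ^ -k]. *)
Lemma weighted_Lp_complete (u : nat -> T -> R) :
  (forall k, measurable_fun D (u k)) ->
  (forall k j, (k <= j)%N ->
    (\int[mu]_(x in D) (`|u j x - u k x| `^ p * w x)%:E <= (2 ^- k * (2 ^- k) `^ p)%:E)%E) ->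
  exists2 v : T -> R, measurable_fun D v & forall k,
    (\int[mu]_(x in D) (`|u k x - v x| `^ p * w x)%:E <= (2 ^- k * (2 ^- k) `^ p)%:E)%E.
Proof.
move=> mu_ uC.
pose g k x := (2 ^+ k) `^ p * (`|u k.+1 x - u k x| `^ p * w x).
have g0 k x : 0 <= g k x by rewrite !mulr_ge0 ?powR_ge0.
have mg k : measurable_fun D (g k).
  by apply: measurable_funM; [exact: measurable_cst|exact: dist_meas].
have mgE k : measurable_fun D (EFin \o g k) by apply/measurable_EFinP.
have gE0 k x : D x -> (0 <= (g k x)%:E)%E by rewrite lee_fin.
have int_g k : (\int[mu]_(x in D) (g k x)%:E <= (2 ^- k)%:E)%E.
  rewrite (integralZl_nonneg _ mD); last 3 first.
  - exact: dist_meas.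
  - by move=> x _; rewrite mulr_ge0 ?powR_ge0.
  - exact: powR_ge0.
  apply: le_trans (lee_wpmul2l _ (uC k k.+1 (leqnSn k))) _; first by rewrite lee_fin powR_ge0.
  rewrite -EFinM lee_fin mulrCA -powRM ?invr_ge0 ?exprn_ge0//.
  by rewrite mulfV ?expf_neq0// powR1 mulr1.
pose G x := (\sum_(0 <= k <oo) (g k x)%:E)%E.
have mG : measurable_fun D G.
  exact: (@ge0_emeasurable_sum _ _ _ D (fun k x => (g k x)%:E) xpredT
    (fun k x Dx _ => gE0 k x Dx) (fun k _ => mgE k)).
have G0 x : (0 <= G x)%E by apply: nneseries_ge0 => k _ _; rewrite lee_fin.
have iG : mu.-integrable D G.
  apply/integrableP; split=> //.
  under eq_integral do rewrite gee0_abs ?G0//.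
  rewrite (integral_nneseries mu mD mgE gE0).
  apply: (@le_lt_trans _ _ (2 : R)%:E); last exact: ltry.
  apply: lime_le.
    by apply: is_cvg_nneseries => k _ _; apply: integral_ge0 => x _; rewrite lee_fin.
  apply: nearW => m; apply: (@le_trans _ _ (\sum_(0 <= k < m) (2 ^- k)%:E)%E).
    by apply: lee_sum => k _; exact: int_g.
  rewrite sumEFin lee_fin big_mkord.
  suff -> : \sum_(k < m) 2 ^- k = 2 - 2 * 2 ^- m :> R.
    by rewrite gerBl mulr_ge0// invr_ge0 exprn_ge0.
  elim: m => [|m IH]; first by rewrite big_ord0 expr0 invr1 mulr1 subrr.
  by rewrite big_ord_recr /= IH exprS invfM; set b := 2 ^- m; field.
have fin_ae := integrable_ae mD iG.
have cvg_ae : {ae mu, forall x, D x -> cvgn (u^~ x)}.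
  apply: filterS2 fin_ae w_gt0 => x Gx wx Dx.
  have {}Gx := Gx Dx; have {}wx := wx Dx.
  pose C := fine (G x); have C0 : 0 <= C by exact/fine_ge0.
  have gC k : g k x <= C.
    rewrite -lee_fin /C fineK//.
    have h i : (0 <= i)%N -> xpredT i -> (0 <= (g i x)%:E)%E by rewrite lee_fin.
    apply: le_trans (nneseries_lim_ge k.+1 h).
    by rewrite big_nat_recr//= leeDr// sume_ge0// => i _; rewrite lee_fin.
  apply: (@geometric_steps_cvg _ _ ((C / w x) `^ p^-1)); first exact: powR_ge0.
  move=> k; have := gC k; rewrite /g mulrA -ler_pdivlMr// -powRM ?exprn_ge0// => h.
  rewrite ler_pdivlMr ?exprn_gt0// mulrC.
  have := @ge0_ler_powR R p^-1 _ _ _ _ _ h.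
  rewrite invr_ge0 !nnegrE powR_ge0 divr_ge0 ?(ltW wx)// => /(_ (ltW p0) isT isT).
  by rewrite -powRrM mulfV ?gt_eqF// powRr1// mulr_ge0// exprn_ge0.
(* The upper limit is measurable on all of [D] and agrees with the limit wherever that exists. *)
pose v x := fine (limn_esup (fun k => (u k x)%:E)).
have mv : measurable_fun D v.
  apply: (measurableT_comp (fine_measurable measurableT)).
  by apply: measurable_fun_limn_esup => k; apply/measurable_EFinP.
have cvg_v : {ae mu, forall x, D x -> u k x @[k --> \oo] --> v x}.
  apply: filterS cvg_ae => x cx Dx; have {}cx := cx Dx.
  have cE : (u j x)%:E @[j --> \oo] --> (limn (u^~ x))%:E.
    by apply: cvg_EFin; [exact: nearW|exact: cx].
  by rewrite /v (cvg_limn_einf_sup cE).2; exact: cx.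
exists v => // k.
(* Almost everywhere the integrand is the limit over [j]; Fatou's lemma then carries the Cauchy
   bound over to [v]. *)
apply: (@le_trans _ _ (\int[mu]_(x in D) limn_einf (fun j => (`|u j x - u k x| `^ p * w x)%:E))%E).
  rewrite le_eqVlt; apply/orP; left; apply/eqP; apply: ae_eq_integral => //.
  - by apply/measurable_EFinP; exact: dist_meas.
  - rewrite /limn_einf; apply: (@measurableT_comp _ _ _ _ _ _ (-%E : \bar R -> \bar R)).
      exact: oppe_measurable.
    apply: measurable_fun_limn_esup => j.
    apply: (@measurableT_comp _ _ _ _ _ _ (-%E : \bar R -> \bar R)).
      exact: oppe_measurable.
    by apply/measurable_EFinP; exact: dist_meas.
  - apply: filterS cvg_v => x cx Dx; have {}cx := cx Dx.
    suff h : (`|u j x - u k x| `^ p * w x)%:E @[j --> \oo] --> (`|u k x - v x| `^ p * w x)%:E.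
      by rewrite (cvg_limn_einf_sup h).1.
    apply: cvg_EFin; first exact: nearW.
    apply: cvgMr_tmp; rewrite distrC; apply: powR_cvg => //.
    apply: cvg_norm; apply: cvgB => //; exact: cvg_cst.
apply: le_trans (fatou mu mD _ _) _.
- by move=> j; apply/measurable_EFinP; exact: dist_meas.
- by move=> j x _; rewrite lee_fin mulr_ge0 ?powR_ge0.
rewrite limn_einf_lim; apply: lime_le; first exact: is_cvg_einfs.
exists k => // j /= kj; apply: le_trans (ereal_inf_lbound _) (uC k j kj).
by exists j => //=.
Qed.

End Lp_complete.

(** * The variational problem *)

Lemma pairing_bound d (T : measurableType d) (R : realType)
    (mu : {measure set T -> \bar R}) (D : set T) (p : R) (a b c : T -> R) :
  measurable D -> 1 < p -> measurable_fun D c -> Lp_fun mu D p a -> Lp_fun mu D p b ->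
  (forall x, D x -> `|c x| <= a x * b x `^ (p - 1)) ->
  mu.-integrable D (EFin \o c) /\
  `|\int[mu]_(x in D) c x| <= nrm mu D p a * nrm mu D p b `^ (p - 1).
Proof.
move=> mD p1 mc La Lb cab.
have mcn : measurable_fun D (fun x => `|c x|).
  exact: (measurableT_comp (@normr_measurable _ setT) mc).
have bound : (\int[mu]_(x in D) (`|c x|)%:E <=
    (nrm mu D p a * nrm mu D p b `^ (p - 1))%:E)%E.
  by apply: (hoelder_nrm mD p1 mcn La Lb) => x Dx; rewrite normr_ge0 cab.
have ic : mu.-integrable D (EFin \o c).
  apply/integrableP; split; first exact/measurable_EFinP.
  exact: le_lt_trans bound (ltry _).
split=> //; rewrite -lee_fin; apply: le_trans bound.
rewrite EFin_normr_Rintegral//.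
apply: (le_abse_integral mu mD); exact/measurable_EFinP.
Qed.

Lemma sqr_powR (R : realType) (a p : R) : 0 <= a -> (a ^+ 2) `^ (p / 2) = a `^ p.
Proof. by move=> a0; rewrite -powR_mulrn// -powRrM mulrCA divff// mulr1. Qed.

Definition weighted_abs (T : Type) (R : realType) (p : R) (w u : T -> R) (x : T) : R :=
  `|u x| * w x `^ p^-1.

Definition form_norm (R : realType) (n : nat) (Q : 'rV[R]_n.+1 -> 'M[R]_n.+1)
    (g : 'rV[R]_n.+1 -> 'cV[R]_n.+1) (x : 'rV[R]_n.+1) : R :=
  enorm (sqrtmx (Q x) *m g x).

(** The interface to the variational part: the chain condition is represented by the Poincare
    inequality alone, with an unspecified constant [b] for each function. *)
Record degenerate_form (R : realType) (n : nat) (p lambda Lambda C : R)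
    (E : set 'rV[R]_n.+1) (Q : 'rV[R]_n.+1 -> 'M[R]_n.+1) (w : 'rV[R]_n.+1 -> R)
    : Prop := {
  df_gt1 : 1 < p;
  df_open : open E;
  df_bounded : bounded_set E;
  df_weight_ge0 : forall x, 0 <= w x;
  df_weight_measurable : measurable_fun E w;
  df_weight_gt0 : {ae (@lebesgue_rV R n), forall x, E x -> 0 < w x};
  df_weight_lty : (\int[@lebesgue_rV R n]_(x in E) (w x)%:E < +oo)%E;
  df_measurable : forall i j, measurable_fun E (fun x => Q x i j);
  df_psd : forall x, E x -> psdmx (Q x);
  df_lower : 0 < lambda;
  df_upper : 0 < Lambda;
  df_elliptic : {ae (@lebesgue_rV R n), forall x, E x -> forall xi : 'cV[R]_n.+1,
    lambda * w x `^ (2 / p) * enorm xi ^+ 2 <= quadform (Q x) xi /\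
    quadform (Q x) xi <= Lambda * w x `^ (2 / p) * enorm xi ^+ 2};
  df_const : 0 <= C;
  df_Poincare : forall f, C1_closure E f -> exists b : R,
    (\int[@lebesgue_rV R n]_(x in E) (`|f x - b| `^ p * w x)%:E <=
     C%:E * \int[@lebesgue_rV R n]_(x in E) (enorm (grad f x) `^ p * w x)%:E)%E }.

(** * Comparison of the norm given by the matrix with the weighted norm *)

Section degenerate_form.
Context (R : realType) (n : nat) (p lambda Lambda C : R).
Local Notation T := 'rV[R]_n.+1.
Local Notation mu := (@lebesgue_rV R n).
Context (E : set T) (Q : T -> 'M[R]_n.+1) (w : T -> R).
Hypothesis H : degenerate_form p lambda Lambda C E Q w.
Local Notation LpE := (Lp_fun mu E p).
Local Notation nrmE := (nrm mu E p).
Local Notation aw := (weighted_abs p w).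
Local Notation aQ := (form_norm Q).
Implicit Types (u v f : T -> R) (g h : T -> 'cV[R]_n.+1).
Definition measurable_field g := forall i, measurable_fun E (fun x => g x i 0).

Let p1 : 1 < p := df_gt1 H.
Let p0 : 0 < p. Proof. exact: lt_trans p1. Qed.
Let w0 x : 0 <= w x := df_weight_ge0 H x.
Let mw : measurable_fun E w := df_weight_measurable H.
Let mE : measurable E. Proof. exact: open_measurable_rV (df_open H). Qed.

Lemma weighted_abs_ge0 u x : 0 <= aw u x.
Proof. by rewrite mulr_ge0 ?powR_ge0. Qed.

Lemma weighted_absX u x : aw u x `^ p = `|u x| `^ p * w x.
Proof.
by rewrite powRM ?powR_ge0// -powRrM mulVf ?gt_eqF// powRr1.
Qed.

Lemma measurable_weighted_abs u : measurable_fun E u -> measurable_fun E (aw u).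
Proof.
move=> mu_; apply: measurable_funM; last exact: measurable_powR_fun mw.
exact: (measurableT_comp (@normr_measurable _ setT) mu_).
Qed.

Lemma form_norm_ge0 g x : 0 <= aQ g x.
Proof. exact: enorm_ge0. Qed.

Lemma measurable_form g h : measurable_field g -> measurable_field h ->
  measurable_fun E (fun x => ((g x)^T *m Q x *m h x) 0 0).
Proof.
move=> mg mh; under eq_fun do rewrite mxE.
apply: measurable_sum => i; apply: measurable_funM; last exact: mh.
under eq_fun do rewrite mxE.
apply: measurable_sum => j; apply: measurable_funM; last exact: df_measurable H _ _.
by under eq_fun do rewrite mxE; exact: mg.
Qed.

(** The square root matrix is obtained by choice, so its entries are avoided: on [E] the norm is the
    root of a polynomial expression in the entries of [Q] and [g]. The absolute value makes the
    radicand non-negative off [E] as well. *)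
Lemma measurable_form_norm g : measurable_field g -> measurable_fun E (aQ g).
Proof.
move=> mg.
apply: (@eq_measurable_fun _ _ _ _ E (fun x => Num.sqrt `|((g x)^T *m Q x *m g x) 0 0|)).
  move=> x /set_mem Ex; have psd := df_psd H Ex.
  rewrite -/(quadform (Q x) (g x)) -(sqr_enorm_sqrtmx _ psd).
  by rewrite ger0_norm ?sqr_ge0// sqrtr_sqr ger0_norm// enorm_ge0.
apply: measurable_sqrt_fun; first by move=> x; exact: normr_ge0.
exact: (measurableT_comp (@normr_measurable _ setT) (measurable_form mg mg)).
Qed.

Lemma form_dot g h x : E x ->
  ((g x)^T *m Q x *m h x) 0 0 = dot (sqrtmx (Q x) *m g x) (sqrtmx (Q x) *m h x).
Proof.
move=> /(df_psd H)/sqrtmxP[[symS _] SS].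
rewrite -{1}SS -mulmxA -(mulmxA (sqrtmx _)) mulmxA -{1}symS -trmx_mul mxE /dot.
by apply: eq_bigr => i _; rewrite big_ord1 !mxE.
Qed.

Lemma Lp_weighted_abs u : Lp p w E u -> LpE (aw u).
Proof.
move=> [mu_ /lty_poweRy]; rewrite invr_eq0 gt_eqF// => /(_ isT) iu; split.
- exact: measurable_weighted_abs.
- by move=> x _; exact: weighted_abs_ge0.
- by under eq_integral do rewrite weighted_absX.
Qed.

Lemma Lp_norm_weighted_abs u : LpE (aw u) -> Lp_norm p w E u = (nrmE (aw u))%:E.
Proof.
move=> Lu; rewrite -(nrm_poweR p1 Lu); congr poweR.
by apply: eq_integral => x _; rewrite weighted_absX.
Qed.

Lemma weighted_abs_Lp u : measurable_fun E u -> LpE (aw u) -> Lp p w E u.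
Proof. by move=> mu_ Lu; split=> //; rewrite (Lp_norm_weighted_abs Lu) ltry. Qed.

Lemma LQ_form_norm g : LQ p Q E g -> LpE (aQ g).
Proof.
move=> [mg /lty_poweRy]; rewrite invr_eq0 gt_eqF// => /(_ isT) ig; split=> //.
- exact: measurable_form_norm.
- by move=> x _; exact: form_norm_ge0.
Qed.

Lemma LQ_norm_form_norm g : LpE (aQ g) -> LQ_norm p Q E g = (nrmE (aQ g))%:E.
Proof. by move=> Lg; rewrite -(nrm_poweR p1 Lg). Qed.

Lemma form_norm_LQ g : measurable_field g -> LpE (aQ g) -> LQ p Q E g.
Proof. by move=> mg Lg; split=> //; rewrite (LQ_norm_form_norm Lg) ltry. Qed.

Lemma nrm_weighted_triangle u a b : measurable_fun E u -> LpE (aw a) -> LpE (aw b) ->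
  (forall x, E x -> u x = a x + b x) ->
  LpE (aw u) /\ nrmE (aw u) <= nrmE (aw a) + nrmE (aw b).
Proof.
move=> mu_ La Lb uab.
have le x : E x -> 0 <= aw u x <= aw a x + aw b x.
  move=> Ex; rewrite weighted_abs_ge0 /weighted_abs uab// -mulrDl.
  by rewrite ler_wpM2r ?powR_ge0// ler_normD.
have mau := measurable_weighted_abs mu_; split.
  exact: (Lp_le mE p1 mau (Lp_add mE p1 La Lb) le).
exact: (nrm_triangle mE p1 mau La Lb le).
Qed.

Lemma nrm_form_triangle g a b : measurable_field g -> LpE (aQ a) -> LpE (aQ b) ->
  (forall x, E x -> g x = a x + b x) ->
  LpE (aQ g) /\ nrmE (aQ g) <= nrmE (aQ a) + nrmE (aQ b).
Proof.
move=> mg La Lb gab.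
have le x : E x -> 0 <= aQ g x <= aQ a x + aQ b x.
  move=> Ex; rewrite form_norm_ge0 /form_norm gab// mulmxDr.
  exact: enormD.
have mag := measurable_form_norm mg; split.
  exact: (Lp_le mE p1 mag (Lp_add mE p1 La Lb) le).
exact: (nrm_triangle mE p1 mag La Lb le).
Qed.

Let powR_bound (c xi : R) (x : T) : 0 <= c -> 0 <= xi ->
  (c * w x `^ (2 / p) * xi ^+ 2) `^ (p / 2) = c `^ (p / 2) * (xi `^ p * w x).
Proof.
move=> c0 xi0; have wp0 : 0 <= w x `^ (2 / p) by exact: powR_ge0.
rewrite powRM ?sqr_ge0 ?(mulr_ge0 c0 wp0)// (powRM _ c0 wp0) (sqr_powR _ xi0).
rewrite -powRrM (_ : 2 / p * (p / 2) = 1) ?powRr1//; last by field; rewrite gt_eqF.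
by rewrite -mulrA (mulrC (w x)).
Qed.

(** Ellipticity raised to the power [p / 2], which turns [w ^ (2 / p) * |g| ^ 2] into
    [|g| ^ p * w]. *)
Lemma integral_form_bounds g : measurable_field g ->
  (\int[mu]_(x in E) (aQ g x `^ p)%:E <=
   (Lambda `^ (p / 2))%:E * \int[mu]_(x in E) (enorm (g x) `^ p * w x)%:E)%E /\
  (\int[mu]_(x in E) (enorm (g x) `^ p * w x)%:E <=
   (lambda `^ (- (p / 2)))%:E * \int[mu]_(x in E) (aQ g x `^ p)%:E)%E.
Proof.
move=> mg.
have mQ : measurable_fun E (fun x => aQ g x `^ p).
  by apply: measurable_powR_fun; exact: measurable_form_norm.
have me : measurable_fun E (fun x => enorm (g x) `^ p * w x).
  exact: (measurable_funM (measurable_powR_fun _ (measurable_enorm mg)) mw).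
have e0 x : E x -> 0 <= enorm (g x) `^ p * w x by rewrite mulr_ge0 ?powR_ge0.
have Q0 x : E x -> 0 <= aQ g x `^ p by rewrite powR_ge0.
rewrite -(integralZl_nonneg mu mE me e0 (powR_ge0 _ _)).
rewrite -(integralZl_nonneg mu mE mQ Q0 (powR_ge0 _ _)).
have pw2 (a b : R) : 0 <= a -> a <= b -> a `^ (p / 2) <= b `^ (p / 2).
  move=> a0 ab; apply: ge0_ler_powR; rewrite ?nnegrE ?divr_ge0 ?(ltW p0)//.
  exact: le_trans ab.
have [l0 L0] := (df_lower H, df_upper H).
have bnd := df_elliptic H.
have aQE x : E x -> quadform (Q x) (g x) `^ (p / 2) = aQ g x `^ p.
  by move=> Ex; rewrite -sqr_enorm_sqrtmx; [rewrite sqr_powR// enorm_ge0|exact: df_psd H _ Ex].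
split; apply: (ae_ge0_le_integral mE).
- by move=> x _; rewrite lee_fin powR_ge0.
- exact/measurable_EFinP.
- by move=> x Ex; rewrite lee_fin mulr_ge0 ?powR_ge0// e0.
- apply/measurable_EFinP; exact: (measurable_funM (measurable_cst _) me).
- apply: filterS bnd => x xb Ex; rewrite lee_fin -aQE//.
  have [_ /(pw2 _ _ ((df_psd H Ex).2 _))] := xb Ex (g x).
  by rewrite powR_bound// ?(ltW L0) ?enorm_ge0.
- by move=> x Ex; rewrite lee_fin e0.
- exact/measurable_EFinP.
- by move=> x Ex; rewrite lee_fin mulr_ge0 ?powR_ge0.
- apply/measurable_EFinP; exact: (measurable_funM (measurable_cst _) mQ).
- apply: filterS bnd => x xb Ex; rewrite lee_fin -aQE//.
  have lo0 : 0 <= lambda * w x `^ (2 / p) * enorm (g x) ^+ 2.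
    by rewrite !mulr_ge0 ?powR_ge0 ?(ltW l0) ?enorm_ge0.
  have [/(pw2 _ _ lo0)] := xb Ex (g x).
  rewrite powR_bound// ?(ltW l0) ?enorm_ge0// => hb _.
  by rewrite powRN [leRHS]mulrC ler_pdivlMr ?powR_gt0// mulrC.
Qed.

Lemma C1_Lp f : C1_closure E f -> LpE (aw f) /\ LpE (aQ (grad f)).
Proof.
move=> C1f.
have [M M0 fM] := C1_bounded (df_bounded H) C1f.
have [G G0 gG] := C1_grad_bounded (df_bounded H) C1f.
have mf := C1_measurable (df_open H) C1f.
have mg : measurable_field (grad f) := C1_measurable_pderiv (df_open H) C1f.
have bounded (k : T -> R) N : measurable_fun E k -> (forall x, E x -> 0 <= k x <= N) ->
    (\int[mu]_(x in E) (k x `^ p * w x)%:E < +oo)%E.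
  move=> mk kN; apply: (@le_lt_trans _ _ (\int[mu]_(x in E) (N `^ p * w x)%:E)%E).
    apply: (le_integral_nonneg mu mE).
    - exact: (measurable_funM (measurable_powR_fun _ mk) mw).
    - exact: (measurable_funM (measurable_cst _) mw).
    - move=> x /kN/andP[k0 kxN]; rewrite mulr_ge0 ?powR_ge0//= ler_wpM2r//.
      by apply: ge0_ler_powR; rewrite ?nnegrE ?(ltW p0)// (le_trans k0).
  rewrite (integralZl_nonneg mu mE mw (fun x _ => w0 x) (powR_ge0 _ _)).
  by apply: lte_mul_pinfty (df_weight_lty H); rewrite ?lee_fin ?powR_ge0.
split; split.
- exact: measurable_weighted_abs.
- by move=> x _; exact: weighted_abs_ge0.
- under eq_integral do rewrite weighted_absX.
  apply: (bounded (fun x => `|f x|) M) => [|x Ex]; last by rewrite normr_ge0 fM.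
  exact: (measurableT_comp (@normr_measurable _ setT) mf).
- exact: measurable_form_norm.
- by move=> x _; exact: form_norm_ge0.
- apply: le_lt_trans (integral_form_bounds mg).1 _.
  apply: lte_mul_pinfty; rewrite ?lee_fin ?powR_ge0//.
  apply: (bounded (fun x => enorm (grad f x)) G) => [|x Ex].
    exact: measurable_enorm.
  by rewrite enorm_ge0 gG.
Qed.

End degenerate_form.

Lemma C1_comb (R : realType) (n : nat) (E : set 'rV[R]_n.+1)
    (f g : 'rV[R]_n.+1 -> R) (a b : R) :
  C1_closure E f -> C1_closure E g ->
  C1_closure E (fun x => a * f x + b * g x) /\
  forall x, E x -> grad (fun x => a * f x + b * g x) x = a *: grad f x + b *: grad g x.
Proof.
move=> [cf df [F cF fF]] [cg dg [G cG gG]].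
have gradE x : E x ->
    grad (fun x => a * f x + b * g x) x = a *: grad f x + b *: grad g x.
  move=> Ex; apply/colP => i; rewrite !mxE.
  have hf : derivable (f : _ -> R^o) x (delta_mx 0 i) by exact/diff_derivable/df.
  have hg : derivable (g : _ -> R^o) x (delta_mx 0 i) by exact/diff_derivable/dg.
  have hfa : derivable (a *: (f : _ -> R^o)) x (delta_mx 0 i) by exact: derivableZ.
  have hgb : derivable (b *: (g : _ -> R^o)) x (delta_mx 0 i) by exact: derivableZ.
  rewrite [LHS](deriveD hfa hgb).
  by rewrite (deriveZ _ hf) (deriveZ _ hg).
split=> //; split.
- move=> x; apply: (@cvgD R R^o).
    by apply: cvgMl_tmp; exact: cf.
  by apply: cvgMl_tmp; exact: cg.
- move=> x Ex; apply: (@differentiableD R _ R^o (a *: (f : _ -> R^o)) (b *: (g : _ -> R^o))).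
    exact: differentiableZ (df x Ex).
  exact: differentiableZ (dg x Ex).
- exists (fun x => a *: F x + b *: G x) => [x|x Ex]; last by rewrite gradE// fF// gG.
  by apply: cvgD; apply: cvgZl_tmp; [exact: cF|exact: cG].
Qed.

Lemma C1_cst (R : realType) (n : nat) (E : set 'rV[R]_n.+1) (c : R) :
  C1_closure E (fun=> c) /\ forall x : 'rV[R]_n.+1, grad (fun=> c) x = 0.
Proof.
have gradE (x : 'rV[R]_n.+1) : grad (fun=> c) x = 0.
  by apply/colP => i; rewrite !mxE derive_cst.
split=> //; split.
- by move=> x; exact: cvg_cst.
- by move=> x _; exact: differentiable_cst.
- by exists (fun=> 0) => [x|x _]; [exact: cvg_cst|exact: gradE].
Qed.

(** * The source functional and the Poincare inequality for mean zero *)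

Section variational.
Context (R : realType) (n : nat) (p lambda Lambda C : R).
Local Notation T := 'rV[R]_n.+1.
Local Notation mu := (@lebesgue_rV R n).
Context (E : set T) (Q : T -> 'M[R]_n.+1) (w : T -> R).
Hypothesis H : degenerate_form p lambda Lambda C E Q w.
Local Notation LpE := (Lp_fun mu E p).
Local Notation nrmE := (nrm mu E p).
Local Notation aw := (weighted_abs p w).
Local Notation aQ := (form_norm Q).
Local Notation mfield := (measurable_field E).
Implicit Types (u v f phi psi : T -> R) (g h : T -> 'cV[R]_n.+1).

Let p1 : 1 < p := df_gt1 H.
Let p0 : 0 < p. Proof. exact: lt_trans p1. Qed.
Let pB0 : 0 < p - 1. Proof. by rewrite subr_gt0. Qed.
Let w0 x : 0 <= w x := df_weight_ge0 H x.
Let mw : measurable_fun E w := df_weight_measurable H.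
Let mE : measurable E. Proof. exact: open_measurable_rV (df_open H). Qed.

Lemma nrm_weightedZ (c : R) u : LpE (aw u) ->
  LpE (aw (fun x => c * u x)) /\ nrmE (aw (fun x => c * u x)) = `|c| * nrmE (aw u).
Proof.
move=> Lu.
have eqc x : E x -> `|c| * aw u x = aw (fun x => c * u x) x.
  by move=> _; rewrite /weighted_abs normrM mulrA.
split; first exact: (eq_Lp eqc (LpZ mE p1 (normr_ge0 c) Lu)).
by rewrite -(eq_nrm mu p eqc) (nrmZ mE p1 (normr_ge0 c) Lu).
Qed.

Lemma nrm_formZ (c : R) g : LpE (aQ g) ->
  LpE (aQ (fun x => c *: g x)) /\ nrmE (aQ (fun x => c *: g x)) = `|c| * nrmE (aQ g).
Proof.
move=> Lg.
have eqc x : E x -> `|c| * aQ g x = aQ (fun x => c *: g x) x.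
  by move=> _; rewrite /form_norm -scalemxAr enormZ.
split; first exact: (eq_Lp eqc (LpZ mE p1 (normr_ge0 c) Lg)).
by rewrite -(eq_nrm mu p eqc) (nrmZ mE p1 (normr_ge0 c) Lg).
Qed.

(** With [f = 1] this is the weighted integral of [phi], so the mean-zero condition shares the
    linearity and continuity results of the right-hand side. *)
Definition source f phi : R :=
  \int[mu]_(x in E) (`|f x| `^ (p - 2) * f x * phi x * w x).

(** Hoelder after distributing the weight as [w = w ^ (1 / p) * w ^ ((p - 1) / p)]. *)
Lemma source_bound f phi : Lp p w E f -> measurable_fun E phi -> LpE (aw phi) ->
  mu.-integrable E (EFin \o (fun x => `|f x| `^ (p - 2) * f x * phi x * w x)) /\
  `|source f phi| <= nrmE (aw phi) * nrmE (aw f) `^ (p - 1).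
Proof.
move=> Lf mphi Lphi; have [mf _] := Lf.
have mnf : measurable_fun E (fun x => `|f x|).
  exact: (measurableT_comp (@normr_measurable _ setT) mf).
apply: (pairing_bound mE p1 _ Lphi (Lp_weighted_abs H Lf)).
  exact: (measurable_funM (measurable_funM (measurable_funM
    (measurable_powR_fun _ mnf) mf) mphi) mw).
move=> x Ex; rewrite !normrM (ger0_norm (w0 x)) (ger0_norm (powR_ge0 _ _)).
have -> : `|f x| `^ (p - 2) * `|f x| = `|f x| `^ (p - 1).
  by rewrite -(powR_mul_self (normr_ge0 (f x)) pB0); congr (_ `^ _ * _); ring.
have -> : aw f x `^ (p - 1) = `|f x| `^ (p - 1) * w x `^ ((p - 1) / p).
  by rewrite /weighted_abs powRM ?powR_ge0// -powRrM [p^-1 * _]mulrC.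
have {1}-> : w x = w x `^ p^-1 * w x `^ ((p - 1) / p).
  rewrite -powRD; last by rewrite (_ : _ + _ = 1) ?oner_eq0//; field; rewrite gt_eqF.
  by rewrite (_ : _ + _ = 1) ?powRr1//; field; rewrite gt_eqF.
rewrite /weighted_abs le_eqVlt; apply/orP; left; apply/eqP.
have alg (a b c d : R) : a * b * (c * d) = b * c * (a * d) by ring.
exact: alg.
Qed.

Lemma source_comb f phi psi (a b : R) : Lp p w E f ->
  measurable_fun E phi -> LpE (aw phi) -> measurable_fun E psi -> LpE (aw psi) ->
  source f (fun x => a * phi x + b * psi x) = a * source f phi + b * source f psi.
Proof.
move=> Lf mphi Lphi mpsi Lpsi.
have [iphi _] := source_bound Lf mphi Lphi.
have [ipsi _] := source_bound Lf mpsi Lpsi.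
rewrite /source -!RintegralZl// -RintegralD//; last 2 first.
- exact: (integrableZl mE a iphi).
- exact: (integrableZl mE b ipsi).
apply: eq_Rintegral => x _.
have alg (c d e : R) : c * (a * d + b * e) * w x = a * (c * d * w x) + b * (c * e * w x).
  by ring.
exact: alg.
Qed.

Lemma source_cvg f (phi_ : nat -> T -> R) u : Lp p w E f ->
  (forall k, measurable_fun E (phi_ k)) -> (forall k, LpE (aw (phi_ k))) ->
  measurable_fun E u -> LpE (aw u) ->
  nrmE (aw (phi_ k \- u)) @[k --> \oo] --> 0 ->
  source f (phi_ k) @[k --> \oo] --> source f u.
Proof.
move=> Lf mphi Lphi mu_ Lu cvg0.
have bnd k : `|source f u - source f (phi_ k)| <=
    nrmE (aw (phi_ k \- u)) * nrmE (aw f) `^ (p - 1).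
  have mB : measurable_fun E (phi_ k \- u) by exact: measurable_funB.
  have LB : LpE (aw (phi_ k \- u)).
    apply: (nrm_weighted_triangle H mB (Lphi k) (nrm_weightedZ (-1) Lu).1 _).1.
    by move=> x _; rewrite mulN1r.
  have [_] := source_bound Lf mB LB; rewrite distrC; congr (`|_| <= _).
  rewrite [LHS](_ : _ = source f (fun x => 1 * phi_ k x + -1 * u x)); last first.
    by apply: eq_Rintegral => x _; rewrite mul1r mulN1r.
  by rewrite (source_comb _ _ Lf (mphi k) (Lphi k) mu_ Lu) mul1r mulN1r.
apply/cvgrPdist_le => e e0.
have cvgF : nrmE (aw (phi_ k \- u)) * nrmE (aw f) `^ (p - 1) @[k --> \oo] --> (0 : R).
  by rewrite -(mul0r (nrmE (aw f) `^ (p - 1))); apply: cvgMr_tmp.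
move/cvgrPdist_le : cvgF => /(_ e e0); apply: filterS => k.
rewrite sub0r normrN ger0_norm ?mulr_ge0 ?powR_ge0 ?nrm_ge0//.
exact: le_trans (bnd k).
Qed.

Lemma cst_Lp (c : R) : Lp p w E (fun=> c).
Proof.
apply: (weighted_abs_Lp H); first exact: measurable_cst.
exact: (C1_Lp H (C1_cst E c).1).1.
Qed.

Lemma source1 phi : source (fun=> 1) phi = \int[mu]_(x in E) (phi x * w x).
Proof. by apply: eq_Rintegral => x _; rewrite normr1 powR1 mul1r mul1r. Qed.

Let L1 := Lp_weighted_abs H (cst_Lp 1).
Let W1 := nrmE (aw (fun=> 1)).

Lemma source11 : source (fun=> 1) (fun=> 1) = W1 `^ p.
Proof.
apply: EFin_inj; rewrite -(nrm_pow p1 L1) source1 /Rintegral.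
have -> : (\int[mu]_(x in E) (1 * w x)%:E = \int[mu]_(x in E) (aw (fun=> 1) x `^ p)%:E)%E.
  by apply: eq_integral => x _; rewrite (weighted_absX H) normr1 powR1.
by rewrite (nrm_pow p1 L1).
Qed.

Definition admissible phi := C1_closure E phi /\ source (fun=> 1) phi = 0.

Definition Poincare_bound : R := 2 * (C * lambda `^ (- (p / 2))) `^ p^-1.

(** Since the weighted integral of [phi] vanishes, that of [phi - b] is [- b * W1 ^ p]. Hoelder then
    bounds the norm of the constant [b] by the norm of [phi - b], and the triangle inequality gives
    the factor 2. *)
Lemma zero_mean_Poincare phi : admissible phi ->
  nrmE (aw phi) <= Poincare_bound * nrmE (aQ (grad phi)).
Proof.
move=> [C1phi mean0].
have mphi := C1_measurable (df_open H) C1phi.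
have [Lphi LQ] := C1_Lp H C1phi.
have [b Pb] := df_Poincare H C1phi.
pose psi x := phi x - b.
have mpsi : measurable_fun E psi by apply: measurable_funB => //; exact: measurable_cst.
have Lc c := Lp_weighted_abs H (cst_Lp c).
have Lpsi : LpE (aw psi).
  by apply: (nrm_weighted_triangle H mpsi Lphi (Lc (- b)) _).1.
have le_psi : nrmE (aw psi) <= (C * lambda `^ (- (p / 2))) `^ p^-1 * nrmE (aQ (grad phi)).
  have := integral_form_bounds H (C1_measurable_pderiv (df_open H) C1phi : mfield (grad phi)).
  have C0 : (0 <= C%:E)%E by rewrite lee_fin (df_const H).
  move=> [_ le_lower]; have := le_trans Pb (lee_wpmul2l C0 le_lower).
  rewrite (nrm_pow p1 LQ) (@eq_integral _ _ _ mu E (fun x => (aw psi x `^ p)%:E)); last first.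
    by move=> x _; rewrite (weighted_absX H).
  rewrite (nrm_pow p1 Lpsi) -!EFinM lee_fin mulrA => le_pow.
  have := @ge0_ler_powR R p^-1 _ _ _ _ _ le_pow.
  rewrite invr_ge0 !nnegrE !mulr_ge0 ?powR_ge0 ?(df_const H)// => /(_ (ltW p0) isT isT).
  have cl0 : 0 <= C * lambda `^ (- (p / 2)) by rewrite mulr_ge0 ?powR_ge0 ?(df_const H).
  rewrite (powRM _ cl0 (powR_ge0 (nrmE (aQ (grad phi))) p)).
  by rewrite -!(powRrM _ p) mulfV ?gt_eqF// !powRr1 ?nrm_ge0.
have W0 : 0 <= W1 by exact: nrm_ge0.
have le_b : `|b| * W1 <= nrmE (aw psi).
  have [_] := source_bound (cst_Lp 1) mpsi Lpsi.
  rewrite (_ : source _ psi = source (fun=> 1) (fun x => 1 * phi x + (- b) * 1)); last first.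
    by apply: eq_Rintegral => x _; congr (_ * _ * _); rewrite mul1r mulr1.
  rewrite (source_comb _ _ (cst_Lp 1) mphi Lphi
    (measurable_cst _ : measurable_fun E (fun=> 1 : R)) L1) mean0 source11.
  rewrite mulr0 add0r mulNr normrN normrM (ger0_norm (powR_ge0 _ _)) -/W1.
  move: W0; rewrite le_eqVlt => /predU1P[<- _|Wgt0]; first by rewrite mulr0 nrm_ge0.
  have -> : W1 `^ p = W1 * W1 `^ (p - 1).
    rewrite -{2}(powRr1 (ltW Wgt0)) -powRD ?(gt_eqF Wgt0) ?implybT//.
    by rewrite addrC subrK.
  rewrite mulrA.
  by rewrite ler_pM2r// powR_gt0.
have le_sum : nrmE (aw phi) <= nrmE (aw psi) + `|b| * W1.
  rewrite -(nrm_weightedZ b L1).2.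
  apply: (nrm_weighted_triangle H mphi Lpsi (nrm_weightedZ b L1).1 _).2.
  by move=> x _; rewrite mulr1 subrK.
apply: le_trans le_sum _; apply: le_trans (lerD (lexx _) le_b) _.
by rewrite /Poincare_bound -mulrA -mulr2n mulr_natl lerMn2r.
Qed.

End variational.

Lemma colB (R : realType) (n : nat) (A B : 'cV[R]_n) i : (A - B) i 0 = A i 0 - B i 0.
Proof. by rewrite !mxE. Qed.

(** * Coercivity and convexity of the energy *)

Section minimization.
Context (R : realType) (n : nat) (p lambda Lambda C : R).
Local Notation T := 'rV[R]_n.+1.
Local Notation mu := (@lebesgue_rV R n).
Context (E : set T) (Q : T -> 'M[R]_n.+1) (w : T -> R).
Hypothesis H : degenerate_form p lambda Lambda C E Q w.
Local Notation LpE := (Lp_fun mu E p).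
Local Notation nrmE := (nrm mu E p).
Local Notation aw := (weighted_abs p w).
Local Notation aQ := (form_norm Q).
Local Notation mfield := (measurable_field E).
Local Notation admissible := (admissible p E w).
Local Notation source := (source p E w).
Local Notation CP := (Poincare_bound p lambda C).
Implicit Types (u v phi psi : T -> R) (g h : T -> 'cV[R]_n.+1).

Let p1 : 1 < p := df_gt1 H.
Let p0 : 0 < p. Proof. exact: lt_trans p1. Qed.
Let pB0 : 0 < p - 1. Proof. by rewrite subr_gt0. Qed.
Let w0 x : 0 <= w x := df_weight_ge0 H x.
Let mw : measurable_fun E w := df_weight_measurable H.
Let mE : measurable E. Proof. exact: open_measurable_rV (df_open H). Qed.
Let CP0 : 0 <= CP. Proof. by rewrite mulr_ge0 ?powR_ge0. Qed.

Lemma admissible_C1 phi : admissible phi -> [/\ C1_closure E phi,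
  measurable_fun E phi, mfield (grad phi), LpE (aw phi) & LpE (aQ (grad phi))].
Proof.
move=> [C1phi _]; have [La LQ] := C1_Lp H C1phi; split; [exact: C1phi| | |exact: La|exact: LQ].
  exact: C1_measurable (df_open H) C1phi.
exact: C1_measurable_pderiv (df_open H) C1phi.
Qed.

Lemma admissible_comb phi psi (a b : R) : admissible phi -> admissible psi ->
  admissible (fun x => a * phi x + b * psi x).
Proof.
move=> Aphi Apsi; have [C1phi mphi _ Lphi _] := admissible_C1 Aphi.
have [C1psi mpsi _ Lpsi _] := admissible_C1 Apsi.
split; first exact: (C1_comb a b C1phi C1psi).1.
rewrite (source_comb H a b (cst_Lp H 1) mphi Lphi mpsi Lpsi).
by rewrite (proj2 Aphi) (proj2 Apsi) !mulr0 addr0.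
Qed.

Lemma admissible0 : admissible (fun=> 0).
Proof.
split; first exact: (C1_cst E 0).1.
rewrite source1; under eq_Rintegral do rewrite mul0r.
by rewrite (Rintegral_cst mu mE) mul0r.
Qed.

Lemma integral_weighted_pow phi : LpE (aw phi) ->
  (\int[mu]_(x in E) (`|phi x| `^ p * w x)%:E = (nrmE (aw phi) `^ p)%:E)%E.
Proof.
move=> Lphi; rewrite -(nrm_pow p1 Lphi).
by apply: eq_integral => x _; rewrite (weighted_absX H).
Qed.

(** The distance of the gradients in the form norm controls the functions, by the Poincare
    inequality, and each partial derivative in [L^p(w)], by the lower ellipticity bound;
    completeness is available for scalar functions. *)
Lemma form_distance phi psi : admissible phi -> admissible psi ->
  [/\ LpE (aQ (fun x => grad phi x - grad psi x)),
      LpE (aw (fun x => phi x - psi x)),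
      nrmE (aw (fun x => phi x - psi x)) <=
        CP * nrmE (aQ (fun x => grad phi x - grad psi x)) &
      forall i, (\int[mu]_(x in E) (`|grad phi x i 0 - grad psi x i 0| `^ p * w x)%:E <=
        (lambda `^ (- (p / 2)) * nrmE (aQ (fun x => grad phi x - grad psi x)) `^ p)%:E)%E].
Proof.
move=> Aphi Apsi; have [C1phi mphi mg _ _] := admissible_C1 Aphi.
have [C1psi mpsi mh _ _] := admissible_C1 Apsi.
have Adiff := admissible_comb 1 (-1) Aphi Apsi.
have gradE := (C1_comb 1 (-1) C1phi C1psi).2.
have [_ _ _ Ldiff LQdiff] := admissible_C1 Adiff.
have eqf x : E x -> aw (fun x => 1 * phi x + -1 * psi x) x = aw (fun x => phi x - psi x) x.
  by move=> _; rewrite /weighted_abs mul1r mulN1r.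
have eqg x : E x -> aQ (grad (fun x => 1 * phi x + -1 * psi x)) x =
    aQ (fun x => grad phi x - grad psi x) x.
  by move=> Ex; rewrite /form_norm gradE// scale1r scaleN1r.
have LQ := eq_Lp eqg LQdiff; have L := eq_Lp eqf Ldiff.
split=> //.
  rewrite -(eq_nrm mu p eqf) -(eq_nrm mu p eqg).
  exact: (zero_mean_Poincare H Adiff).
move=> i.
have mgh : mfield (fun x => grad phi x - grad psi x).
  move=> j; under eq_fun do rewrite colB.
  exact: (measurable_funB (mg j) (mh j)).
have := (integral_form_bounds H mgh).2; rewrite (nrm_pow p1 LQ) -EFinM.
apply: le_trans; apply: (le_integral_nonneg mu mE).
- have mB := measurableT_comp (@normr_measurable _ setT) (measurable_funB (mg i) (mh i)).
  exact: (measurable_funM (measurable_powR_fun p mB) mw).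
- exact: (measurable_funM (measurable_powR_fun _ (measurable_enorm mgh)) mw).
- move=> x _; rewrite mulr_ge0 ?powR_ge0//= ler_wpM2r//.
  have le_c : `|grad phi x i 0 - grad psi x i 0| <= enorm (grad phi x - grad psi x).
    by have := ler_coef_enorm (grad phi x - grad psi x) i 0; rewrite colB.
  by apply: ge0_ler_powR; rewrite ?nnegrE ?normr_ge0 ?enorm_ge0 ?(ltW p0).
Qed.

Context (f : T -> R).
Hypothesis Lf : Lp p w E f.

Definition energy phi : R := nrmE (aQ (grad phi)) `^ p / p + source f phi.

(** The source term is at least [- a * N], with [N] the norm of the gradient. At [a0] the function
    [x ^ p / p] has slope [a + 1], so its tangent there absorbs the source term and leaves one
    [N]. *)
Lemma energy_lower : exists c, forall phi, admissible phi ->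
  nrmE (aQ (grad phi)) + c <= energy phi.
Proof.
pose F := nrmE (aw f) `^ (p - 1); pose a := CP * F; pose a0 := (a + 1) `^ (p - 1)^-1.
have F0 : 0 <= F by exact: powR_ge0.
have aa0 : 0 <= a by rewrite mulr_ge0.
have a0E : a0 `^ (p - 1) = a + 1.
  by rewrite -powRrM mulVf ?gt_eqF// powRr1// addr_ge0.
exists (a0 `^ p / p - (a + 1) * a0) => phi Aphi.
have [C1phi mphi mg Lphi LQ] := admissible_C1 Aphi.
have := (source_bound H Lf mphi Lphi).2; rewrite ler_norml => /andP[lo _].
have := zero_mean_Poincare H Aphi; rewrite /energy; move: lo; rewrite -/F.
set N := nrmE (aQ _); set U := nrmE (aw phi); set s := source _ _ => lo UN.
have N0 : 0 <= N by exact: nrm_ge0.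
have := powR_tangent p1 (powR_ge0 (a + 1) (p - 1)^-1) N0.
rewrite -/a0 a0E => tan.
have {}tan : a0 `^ p / p + (a + 1) * (N - a0) <= N `^ p / p.
  have alg0 (x y z : R) : x / p + y * z = (x + p * y * z) / p by field; rewrite gt_eqF.
  by rewrite alg0 ler_pM2r// invr_gt0.
have UF : U * F <= a * N by rewrite /a mulrAC ler_wpM2r.
have alg (x y z t : R) : x + (a + 1) * (N - a0) <= y -> - z <= t -> z <= a * N ->
    N + (x - (a + 1) * a0) <= y + t by move=> *; lra.
exact: alg tan lo UF.
Qed.

(* The part of [energy] involving [f] is linear and drops out of the midpoint gap. *)
Lemma energy_convex (e : R) : 0 < e -> exists2 D : R, 0 <= D &
  forall phi psi, admissible phi -> admissible psi ->
    nrmE (aQ (fun x => grad phi x - grad psi x)) `^ p <=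
    e * (nrmE (aQ (grad phi)) `^ p + nrmE (aQ (grad psi)) `^ p) +
    D * ((energy phi + energy psi) / 2 - energy (fun x => 2^-1 * phi x + 2^-1 * psi x)).
Proof.
move=> e0; have [D D0 uc] := @uniform_convexity R n.+1 1 p e p1 e0.
(* The factor [p] undoes the division by [p] in [energy]. *)
exists (D * p) => [|phi psi Aphi Apsi]; first by rewrite mulr_ge0 ?(ltW p0).
have [C1phi mphi _ Lphi LQphi] := admissible_C1 Aphi.
have [C1psi mpsi _ Lpsi LQpsi] := admissible_C1 Apsi.
have Amid := admissible_comb 2^-1 2^-1 Aphi Apsi.
have gradE := (C1_comb 2^-1 2^-1 C1phi C1psi).2.
have [_ _ _ _ LQmid] := admissible_C1 Amid.
have [LQd _ _ _] := form_distance Aphi Apsi.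
set mid := (fun x => 2^-1 * phi x + _) in Amid gradE LQmid *.
have h1 (a : T -> R) : LpE a -> measurable_fun E (fun x => a x `^ p).
  by move=> La; exact: (measurable_powR_fun p (Lp_measurable La)).
have h0 (a : T -> R) x : E x -> 0 <= a x `^ p by move=> _; exact: powR_ge0.
have mD : measurable_fun E (fun x => D * aQ (grad mid) x `^ p).
  exact: (measurable_funM (measurable_cst _) (h1 _ LQmid)).
have D0' x : E x -> 0 <= D * aQ (grad mid) x `^ p by move=> _; rewrite mulr_ge0 ?powR_ge0.
have ms := measurable_funD (h1 _ LQphi) (h1 _ LQpsi).
have s0 x : E x -> 0 <= aQ (grad phi) x `^ p + aQ (grad psi) x `^ p.
  by move=> _; rewrite addr_ge0 ?powR_ge0.
have eD0 : 0 <= e + D / 2 by rewrite addr_ge0 ?(ltW e0) ?divr_ge0.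
have : (\int[mu]_(x in E) (aQ (fun x => grad phi x - grad psi x) x `^ p +
    D * aQ (grad mid) x `^ p)%:E <=
  \int[mu]_(x in E) ((e + D / 2) *
    (aQ (grad phi) x `^ p + aQ (grad psi) x `^ p))%:E)%E.
  apply: (le_integral_nonneg mu mE).
  - exact: (measurable_funD (h1 _ LQd) mD).
  - exact: (measurable_funM (measurable_cst _) ms).
  - move=> x Ex; apply/andP; split; first exact: addr_ge0 (powR_ge0 _ _) (D0' _ Ex).
    have hu := uc (sqrtmx (Q x) *m grad phi x) (sqrtmx (Q x) *m grad psi x).
    rewrite -mulmxBr /midpoint_gap in hu.
    move: hu; rewrite /form_norm (gradE _ Ex).
    have -> : 2^-1 *: (sqrtmx (Q x) *m grad phi x + sqrtmx (Q x) *m grad psi x) =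
        sqrtmx (Q x) *m (2^-1 *: grad phi x + 2^-1 *: grad psi x).
      by rewrite mulmxDr -!scalemxAr scalerDr.
    have alg (X A M : R) : X <= e * A + D * (A / 2 - M) -> X + D * M <= (e + D / 2) * A.
      by rewrite -subr_ge0 -[in X in _ -> X]subr_ge0; congr (0 <= _); ring.
    exact: alg.
have eqL := etrans (integralD_nonneg mu mE (h1 _ LQd) mD (@h0 _) D0')
  (congr2 +%E (nrm_pow p1 LQd) (etrans (integralZl_nonneg mu mE (h1 _ LQmid) (@h0 _) D0)
    (congr1 (fun z => D%:E * z)%E (nrm_pow p1 LQmid)))).
have eqR := etrans (integralZl_nonneg mu mE ms s0 eD0)
  (congr1 (fun z => (e + D / 2)%:E * z)%E
    (etrans (integralD_nonneg mu mE (h1 _ LQphi) (h1 _ LQpsi) (@h0 _) (@h0 _))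
      (congr2 +%E (nrm_pow p1 LQphi) (nrm_pow p1 LQpsi)))).
have le_of_eq (a b c d : \bar R) : a = c -> b = d -> (a <= b)%E -> (c <= d)%E.
  by move=> -> ->.
move=> /(le_of_eq _ _ _ _ eqL eqR); rewrite /= lee_fin /energy.
rewrite (source_comb H 2^-1 2^-1 Lf mphi Lphi mpsi Lpsi).
have alg (X A B M s t : R) : X + D * M <= (e + D / 2) * (A + B) ->
  X <= e * (A + B) + D * p * ((A / p + s + (B / p + t)) / 2 -
    (M / p + (2^-1 * s + 2^-1 * t))).
  move=> h; have -> : D * p * ((A / p + s + (B / p + t)) / 2 -
      (M / p + (2^-1 * s + 2^-1 * t))) = D / 2 * (A + B) - D * M.
    by field; rewrite gt_eqF.
  lra.
exact: alg.
Qed.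

(** Almost-minimizers have gradient norm at most [B] by coercivity, and their midpoint has energy at
    least [m], so the convexity gap is at most [e']. The constants make each of the two terms of the
    convexity estimate at most [eta / 2]. *)
Lemma energy_Cauchy (m eta : R) : (forall phi, admissible phi -> m <= energy phi) ->
  0 < eta -> exists2 e : R, 0 < e & forall phi psi, admissible phi -> admissible psi ->
    energy phi <= m + e -> energy psi <= m + e ->
    nrmE (aQ (fun x => grad phi x - grad psi x)) `^ p <= eta.
Proof.
move=> m_le eta0; have [c low] := energy_lower.
pose B := Num.max 0 (m + 1 - c).
have B0 : 0 <= B by rewrite le_max lexx.
have Bp0 : 0 <= B `^ p by exact: powR_ge0.
have e0 : 0 < eta / (4 * (B `^ p + 1)) by rewrite divr_gt0// mulr_gt0// ltr_wpDl.
have [D D0 cvx] := energy_convex e0.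
have e1 : 0 < Num.min 1 (eta / (2 * (D + 1))).
  by rewrite lt_min ltr01 divr_gt0// mulr_gt0// ltr_wpDl.
exists (Num.min 1 (eta / (2 * (D + 1)))) => // phi psi Aphi Apsi.
set e' := Num.min _ _ => Jphi Jpsi.
have e'1 : e' <= 1 by rewrite ge_min lexx.
have e'2 : e' <= eta / (2 * (D + 1)) by rewrite ge_min lexx orbT.
have N_le chi : admissible chi -> energy chi <= m + e' -> nrmE (aQ (grad chi)) `^ p <= B `^ p.
  move=> Achi Jchi; apply: ge0_ler_powR; rewrite ?nnegrE ?nrm_ge0 ?(ltW p0)//.
  rewrite le_max; apply/orP; right.
  by have := low _ Achi; lra.
apply: le_trans (cvx _ _ Aphi Apsi) _.
have Jmid := m_le _ (admissible_comb 2^-1 2^-1 Aphi Apsi).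
have xB := N_le _ Aphi Jphi; have yB := N_le _ Apsi Jpsi.
move: (nrmE (aQ (grad phi)) `^ p) (nrmE (aQ (grad psi)) `^ p) xB yB => x y xB yB.
move: (energy (fun t => 2^-1 * phi t + _)) (energy phi) (energy psi) Jphi Jpsi Jmid => M a b Jphi Jpsi Jmid.
have h1 : eta / (4 * (B `^ p + 1)) * (x + y) <= eta / 2.
  have -> : eta / 2 = eta / (4 * (B `^ p + 1)) * (2 * (B `^ p + 1)).
    by field; rewrite gt_eqF// ltr_wpDl.
  rewrite (ler_pM2l e0); have alg (z : R) : x <= z -> y <= z -> x + y <= 2 * (z + 1).
    by move=> *; lra.
  exact: alg.
have h2 : D * ((a + b) / 2 - M) <= eta / 2.
  have alg (r s t z : R) : r <= m + s -> t <= m + s -> m <= z -> (r + t) / 2 - z <= s.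
    by move=> *; lra.
  have h3 := alg _ _ _ _ Jphi Jpsi Jmid.
  have h4 := le_trans h3 e'2.
  have h5 := ler_wpM2l D0 h4.
  apply: le_trans h5 _.
  have D10 : 0 < D + 1 by rewrite ltr_wpDl.
  rewrite mulrA ler_pdivrMr ?mulr_gt0//.
  have -> : eta / 2 * (2 * (D + 1)) = D * eta + eta by field.
  by rewrite lerDl ltW.
apply: le_trans (lerD h1 h2) _; rewrite -splitr.
exact: lexx.
Qed.

End minimization.

Lemma geometric_cvg0 (R : realType) (a : nat -> R) (K : R) :
  (forall k, 0 <= a k <= K * 2 ^- k) -> a k @[k --> \oo] --> 0.
Proof.
move=> aK; apply: (@squeeze_cvgr _ _ _ _ (fun=> 0) (fun k => K * 2 ^- k)).
- by apply: nearW => k; exact: aK.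
- exact: cvg_cst.
- have -> : (fun k => K * 2 ^- k) = geometric K 2^-1.
    by apply/funext => k /=; rewrite exprVn.
  by apply: cvg_geometric; rewrite ger0_norm ?invr_ge0// invf_lt1// ltr1n.
Qed.

Lemma powR_enorm_le (R : realType) (n : nat) (p : R) (v : 'cV[R]_n) : 1 < p ->
  enorm v `^ p <= n%:R `^ (p - 1) * \sum_i `|v i 0| `^ p.
Proof.
move=> p1; have le_v : enorm v <= \sum_i 1 * `|v i 0|.
  apply: le_trans (enorm_le_sum v) _; apply: ler_sum => i _.
  by rewrite big_ord1 mul1r.
have := @jensen_sum R _ (index_enum 'I_n) xpredT (fun=> 1) (fun i => `|v i 0|) p p1
  (fun=> ler01) (fun=> normr_ge0 _).
rewrite sumr_const card_ord; under [X in _ <= _ * X]eq_bigr do rewrite mul1r.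
apply: le_trans; apply: ge0_ler_powR; rewrite ?nnegrE ?enorm_ge0 ?(ltW (lt_trans _ p1))//.
exact: le_trans (enorm_ge0 v) le_v.
Qed.

Record approximates (R : realType) (n : nat) (p : R) (E : set 'rV[R]_n.+1)
    (Q : 'rV[R]_n.+1 -> 'M[R]_n.+1) (w : 'rV[R]_n.+1 -> R)
    (phi_ : nat -> 'rV[R]_n.+1 -> R) (u : 'rV[R]_n.+1 -> R)
    (g : 'rV[R]_n.+1 -> 'cV[R]_n.+1) : Prop := {
  apx_C1 : forall k, C1_closure E (phi_ k);
  apx_measurable : measurable_fun E u;
  apx_field : measurable_field E g;
  apx_Lp : Lp_fun (@lebesgue_rV R n) E p (weighted_abs p w u);
  apx_LQ : Lp_fun (@lebesgue_rV R n) E p (form_norm Q g);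
  apx_cvg : nrm (@lebesgue_rV R n) E p (weighted_abs p w (phi_ k \- u))
    @[k --> \oo] --> 0;
  apx_grad_cvg : nrm (@lebesgue_rV R n) E p (form_norm Q (grad (phi_ k) \- g))
    @[k --> \oo] --> 0 }.

(** * Minimizing sequences and their limits *)

Section minimizer.
Context (R : realType) (n : nat) (p lambda Lambda C : R).
Local Notation T := 'rV[R]_n.+1.
Local Notation mu := (@lebesgue_rV R n).
Context (E : set T) (Q : T -> 'M[R]_n.+1) (w : T -> R).
Hypothesis H : degenerate_form p lambda Lambda C E Q w.
Local Notation LpE := (Lp_fun mu E p).
Local Notation nrmE := (nrm mu E p).
Local Notation aw := (weighted_abs p w).
Local Notation aQ := (form_norm Q).
Local Notation mfield := (measurable_field E).
Local Notation admissible := (admissible p E w).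
Local Notation CP := (Poincare_bound p lambda C).
Implicit Types (u v phi psi : T -> R) (g h : T -> 'cV[R]_n.+1).

Let p1 : 1 < p := df_gt1 H.
Let p0 : 0 < p. Proof. exact: lt_trans p1. Qed.
Let w0 x : 0 <= w x := df_weight_ge0 H x.
Let mw : measurable_fun E w := df_weight_measurable H.
Let mE : measurable E. Proof. exact: open_measurable_rV (df_open H). Qed.

Lemma nrm_le_pow (a : T -> R) (K t : R) : LpE a -> 0 <= K -> 0 <= t ->
  (\int[mu]_(x in E) (a x `^ p)%:E <= (K * t `^ p)%:E)%E -> nrmE a <= K `^ p^-1 * t.
Proof.
move=> La K0 t0; rewrite (nrm_pow p1 La) lee_fin => h.
have := @ge0_ler_powR R p^-1 _ _ _ _ _ h.
rewrite invr_ge0 !nnegrE mulr_ge0 ?powR_ge0// => /(_ (ltW p0) isT isT).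
rewrite (powRM _ K0 (powR_ge0 _ _)) -!(powRrM _ p) mulfV ?gt_eqF//.
by rewrite !powRr1 ?nrm_ge0.
Qed.

Context (f : T -> R).
Hypothesis Lf : Lp p w E f.
Local Notation energy := (energy p E Q w f).

Lemma infimum : exists m : R, (forall phi, admissible phi -> m <= energy phi) /\
  forall e : R, 0 < e -> exists2 phi, admissible phi & energy phi <= m + e.
Proof.
have [c low] := energy_lower H Lf.
pose A : set R := [set energy phi | phi in admissible].
have Alb : lbound A c.
  by move=> _ [phi Aphi <-]; apply: le_trans (low _ Aphi); rewrite lerDr nrm_ge0.
have A0 : A !=set0 by exists (energy (fun=> 0)), (fun=> 0) => //; exact: admissible0 H.
exists (inf A); split=> [phi Aphi|e e0].
  by apply: ge_inf; [exists c|exists phi].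
have [_ [phi Aphi <-] lt] := inf_adherent e0 (conj A0 (ex_intro _ c Alb)).
by exists phi => //; exact: ltW.
Qed.

(** The Cauchy rate required by [weighted_Lp_complete]. *)
Let delta k : R := 2 ^- k * (2 ^- k) `^ p.
Let delta_gt0 k : 0 < delta k.
Proof. by rewrite mulr_gt0 ?powR_gt0// invr_gt0 exprn_gt0. Qed.
Let delta_le k : delta k <= (2 ^- k) `^ p.
Proof.
rewrite -[leRHS]mul1r; apply: ler_wpM2r; first exact: powR_ge0.
by rewrite invf_le1 ?exprn_gt0// exprn_ege1// ler1n.
Qed.

Lemma minimizing_sequence : exists (m : R) (phi_ : nat -> T -> R),
  [/\ forall phi, admissible phi -> m <= energy phi,
      forall k, admissible (phi_ k) /\ energy (phi_ k) <= m + 2 ^- k,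
      forall k j, (k <= j)%N ->
        (\int[mu]_(x in E) (`|phi_ j x - phi_ k x| `^ p * w x)%:E <= (delta k)%:E)%E &
      forall i k j, (k <= j)%N ->
        (\int[mu]_(x in E) (`|grad (phi_ j) x i 0 - grad (phi_ k) x i 0| `^ p * w x)%:E
          <= (delta k)%:E)%E].
Proof.
have [m [m_le m_adh]] := infimum.
(* [K] dominates both constants by which the form norm controls the functions and their partial
   derivatives; the 1 makes it positive. *)
pose K := CP `^ p + lambda `^ (- (p / 2)) + 1.
have K0 : 0 < K by rewrite ltr_wpDl// addr_ge0 ?powR_ge0.
have eta0 k : 0 < delta k / K by rewrite divr_gt0.
have /choice[e eP] : forall k, exists e : R, 0 < e /\ forall phi psi,
    admissible phi -> admissible psi -> energy phi <= m + e -> energy psi <= m + e ->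
    nrmE (aQ (fun x => grad phi x - grad psi x)) `^ p <= delta k / K.
  by move=> k; have [e e0 eP] := energy_Cauchy H Lf m_le (eta0 k); exists e.
(* The minimum over all earlier tolerances ensures that each [phi_ j] with [j >= k] meets the
   tolerance [e k]. *)
pose e' k := \big[Num.min/2 ^- k]_(i < k.+1) e i.
have e'0 k : 0 < e' k.
  by apply: lt_bigmin => [|i _]; [rewrite invr_gt0 exprn_gt0|exact: (eP i).1].
have e'2 k : e' k <= 2 ^- k by exact: bigmin_le_id.
have e'e k j : (k <= j)%N -> e' j <= e k.
  by move=> kj; apply: (@bigmin_le _ _ _ _ (Ordinal (kj : (k < j.+1)%N))).
have /choice[phi_ phiP] : forall k, exists phi, admissible phi /\ energy phi <= m + e' k.
  by move=> k; have [phi Aphi Jphi] := m_adh _ (e'0 k); exists phi.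
have J_le k j : (k <= j)%N -> energy (phi_ j) <= m + e k.
  by move=> kj; apply: le_trans (phiP j).2 _; rewrite lerD2l e'e.
have dist k j : (k <= j)%N ->
    nrmE (aQ (fun x => grad (phi_ j) x - grad (phi_ k) x)) `^ p <= delta k / K.
  by move=> kj; apply: (eP k).2; [exact: (phiP j).1|exact: (phiP k).1|exact: J_le|exact: J_le].
have scale k (c z : R) : 0 <= c -> c <= K -> z <= delta k / K -> c * z <= delta k.
  move=> c0 cK zK; apply: le_trans (ler_wpM2l c0 zK) _.
  by rewrite mulrA ler_pdivrMr// mulrC ler_pM2l.
exists m, phi_; split=> // [k|k j kj|i k j kj].
- by split; [exact: (phiP k).1|apply: le_trans (phiP k).2 _; rewrite lerD2l].
- have [_ L le_d _] := form_distance H (phiP j).1 (phiP k).1.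
  rewrite (integral_weighted_pow H L) lee_fin.
  have CP0 : 0 <= CP by rewrite mulr_ge0 ?powR_ge0.
  have := @ge0_ler_powR R p _ _ _ _ _ le_d.
  rewrite !nnegrE mulr_ge0 ?nrm_ge0// => /(_ (ltW p0) isT isT) /le_trans; apply.
  rewrite (powRM _ CP0 (nrm_ge0 _ _ _ _)); apply: scale (dist _ _ kj); first exact: powR_ge0.
  by rewrite /K -addrA lerDl addr_ge0 ?powR_ge0.
- have [_ _ _ le_d] := form_distance H (phiP j).1 (phiP k).1.
  apply: le_trans (le_d i) _; rewrite lee_fin; apply: scale (dist _ _ kj).
    exact: powR_ge0.
  by rewrite /K addrAC lerDr addr_ge0 ?powR_ge0.
Qed.

(** The limit field is assembled from the limits of the partial derivatives in [L^p(w)]; the upper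
    ellipticity bound turns componentwise convergence into convergence in the form norm. Finiteness
    of the norms of [u] and [g] follows by subtracting from [phi_ 0]. *)
Lemma minimizer : exists (m : R) (phi_ : nat -> T -> R) u g,
  [/\ forall phi, admissible phi -> m <= energy phi,
      forall k, admissible (phi_ k) /\ energy (phi_ k) <= m + 2 ^- k &
      approximates p E Q w phi_ u g].
Proof.
have [m [phi_ [m_le phiP Cauchy Cauchy_grad]]] := minimizing_sequence.
have phiA k := admissible_C1 H (phiP k).1.
have mphi k : measurable_fun E (phi_ k) by have [] := phiA k.
have mgrad k : mfield (grad (phi_ k)) by have [] := phiA k.
have complete := weighted_Lp_complete mE p0 w0 mw (df_weight_gt0 H).
have [u mu_ uP] := complete phi_ mphi Cauchy.
have /choice[gi gP] : forall i, exists v : T -> R, measurable_fun E v /\ forall k,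
    (\int[mu]_(x in E) (`|grad (phi_ k) x i 0 - v x| `^ p * w x)%:E <= (delta k)%:E)%E.
  move=> i; have [v mv vP] := complete _ (fun k => mgrad k i) (Cauchy_grad i).
  by exists v.
pose g x : 'cV[R]_n.+1 := \col_i gi i x.
have mg : mfield g.
  by move=> i; under eq_fun do rewrite mxE; exact: (gP i).1.
have two0 k : 0 <= 2 ^- k :> R by rewrite invr_ge0 exprn_ge0.
have mB k : measurable_fun E (phi_ k \- u) by exact: measurable_funB.
have mgB k : mfield (grad (phi_ k) \- g).
  by move=> i; under eq_fun do rewrite colB; exact: (measurable_funB (mgrad k i) (mg i)).
have intB k : (\int[mu]_(x in E) (aw (phi_ k \- u) x `^ p)%:E <= (delta k)%:E)%E.
  by under eq_integral do rewrite (weighted_absX H); exact: uP.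
have LB k : LpE (aw (phi_ k \- u)).
  split; first exact: (measurable_weighted_abs H (mB k)).
    by move=> x _; exact: weighted_abs_ge0.
  exact: le_lt_trans (intB k) (ltry _).
pose N : R := n.+1%:R `^ (p - 1) * n.+1%:R.
have N0 : 0 <= N by rewrite mulr_ge0 ?powR_ge0.
have intgB k : (\int[mu]_(x in E) (aQ (grad (phi_ k) \- g) x `^ p)%:E <=
    (Lambda `^ (p / 2) * N * (2 ^- k) `^ p)%:E)%E.
  apply: le_trans (integral_form_bounds H (mgB k)).1 _.
  rewrite -mulrA EFinM; apply: lee_wpmul2l; first by rewrite lee_fin powR_ge0.
  have mi i : measurable_fun E (fun x => `|grad (phi_ k) x i 0 - gi i x| `^ p * w x).
    have mB_i := measurableT_comp (@normr_measurable _ setT)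
      (measurable_funB (mgrad k i) (gP i).1).
    exact: (measurable_funM (measurable_powR_fun p mB_i) mw).
  have i0 i x : E x -> 0 <= `|grad (phi_ k) x i 0 - gi i x| `^ p * w x.
    by move=> _; rewrite mulr_ge0 ?powR_ge0.
  pose c : R := n.+1%:R `^ (p - 1).
  have msum := measurable_sum (index_enum 'I_n.+1) mi.
  have sum0 x : E x -> 0 <= \sum_i `|grad (phi_ k) x i 0 - gi i x| `^ p * w x.
    by move=> Ex; apply: sumr_ge0 => i _; exact: i0.
  apply: (@le_trans _ _ (\int[mu]_(x in E)
      (c * \sum_i `|grad (phi_ k) x i 0 - gi i x| `^ p * w x)%:E)%E).
    apply: (le_integral_nonneg mu mE).
    - exact: (measurable_funM (measurable_powR_fun p (measurable_enorm (mgB k))) mw).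
    - exact: (measurable_funM (measurable_cst _) msum).
    - move=> x _; rewrite mulr_ge0 ?powR_ge0//= -mulr_suml mulrA ler_wpM2r//.
      apply: le_trans (powR_enorm_le _ p1) _; rewrite ler_wpM2l ?powR_ge0//.
      by apply: ler_sum => i _; rewrite colB [g x i 0]mxE.
  rewrite (integralZl_nonneg mu mE msum sum0 (powR_ge0 _ _)) /N -mulrA EFinM.
  apply: lee_wpmul2l; first by rewrite lee_fin powR_ge0.
  rewrite (integral_sum_nonneg mu _ mE mi i0).
  apply: (@le_trans _ _ (\sum_(i < n.+1) ((2 ^- k) `^ p)%:E)%E).
    by apply: lee_sum => i _; apply: le_trans ((gP i).2 k) _; rewrite lee_fin delta_le.
  by rewrite sumEFin sumr_const card_ord lee_fin mulr_natl.
have LgB k : LpE (aQ (grad (phi_ k) \- g)).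
  split; first exact: (measurable_form_norm H (mgB k)).
    by move=> x _; exact: form_norm_ge0.
  exact: le_lt_trans (intgB k) (ltry _).
exists m, phi_, u, g; split=> //.
have [_ _ _ Lphi0 LQphi0] := phiA 0%N.
split=> //.
- by move=> k; have [] := phiA k.
- have LB0 := (nrm_weightedZ H (-1) (LB 0%N)).1.
  apply: (nrm_weighted_triangle H mu_ Lphi0 LB0 _).1.
  by move=> x _; rewrite mulN1r /= opprB addrCA subrr addr0.
- have LB0 := (nrm_formZ H (-1) (LgB 0%N)).1.
  apply: (nrm_form_triangle H mg LQphi0 LB0 _).1.
  by move=> x _; rewrite scaleN1r /= opprB addrCA subrr addr0.
- apply: (@geometric_cvg0 _ _ (1 `^ p^-1)) => k; rewrite nrm_ge0/=.
  apply: (nrm_le_pow (LB k) ler01 (two0 k)); apply: le_trans (intB k) _.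
  by rewrite mul1r lee_fin delta_le.
- apply: (@geometric_cvg0 _ _ ((Lambda `^ (p / 2) * N) `^ p^-1)) => k; rewrite nrm_ge0/=.
  apply: (nrm_le_pow (LgB k) _ (two0 k) (intgB k)).
  by rewrite mulr_ge0 ?powR_ge0.
Qed.

End minimizer.

(** * The Euler-Lagrange equation *)

Section pointwise.
Context (R : realType) (n : nat) (p : R).
Hypothesis p1 : 1 < p.
Implicit Types A B X : 'cV[R]_n.
Let p0 : 0 < p. Proof. exact: lt_trans p1. Qed.
Let pB0 : 0 < p - 1. Proof. by rewrite subr_gt0. Qed.

Let pB2 (a : R) : 0 <= a -> a `^ (p - 2) * a = a `^ (p - 1).
Proof.
by move=> a0; rewrite -(powR_mul_self a0 pB0); congr (_ `^ _ * _); ring.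
Qed.

Lemma duality_map_bound A B :
  `|enorm A `^ (p - 2) * dot B A| <= enorm B * enorm A `^ (p - 1).
Proof.
rewrite normrM (ger0_norm (powR_ge0 _ _)) -(pB2 (enorm_ge0 A)) [leRHS]mulrCA.
by rewrite ler_wpM2l ?powR_ge0// ler_dot_enorm.
Qed.

(** Convexity of the [p]-th power of the norm with the tangent taken at the shifted point
    [A + t *: B]: the scalar tangent inequality combined with Cauchy-Schwarz. *)
Lemma enorm_powR_tangent A B (t : R) :
  enorm (A + t *: B) `^ p - enorm A `^ p <=
  p * (t * (enorm (A + t *: B) `^ (p - 2) * dot B (A + t *: B))).
Proof.
set X := A + t *: B.
have tan := powR_tangent p1 (enorm_ge0 X) (enorm_ge0 A).
have dotE : t * dot B X = enorm X ^+ 2 - dot A X.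
  rewrite sqr_enorm -dotZl (_ : t *: B = X - A); last by rewrite /X addrC addKr.
  by rewrite dotDl dotNl.
have dAX := le_trans (ler_norm _) (ler_dot_enorm A X).
have X2 : enorm X `^ (p - 2) * enorm X = enorm X `^ (p - 1) by rewrite pB2// enorm_ge0.
have key : enorm X `^ (p - 1) * (enorm X - enorm A) <= t * (enorm X `^ (p - 2) * dot B X).
  rewrite mulrCA dotE -X2 -mulrA ler_wpM2l ?powR_ge0//.
  by rewrite mulrBr -expr2 lerD2l lerN2 mulrC.
have := ler_wpM2l (ltW p0) key; set Y := _ * dot B X.
move: tan; set x := enorm X `^ p; set y := enorm A `^ p; set z := enorm X `^ (p - 1).
have alg (a b P : R) : x + P * z * (b - a) <= y -> P * (z * (a - b)) <= P * (t * Y) ->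
    x - y <= P * (t * Y).
  by move=> h1 h2; apply: le_trans h2; rewrite -subr_ge0 in h1; rewrite -subr_ge0;
    have -> : P * (z * (a - b)) - (x - y) = y - (x + P * z * (b - a)) by ring.
exact: alg.
Qed.

Lemma enorm_segment_cvg A B (t_ : nat -> R) : t_ k @[k --> \oo] --> 0 ->
  enorm (A + t_ k *: B) @[k --> \oo] --> enorm A.
Proof.
move=> t0; apply/cvgrPdist_le => e e0.
have tB : t_ k * enorm B @[k --> \oo] --> (0 : R).
  by rewrite -(mul0r (enorm B)); exact: cvgMr_tmp.
move/cvgrPdist_le : tB => /(_ e e0); apply: filterS => k.
rewrite sub0r normrN normrM (ger0_norm (enorm_ge0 B)) => h; apply: le_trans h.
rewrite -enormZ; apply: le_trans (ler_enorm_dist _ _) _.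
by rewrite opprD addrA subrr add0r enormN.
Qed.

(** At [A = 0] the factor with exponent [p - 2] may blow up, but the product is bounded by a
    multiple of the power [p - 1] of the norm, which tends to 0. *)
Lemma duality_map_cvg A B (t_ : nat -> R) : t_ k @[k --> \oo] --> 0 ->
  enorm (A + t_ k *: B) `^ (p - 2) * dot B (A + t_ k *: B) @[k --> \oo] -->
  enorm A `^ (p - 2) * dot B A.
Proof.
move=> t0; have Xcvg := @enorm_segment_cvg A B t_ t0.
have [A0|A0] := eqVneq (enorm A) 0; last first.
  have Agt0 : 0 < enorm A by rewrite lt_neqAle eq_sym A0 enorm_ge0.
  apply: cvgM; first exact: powR_cvg_gt0.
  have -> : (fun k => dot B (A + t_ k *: B)) = (fun k => dot B A + t_ k * dot B B).
    by apply/funext => k; rewrite dotDr dotZr.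
  rewrite -[X in _ --> X]addr0 -[X in _ --> _ + X](mul0r (dot B B)).
  by apply: cvgD; [exact: cvg_cst|exact: cvgMr_tmp].
have -> : enorm A `^ (p - 2) * dot B A = 0.
  by rewrite (enorm_eq0 A0) -(scale0r B) dotZr mul0r mulr0.
have Xp : enorm B * enorm (A + t_ k *: B) `^ (p - 1) @[k --> \oo] --> (0 : R).
  rewrite -(mulr0 (enorm B)) -[X in _ * X](powR0 (lt0r_neq0 pB0)); apply: cvgMl_tmp.
  by apply: powR_cvg => //; [move=> k; exact: enorm_ge0|rewrite -A0].
apply/cvgrPdist_le => e e0; move/cvgrPdist_le : Xp => /(_ e e0); apply: filterS => k.
rewrite !sub0r !normrN => h; apply: le_trans (duality_map_bound _ _) _.
exact: le_trans (ler_norm _) h.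
Qed.

End pointwise.

Definition flux (R : realType) (n : nat) (p : R) (Q : 'rV[R]_n.+1 -> 'M[R]_n.+1)
    (g h : 'rV[R]_n.+1 -> 'cV[R]_n.+1) (x : 'rV[R]_n.+1) : R :=
  enorm (sqrtmx (Q x) *m g x) `^ (p - 2) * ((h x)^T *m Q x *m g x) 0 0.

Definition pairing (R : realType) (n : nat) (p : R) (E : set 'rV[R]_n.+1)
    (Q : 'rV[R]_n.+1 -> 'M[R]_n.+1) (g h : 'rV[R]_n.+1 -> 'cV[R]_n.+1) : R :=
  \int[@lebesgue_rV R n]_(x in E) flux p Q g h x.

(** * The pairing of the weak equation *)

Section first_variation.
Context (R : realType) (n : nat) (p lambda Lambda C : R).
Local Notation T := 'rV[R]_n.+1.
Local Notation mu := (@lebesgue_rV R n).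
Context (E : set T) (Q : T -> 'M[R]_n.+1) (w : T -> R).
Hypothesis H : degenerate_form p lambda Lambda C E Q w.
Local Notation LpE := (Lp_fun mu E p).
Local Notation nrmE := (nrm mu E p).
Local Notation aw := (weighted_abs p w).
Local Notation aQ := (form_norm Q).
Local Notation mfield := (measurable_field E).
Local Notation admissible := (admissible p E w).
Local Notation source := (source p E w).
Implicit Types (u v phi psi : T -> R) (g h : T -> 'cV[R]_n.+1).

Let p1 : 1 < p := df_gt1 H.
Let p0 : 0 < p. Proof. exact: lt_trans p1. Qed.
Let pB0 : 0 < p - 1. Proof. by rewrite subr_gt0. Qed.
Let w0 x : 0 <= w x := df_weight_ge0 H x.
Let mE : measurable E. Proof. exact: open_measurable_rV (df_open H). Qed.

Local Notation flux := (flux p Q).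
Local Notation pairing := (pairing p E Q).

Lemma fluxE g h x : E x -> flux g h x =
  enorm (sqrtmx (Q x) *m g x) `^ (p - 2) *
    dot (sqrtmx (Q x) *m h x) (sqrtmx (Q x) *m g x).
Proof. by move=> Ex; rewrite /flux (form_dot H _ _ Ex). Qed.

Lemma measurable_flux g h : mfield g -> mfield h -> measurable_fun E (flux g h).
Proof.
move=> mg mh; have mf := measurable_form H mh mg.
exact: (measurable_funM (measurable_powR_fun _ (measurable_form_norm H mg)) mf).
Qed.

Lemma pairing_le g h : mfield g -> mfield h -> LpE (aQ g) -> LpE (aQ h) ->
  mu.-integrable E (EFin \o flux g h) /\
  `|pairing g h| <= nrmE (aQ h) * nrmE (aQ g) `^ (p - 1).
Proof.
move=> mg mh Lg Lh; apply: (pairing_bound mE p1 (measurable_flux mg mh) Lh Lg).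
by move=> x Ex; rewrite (fluxE _ _ Ex); exact: duality_map_bound.
Qed.

Lemma pairing_comb g h k (a b : R) : mfield g -> mfield h -> mfield k ->
  LpE (aQ g) -> LpE (aQ h) -> LpE (aQ k) ->
  pairing g (fun x => a *: h x + b *: k x) = a * pairing g h + b * pairing g k.
Proof.
move=> mg mh mk Lg Lh Lk.
have [ih _] := pairing_le mg mh Lg Lh; have [ik _] := pairing_le mg mk Lg Lk.
rewrite /pairing -(RintegralZl a mE ih) -(RintegralZl b mE ik).
rewrite -(RintegralD mE (integrableZl mE a ih) (integrableZl mE b ik)).
apply: eq_Rintegral => x /set_mem Ex; rewrite (fluxE _ _ Ex).
rewrite (fluxE _ _ Ex) (fluxE _ _ Ex) mulmxDr -!scalemxAr dotDl !dotZl.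
have alg (c d e : R) : c * (a * d + b * e) = a * (c * d) + b * (c * e) by ring.
exact: alg.
Qed.

Lemma eq_pairing g h k : (forall x, E x -> h x = k x) -> pairing g h = pairing g k.
Proof. by move=> hk; apply: eq_Rintegral => x /set_mem Ex; rewrite /flux hk. Qed.

Lemma mfield_comb h k (a b : R) : mfield h -> mfield k ->
  mfield (fun x => a *: h x + b *: k x).
Proof.
move=> mh mk i.
have -> : (fun x => (a *: h x + b *: k x) i 0) = (fun x => a * h x i 0 + b * k x i 0).
  by apply/funext => x; rewrite !mxE.
exact: (measurable_funD (measurable_funM (measurable_cst _) (mh i))
  (measurable_funM (measurable_cst _) (mk i))).
Qed.

Lemma Lp_form_comb h k (a b : R) : mfield h -> mfield k -> LpE (aQ h) -> LpE (aQ k) ->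
  LpE (aQ (fun x => a *: h x + b *: k x)).
Proof.
move=> mh mk Lh Lk.
exact: (nrm_form_triangle H (mfield_comb a b mh mk)
  (nrm_formZ H a Lh).1 (nrm_formZ H b Lk).1 _).1.
Qed.

Lemma nrm_form_dist g h : mfield g -> mfield h -> LpE (aQ g) -> LpE (aQ h) ->
  LpE (aQ (g \- h)) /\ `|nrmE (aQ g) - nrmE (aQ h)| <= nrmE (aQ (g \- h)).
Proof.
move=> mg mh Lg Lh.
have eqd x : E x -> aQ (fun x => 1 *: g x + -1 *: h x) x = aQ (g \- h) x.
  by move=> _; rewrite /form_norm scale1r scaleN1r.
have Ld := eq_Lp eqd (Lp_form_comb 1 (-1) mg mh Lg Lh); split=> //.
have [LNd Nd] := nrm_formZ H (-1) Ld.
have h1 : nrmE (aQ g) <= nrmE (aQ (g \- h)) + nrmE (aQ h).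
  by apply: (nrm_form_triangle H mg Ld Lh _).2 => x _; rewrite /= subrK.
have h2 : nrmE (aQ h) <= nrmE (aQ (g \- h)) + nrmE (aQ g).
  have -> : nrmE (aQ (g \- h)) = nrmE (aQ (fun x => -1 *: (g \- h) x)).
    by rewrite Nd normrN1 mul1r.
  apply: (nrm_form_triangle H mh LNd Lg _).2 => x _.
  by rewrite scaleN1r /= opprB subrK.
by rewrite ler_norml; apply/andP; split; lra.
Qed.

Lemma nrm_form_cvg (h_ : nat -> T -> 'cV[R]_n.+1) h :
  (forall k, mfield (h_ k)) -> mfield h -> (forall k, LpE (aQ (h_ k))) -> LpE (aQ h) ->
  nrmE (aQ (h_ k \- h)) @[k --> \oo] --> 0 ->
  nrmE (aQ (h_ k)) @[k --> \oo] --> nrmE (aQ h).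
Proof.
move=> mh_ mh Lh_ Lh h0; apply/cvgrPdist_le => e e0.
move/cvgrPdist_le : h0 => /(_ e e0); apply: filterS => k.
rewrite sub0r normrN distrC => hk.
apply: le_trans (nrm_form_dist (mh_ k) mh (Lh_ k) Lh).2 _.
exact: le_trans (ler_norm _) hk.
Qed.

Lemma pairing_cvg g (h_ : nat -> T -> 'cV[R]_n.+1) h : mfield g -> LpE (aQ g) ->
  (forall k, mfield (h_ k)) -> mfield h -> (forall k, LpE (aQ (h_ k))) -> LpE (aQ h) ->
  nrmE (aQ (h_ k \- h)) @[k --> \oo] --> 0 ->
  pairing g (h_ k) @[k --> \oo] --> pairing g h.
Proof.
move=> mg Lg mh_ mh Lh_ Lh h0; apply/cvgrPdist_le => e e0.
have {}h0 : nrmE (aQ (h_ k \- h)) * nrmE (aQ g) `^ (p - 1) @[k --> \oo] --> (0 : R).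
  by rewrite -(mul0r (nrmE (aQ g) `^ (p - 1))); exact: cvgMr_tmp.
move/cvgrPdist_le : h0 => /(_ e e0); apply: filterS => k.
rewrite sub0r normrN ger0_norm ?mulr_ge0 ?powR_ge0 ?nrm_ge0//; apply: le_trans.
have [Ld _] := nrm_form_dist (mh_ k) mh (Lh_ k) Lh.
have md : mfield (h_ k \- h).
  move=> i; have := mfield_comb 1 (-1) (mh_ k) mh i.
  by under eq_fun do rewrite scale1r scaleN1r.
have [_] := pairing_le mg md Lg Ld; rewrite distrC; congr (`|_| <= _).
rewrite (@eq_pairing _ (h_ k \- h) (fun x => 1 *: h_ k x + -1 *: h x)).
  by rewrite pairing_comb// mul1r mulN1r.
by move=> x _; rewrite scale1r scaleN1r.
Qed.

End first_variation.

Section Euler_Lagrange.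
Context (R : realType) (n : nat) (p lambda Lambda C : R).
Local Notation T := 'rV[R]_n.+1.
Local Notation mu := (@lebesgue_rV R n).
Context (E : set T) (Q : T -> 'M[R]_n.+1) (w : T -> R).
Hypothesis H : degenerate_form p lambda Lambda C E Q w.
Local Notation LpE := (Lp_fun mu E p).
Local Notation nrmE := (nrm mu E p).
Local Notation aw := (weighted_abs p w).
Local Notation aQ := (form_norm Q).
Local Notation mfield := (measurable_field E).
Local Notation admissible := (admissible p E w).
Local Notation source := (source p E w).
Local Notation flux := (flux p Q).
Local Notation pairing := (pairing p E Q).
Implicit Types (u v phi psi : T -> R) (g h : T -> 'cV[R]_n.+1).

Let p1 : 1 < p := df_gt1 H.
Let p0 : 0 < p. Proof. exact: lt_trans p1. Qed.
Let mE : measurable E. Proof. exact: open_measurable_rV (df_open H). Qed.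

Lemma Lp_shift g h (t : R) : mfield g -> mfield h -> LpE (aQ g) -> LpE (aQ h) ->
  mfield (fun x => g x + t *: h x) /\ LpE (aQ (fun x => g x + t *: h x)).
Proof.
move=> mg mh Lg Lh.
have := mfield_comb 1 t mg mh; have := Lp_form_comb H 1 t mg mh Lg Lh.
have -> : (fun x => 1 *: g x + t *: h x) = (fun x => g x + t *: h x).
  by apply/funext => x; rewrite scale1r.
by [].
Qed.

Lemma pairing_tangent g h (t : R) : mfield g -> mfield h -> LpE (aQ g) -> LpE (aQ h) ->
  nrmE (aQ (fun x => g x + t *: h x)) `^ p - nrmE (aQ g) `^ p <=
  p * (t * pairing (fun x => g x + t *: h x) h).
Proof.
move=> mg mh Lg Lh; have [mX LX] := Lp_shift t mg mh Lg Lh.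
set X := (fun x => _) in mX LX *.
have [iX _] := pairing_le H mX mh LX Lh.
have ip (a : T -> R) : LpE a ->
    mu.-integrable E (EFin \o (fun x => a x `^ p)) /\
    \int[mu]_(x in E) (a x `^ p) = nrmE a `^ p.
  move=> La; have La' := nrm_pow p1 La; split; last by rewrite /Rintegral La'.
  apply/integrableP; split.
    by apply/measurable_EFinP; exact: (measurable_powR_fun p (Lp_measurable La)).
  rewrite (@eq_integral _ _ _ _ _ (fun x => (a x `^ p)%:E)).
    by rewrite La' ltry.
  by move=> x _; rewrite /= ger0_norm ?powR_ge0.
have [ig <-] := ip _ Lg; have [iXp <-] := ip _ LX.
have [iXt iXtp] : mu.-integrable E (EFin \o (fun x => t * flux X h x)) /\
    mu.-integrable E (EFin \o (fun x => p * (t * flux X h x))).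
  by have it := integrableZl mE t iX; split; [exact: it|exact: (integrableZl mE p it)].
rewrite -(RintegralB mE iXp ig) -(RintegralZl t mE iX) -(RintegralZl p mE iXt).
apply: (le_Rintegral mE (integrableB mE iXp ig) iXtp) => x Ex.
rewrite (fluxE H _ _ Ex) /form_norm /X mulmxDr -scalemxAr.
exact: enorm_powR_tangent.
Qed.

(** Dominated convergence: for parameters in [[0, 1]] the integrands are bounded by the [p]-th power
    of the sum of the two form norms. *)
Lemma pairing_shift_cvg g h (t_ : nat -> R) : mfield g -> mfield h ->
  LpE (aQ g) -> LpE (aQ h) -> (forall k, 0 <= t_ k <= 1) -> t_ k @[k --> \oo] --> 0 ->
  pairing (fun x => g x + t_ k *: h x) h @[k --> \oo] --> pairing g h.
Proof.
move=> mg mh Lg Lh t01 t0.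
have Lsum := Lp_add mE p1 Lg Lh.
have dom k x : E x ->
    `|flux (fun x => g x + t_ k *: h x) h x| <= (aQ g x + aQ h x) `^ p.
  move=> Ex; rewrite (fluxE H _ _ Ex); apply: le_trans (duality_map_bound p1 _ _) _.
  have [A0 B0] := (form_norm_ge0 Q g x, form_norm_ge0 Q h x).
  have S0 : 0 <= aQ g x + aQ h x by exact: addr_ge0.
  have /andP[tk0 tk1] := t01 k.
  have leX : enorm (sqrtmx (Q x) *m (g x + t_ k *: h x)) <= aQ g x + aQ h x.
    rewrite mulmxDr -scalemxAr; apply: le_trans (enormD _ _) _; rewrite lerD2l enormZ.
    by rewrite ger0_norm// ler_piMl.
  rewrite -(powR_mul_self S0 p0) [leRHS]mulrC; apply: ler_pM => //.
  - exact: powR_ge0.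
  - by rewrite lerDr.
  - apply: ge0_ler_powR; rewrite ?nnegrE ?enorm_ge0//.
    by rewrite subr_ge0 ltW.
have mflux k : measurable_fun E (EFin \o flux (fun x => g x + t_ k *: h x) h).
  apply/measurable_EFinP.
  exact: (measurable_flux H (Lp_shift (t_ k) mg mh Lg Lh).1 mh).
have mflux0 : measurable_fun E (EFin \o flux g h).
  by apply/measurable_EFinP; exact: (measurable_flux H mg mh).
have cvg_flux : {ae mu, forall x, E x ->
    (flux (fun x => g x + t_ k *: h x) h x)%:E @[k --> \oo] --> (flux g h x)%:E}.
  apply: aeW => x Ex; apply: cvg_EFin; first exact: nearW.
  have eqf : (fun k => flux (fun x => g x + t_ k *: h x) h x) = (fun k =>
     enorm (sqrtmx (Q x) *m g x + t_ k *: (sqrtmx (Q x) *m h x)) `^ (p - 2) *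
     dot (sqrtmx (Q x) *m h x) (sqrtmx (Q x) *m g x + t_ k *: (sqrtmx (Q x) *m h x))).
    by apply/funext => k; rewrite (fluxE H _ _ Ex) mulmxDr -scalemxAr.
  have := @duality_map_cvg _ _ _ p1 (sqrtmx (Q x) *m g x) (sqrtmx (Q x) *m h x) _ t0.
  by rewrite -eqf -(fluxE H _ _ Ex).
have isum : mu.-integrable E (EFin \o (fun x => (aQ g x + aQ h x) `^ p)).
  apply/integrableP; split.
    by apply/measurable_EFinP; exact: (measurable_powR_fun p (Lp_measurable Lsum)).
  rewrite (@eq_integral _ _ _ _ _ (fun x => ((aQ g x + aQ h x) `^ p)%:E)).
    by rewrite (nrm_pow p1 Lsum) ltry.
  by move=> x _; rewrite /= ger0_norm ?powR_ge0.
have [_ _ lim] := dominated_convergence mE mflux mflux0 cvg_flux isum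
  (aeW _ (fun x k Ex => dom k x Ex)).
have [i0 _] := pairing_le H mg mh Lg Lh.
apply: fine_cvg; rewrite /pairing /Rintegral fineK; last exact: (integrable_fin_num mE i0).
exact: lim.
Qed.

Context (f : T -> R).
Hypothesis Lf : Lp p w E f.
Local Notation energy := (energy p E Q w f).

Section at_minimizer.
Context (m : R) (phi_ : nat -> T -> R) (u : T -> R) (g : T -> 'cV[R]_n.+1).
Hypothesis m_le : forall phi, admissible phi -> m <= energy phi.
Hypothesis phi_min : forall k, admissible (phi_ k) /\ energy (phi_ k) <= m + 2 ^- k.
Hypothesis apx : approximates p E Q w phi_ u g.

(** The minimality of [m] is used for [phi_ k + t psi]. Subtracting the bound for [phi_ k] cancels
    the source of [phi_ k], and the remaining norms converge. *)
Lemma minimizer_growth psi (t : R) : admissible psi ->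
  nrmE (aQ g) `^ p <=
  nrmE (aQ (fun x => g x + t *: grad psi x)) `^ p + p * (t * source f psi).
Proof.
move=> Apsi; have [C1psi mpsi mgpsi Lpsi LQpsi] := admissible_C1 H Apsi.
have [C1phi mu_ mg Lu Lg cvg_u cvg_g] := apx.
have phiA k := admissible_C1 H (phi_min k).1.
have mgrad k : mfield (grad (phi_ k)) by have [] := phiA k.
have LQphi k : LpE (aQ (grad (phi_ k))) by have [] := phiA k.
have N_cvg := nrm_form_cvg H mgrad mg LQphi Lg cvg_g.
have [mX LX] := Lp_shift t mg mgpsi Lg LQpsi.
pose X k x := grad (phi_ k) x + t *: grad psi x.
have shift k := Lp_shift t (mgrad k) mgpsi (LQphi k) LQpsi.
have Nt_cvg : nrmE (aQ (X k)) @[k --> \oo] --> nrmE (aQ (fun x => g x + t *: grad psi x)).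
  apply: (nrm_form_cvg H (fun k => (shift k).1) mX (fun k => (shift k).2) LX).
  have -> : (fun k => nrmE (aQ (X k \- (fun x => g x + t *: grad psi x)))) =
            (fun k => nrmE (aQ (grad (phi_ k) \- g))).
    apply/funext => k; apply: eq_nrm => x _; congr (enorm (_ *m _)).
    by rewrite /X /= opprD addrACA subrr addr0.
  exact: cvg_g.
have le_k k : nrmE (aQ (grad (phi_ k))) `^ p - p * 2 ^- k <=
    nrmE (aQ (X k)) `^ p + p * (t * source f psi).
  have [_ mphi _ Lphi _] := phiA k.
  have := m_le (admissible_comb H 1 t (phi_min k).1 Apsi); have := (phi_min k).2.
  rewrite /energy (source_comb H 1 t Lf mphi Lphi mpsi Lpsi).
  have -> : nrmE (aQ (grad (fun x => 1 * phi_ k x + t * psi x))) = nrmE (aQ (X k)).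
    apply: eq_nrm => x Ex; rewrite /form_norm.
    by rewrite ((C1_comb 1 t (C1phi k) C1psi).2 x Ex) scale1r.
  have alg (a b s c e M : R) : a / p + s <= M + e -> M <= b / p + (1 * s + c) ->
      a - p * e <= b + p * c.
    move=> h1 h2; have : a / p - e <= b / p + c by lra.
    rewrite -(ler_pM2l p0) mulrBr mulrDr.
    have pd (z : R) : p * (z / p) = z by rewrite mulrC divfK// gt_eqF.
    by rewrite !pd.
  exact: alg.
have two0 : 2 ^- k @[k --> \oo] --> (0 : R).
  by apply: (@geometric_cvg0 _ _ 1) => k; rewrite mul1r lexx invr_ge0 exprn_ge0.
have Np := powR_cvg p0 (fun k => nrm_ge0 _ _ _ _) (nrm_ge0 _ _ _ _) N_cvg.
have Ntp := powR_cvg p0 (fun k => nrm_ge0 _ _ _ _) (nrm_ge0 _ _ _ _) Nt_cvg.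
have L1 : nrmE (aQ (grad (phi_ k))) `^ p - p * 2 ^- k @[k --> \oo] --> nrmE (aQ g) `^ p.
  rewrite -[X in _ --> X]subr0 -[X in _ --> _ - X](mulr0 p).
  by apply: cvgB; [exact: Np|exact: cvgMl_tmp].
have L2 : nrmE (aQ (X k)) `^ p + p * (t * source f psi) @[k --> \oo] -->
    nrmE (aQ (fun x => g x + t *: grad psi x)) `^ p + p * (t * source f psi).
  by apply: cvgD; [exact: Ntp|exact: cvg_cst].
by apply: (ler_cvg_to L1 L2); exact: nearW.
Qed.

(* Divide the growth inequality by [t > 0] and let [t] tend to 0. *)
Lemma Euler_inequality psi : admissible psi -> 0 <= pairing g (grad psi) + source f psi.
Proof.
move=> Apsi; have [C1psi mpsi mgpsi Lpsi LQpsi] := admissible_C1 H Apsi.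
have [_ _ mg _ Lg _ _] := apx.
pose t_ k : R := 2 ^- k.
have t0 k : 0 < t_ k by rewrite invr_gt0 exprn_gt0.
have t01 k : 0 <= t_ k <= 1.
  by rewrite (ltW (t0 k)) invf_le1 ?exprn_gt0// exprn_ege1// ler1n.
have tcvg : t_ k @[k --> \oo] --> 0.
  by apply: (@geometric_cvg0 _ _ 1) => k; rewrite mul1r lexx (ltW (t0 k)).
have lim := pairing_shift_cvg mg mgpsi Lg LQpsi t01 tcvg.
have {}lim : pairing (fun x => g x + t_ k *: grad psi x) (grad psi) + source f psi
    @[k --> \oo] --> pairing g (grad psi) + source f psi.
  by apply: cvgD => //; exact: cvg_cst.
apply: (cvgr_to_ge lim); apply: nearW => k.
have := minimizer_growth (t_ k) Apsi.
have := pairing_tangent (t_ k) mg mgpsi Lg LQpsi.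
have alg (a b c s t : R) : 0 < t -> a - b <= p * (t * c) -> b <= a + p * (t * s) -> 0 <= c + s.
  move=> tt0 h1 h2; have : 0 <= p * t * (c + s).
    have -> : p * t * (c + s) = p * (t * c) + p * (t * s) by ring.
    lra.
  by rewrite pmulr_rge0// mulr_gt0.
exact: alg.
Qed.

Lemma Euler_Lagrange psi : admissible psi -> pairing g (grad psi) = - source f psi.
Proof.
move=> Apsi; have [C1psi mpsi mgpsi Lpsi LQpsi] := admissible_C1 H Apsi.
have [_ _ mg _ Lg _ _] := apx.
apply/eqP; rewrite -addr_eq0 eq_le Euler_inequality// andbT.
(* The opposite inequality comes from [- psi], written as a linear combination of [psi] with
   itself. *)
have Aneg := admissible_comb H (-1) 0 Apsi Apsi.
have := Euler_inequality Aneg.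
rewrite (source_comb H (-1) 0 Lf mpsi Lpsi mpsi Lpsi).
rewrite (@eq_pairing _ _ p E Q g _ (fun x => -1 *: grad psi x + 0 *: grad psi x)).
  rewrite (pairing_comb H (-1) 0 mg mgpsi mgpsi Lg LQpsi LQpsi).
  by rewrite !mulN1r !mul0r !addr0 -opprD oppr_ge0.
by move=> x Ex; rewrite ((C1_comb (-1) 0 C1psi C1psi).2 x Ex).
Qed.

End at_minimizer.
End Euler_Lagrange.

(** * The Neumann property *)

Section Neumann.
Context (R : realType) (n : nat) (p lambda Lambda C : R).
Local Notation T := 'rV[R]_n.+1.
Local Notation mu := (@lebesgue_rV R n).
Context (E : set T) (Q : T -> 'M[R]_n.+1) (w : T -> R).
Hypothesis H : degenerate_form p lambda Lambda C E Q w.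
Local Notation LpE := (Lp_fun mu E p).
Local Notation nrmE := (nrm mu E p).
Local Notation aw := (weighted_abs p w).
Local Notation aQ := (form_norm Q).
Local Notation mfield := (measurable_field E).
Local Notation admissible := (admissible p E w).
Local Notation source := (source p E w).
Local Notation pairing := (pairing p E Q).
Local Notation CP := (Poincare_bound p lambda C).
Implicit Types (u v phi psi : T -> R) (g h : T -> 'cV[R]_n.+1).

Let p1 : 1 < p := df_gt1 H.
Let p0 : 0 < p. Proof. exact: lt_trans p1. Qed.
Let pB0 : 0 < p - 1. Proof. by rewrite subr_gt0. Qed.
Let mE : measurable E. Proof. exact: open_measurable_rV (df_open H). Qed.

Lemma C1_mfield phi : C1_closure E phi -> mfield (grad phi).
Proof. exact: C1_measurable_pderiv (df_open H). Qed.

Lemma nrm_weighted_dist u v : measurable_fun E u -> measurable_fun E v ->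
  LpE (aw u) -> LpE (aw v) ->
  LpE (aw (u \- v)) /\ `|nrmE (aw u) - nrmE (aw v)| <= nrmE (aw (u \- v)).
Proof.
move=> mu_ mv Lu Lv.
have mB : measurable_fun E (u \- v) by exact: measurable_funB.
have [LNv _] := nrm_weightedZ H (-1) Lv.
have [Ld _] : LpE (aw (u \- v)) /\ True.
  split=> //; apply: (nrm_weighted_triangle H mB Lu LNv _).1 => x _.
  by rewrite mulN1r.
have [LNd Nd] := nrm_weightedZ H (-1) Ld; split=> //.
have h1 : nrmE (aw u) <= nrmE (aw (u \- v)) + nrmE (aw v).
  by apply: (nrm_weighted_triangle H mu_ Ld Lv _).2 => x _; rewrite /= subrK.
have h2 : nrmE (aw v) <= nrmE (aw (u \- v)) + nrmE (aw u).
  have -> : nrmE (aw (u \- v)) = nrmE (aw (fun x => -1 * (u \- v) x)).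
    by rewrite Nd normrN1 mul1r.
  apply: (nrm_weighted_triangle H mv LNd Lu _).2 => x _.
  by rewrite mulN1r /= opprB subrK.
by rewrite ler_norml; apply/andP; split; lra.
Qed.

Lemma source1_int u : measurable_fun E u -> LpE (aw u) -> source (fun=> 1) u = 0 ->
  (\int[mu]_(x in E) (u x * w x)%:E)%E = 0.
Proof.
move=> mu_ Lu u0; have [iu _] := source_bound H (cst_Lp H 1) mu_ Lu.
have := integrable_fin_num mE iu; move: u0; rewrite /source /Rintegral.
rewrite (@eq_integral _ _ _ mu E (fun x => (u x * w x)%:E)).
  by move=> + /fineK => -> <-.
by move=> x _; rewrite /= normr1 powR1 !mul1r.
Qed.

(** The weighted mean is continuous in the weighted norm, so mean zero passes to the limit. *)
Lemma approximates_H1tilde (phi_ : nat -> T -> R) u g :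
  (forall k, admissible (phi_ k)) -> approximates p E Q w phi_ u g ->
  H1tilde p Q w E u g.
Proof.
move=> Aphi [C1phi mu_ mg Lu Lg cvg_u cvg_g].
have mphi k : measurable_fun E (phi_ k) by have [] := admissible_C1 H (Aphi k).
have Lphi k : LpE (aw (phi_ k)) by have [] := admissible_C1 H (Aphi k).
have LQphi k : LpE (aQ (grad (phi_ k))) by have [] := admissible_C1 H (Aphi k).
split; last first.
  apply: source1_int => //.
  have := source_cvg H (cst_Lp H 1) mphi Lphi mu_ Lu cvg_u.
  have -> : (fun k => source (fun=> 1) (phi_ k)) = (fun=> 0).
    by apply/funext => k; exact: (Aphi k).2.
  by move=> h; apply/esym/(cvg_unique _ (cvg_cst _) h).
split; [exact: (weighted_abs_Lp H mu_ Lu)|exact: (form_norm_LQ H mg Lg)|].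
exists phi_; split.
- move=> k; split; first exact: C1phi.
  by rewrite (Lp_norm_weighted_abs H (Lphi k)) (LQ_norm_form_norm H (LQphi k)) -EFinD ltry.
- have -> : (fun k => Lp_norm p w E (phi_ k \- u)) = (fun k => (nrmE (aw (phi_ k \- u)))%:E).
    apply/funext => k; apply: (Lp_norm_weighted_abs H).
    exact: (nrm_weighted_dist (mphi k) mu_ (Lphi k) Lu).1.
  by apply: cvg_EFin; [exact: nearW|exact: cvg_u].
- have -> : (fun k => LQ_norm p Q E (grad (phi_ k) \- g)) =
      (fun k => (nrmE (aQ (grad (phi_ k) \- g)))%:E).
    apply/funext => k; apply: (LQ_norm_form_norm H).
    exact: (nrm_form_dist H (C1_mfield (C1phi k)) mg (LQphi k) Lg).1.
  by apply: cvg_EFin; [exact: nearW|exact: cvg_g].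
Qed.

Lemma admissible_H1tilde phi : admissible phi -> H1tilde p Q w E phi (grad phi).
Proof.
move=> Aphi; have [C1phi mphi mg Lphi LQ] := admissible_C1 H Aphi.
apply: (@approximates_H1tilde (fun=> phi)); first by move=> _; exact: Aphi.
split; [by move=> _; exact: C1phi|exact: mphi|exact: mg|exact: Lphi|exact: LQ| |].
- have -> : (fun k : nat => nrmE (aw (phi \- phi))) = (fun=> 0); last exact: cvg_cst.
  apply/funext => _; rewrite (@eq_nrm _ _ _ mu E p _ (aw (fun x => 0 * phi x))).
    by rewrite (nrm_weightedZ H 0 Lphi).2 normr0 mul0r.
  by move=> x _; rewrite /weighted_abs /= subrr mul0r.
- have -> : (fun k : nat => nrmE (aQ (grad phi \- grad phi))) = (fun=> 0); last exact: cvg_cst.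
  apply/funext => _; rewrite (@eq_nrm _ _ _ mu E p _ (aQ (fun x => 0 *: grad phi x))).
    by rewrite (nrm_formZ H 0 LQ).2 normr0 mul0r.
  by move=> x _; rewrite /form_norm /= subrr scale0r.
Qed.

Lemma H1tilde_admissible phi g : C1_closure E phi -> H1tilde p Q w E phi g -> admissible phi.
Proof. by move=> C1phi [_ mean0]; split=> //; rewrite source1 /Rintegral mean0. Qed.

(** The functions approximating an element of mean zero need not have mean zero themselves. Their
    weighted means [c k] tend to that of [u], so subtracting them changes neither the limit nor the
    gradients. *)
Lemma H1tilde_approximates u g : H1tilde p Q w E u g ->
  exists2 psi_ : nat -> T -> R, forall k, admissible (psi_ k) &
    approximates p E Q w psi_ u g.
Proof.
move=> [[Lpu LQg [f_ [fin_f cvg_f cvg_gf]]] mean0].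
have [[mu_ _] [mg _]] := (Lpu, LQg).
have Lu := Lp_weighted_abs H Lpu; have Lg := LQ_form_norm H LQg.
have C1f k : C1_closure E (f_ k) := (fin_f k).1.
have mf k : measurable_fun E (f_ k) := C1_measurable (df_open H) (C1f k).
have LfQ k := C1_Lp H (C1f k).
have L1 := Lp_weighted_abs H (cst_Lp H 1).
have m1 : measurable_fun E (fun=> 1 : R) by exact: measurable_cst.
pose W1 := nrmE (aw (fun=> 1)).
pose c k := source (fun=> 1) (f_ k) / W1 `^ p.
pose psi_ k x := 1 * f_ k x + (- c k) * 1.
have Ncvg : nrmE (aw (f_ k \- u)) @[k --> \oo] --> (0 : R).
  move: cvg_f.
  have -> : (fun k => Lp_norm p w E (f_ k \- u)) = (fun k => (nrmE (aw (f_ k \- u)))%:E).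
    apply/funext => k; apply: (Lp_norm_weighted_abs H).
    exact: (nrm_weighted_dist (mf k) mu_ (LfQ k).1 Lu).1.
  by move=> /fine_cvg; exact.
have Gcvg : nrmE (aQ (grad (f_ k) \- g)) @[k --> \oo] --> (0 : R).
  move: cvg_gf.
  have -> : (fun k => LQ_norm p Q E (grad (f_ k) \- g)) =
      (fun k => (nrmE (aQ (grad (f_ k) \- g)))%:E).
    apply/funext => k; apply: (LQ_norm_form_norm H).
    exact: (nrm_form_dist H (C1_mfield (C1f k)) mg (LfQ k).2 Lg).1.
  by move=> /fine_cvg; exact.
have ccvg : c k @[k --> \oo] --> (0 : R).
  rewrite -(mul0r (W1 `^ p)^-1); apply: cvgMr_tmp.
  have := source_cvg H (cst_Lp H 1) mf (fun k => (LfQ k).1) mu_ Lu Ncvg.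
  by rewrite (_ : source _ u = 0)// source1 /Rintegral mean0.
have Apsi k : admissible (psi_ k).
  split; first exact: (C1_comb 1 (- c k) (C1f k) (C1_cst E 1).1).1.
  rewrite (source_comb H 1 (- c k) (cst_Lp H 1) (mf k) (LfQ k).1 m1 L1) (source11 H) -/W1.
  (* If [w] has no mass on [E], the quotient defining [c k] is 0 by convention, and the integral to
     be cancelled vanishes by Hoelder. *)
  have [W0|W0] := eqVneq W1 0; last first.
    by rewrite mulNr mulfVK ?mul1r ?subrr// gt_eqF// powR_gt0// lt_neqAle eq_sym W0 nrm_ge0.
  have [_] := source_bound H (cst_Lp H 1) (mf k) (LfQ k).1.
  rewrite -/W1 W0 powR0 ?gt_eqF// mulr0 normr_le0 => /eqP ->.
  by rewrite powR0 ?gt_eqF// !mulr0 addr0.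
exists psi_; first exact: Apsi.
split; [by move=> k; exact: (Apsi k).1|exact: mu_|exact: mg|exact: Lu|exact: Lg| |].
- apply: (@squeeze_cvgr _ _ _ _ (fun=> 0)
      (fun k => nrmE (aw (f_ k \- u)) + `|c k| * W1)).
  + apply: nearW => k; rewrite nrm_ge0/=.
    have [Lc Nc] := nrm_weightedZ H (- c k) L1.
    rewrite -normrN -Nc.
    have mB : measurable_fun E (psi_ k \- u).
      exact: (measurable_funB (C1_measurable (df_open H) (Apsi k).1) mu_).
    have [Ld _] := nrm_weighted_dist (mf k) mu_ (LfQ k).1 Lu.
    apply: (nrm_weighted_triangle H mB Ld Lc _).2 => x _.
    by rewrite /psi_ /= mul1r addrAC.
  + exact: cvg_cst.
  + rewrite -[X in _ --> X]addr0 -[X in _ --> _ + X](mul0r W1).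
    apply: cvgD; first exact: Ncvg.
    by apply: cvgMr_tmp; rewrite -(@normr0 _ R); exact: cvg_norm.
- have -> : (fun k => nrmE (aQ (grad (psi_ k) \- g))) =
      (fun k => nrmE (aQ (grad (f_ k) \- g))); last exact: Gcvg.
  apply/funext => k; apply: eq_nrm => x Ex; congr (enorm (_ *m _)).
  rewrite /= ((C1_comb 1 (- c k) (C1f k) (C1_cst E 1).1).2 x Ex).
  by rewrite (C1_cst E 1).2 scaler0 addr0 scale1r.
Qed.

Lemma weak_solution_pairing f u g : Lp p w E f -> weak_solution p Q w E f u g ->
  forall phi, admissible phi -> pairing g (grad phi) = - source f phi.
Proof.
move=> Lf [_ weak] phi Aphi.
have := weak phi Aphi.1 (admissible_H1tilde Aphi).
by rewrite /pairing /source /Rintegral /flux => ->; rewrite fineN.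
Qed.

Lemma weak_solution_exists f : Lp p w E f -> exists u g, weak_solution p Q w E f u g.
Proof.
move=> Lf; have [m [phi_ [u [g [m_le phi_min apx]]]]] := minimizer H Lf.
exists u, g; split.
  by apply: (approximates_H1tilde _ apx) => k; exact: (phi_min k).1.
move=> phi C1phi /(H1tilde_admissible C1phi) Aphi.
have [_ mphi mgphi Lphi LQphi] := admissible_C1 H Aphi.
have [_ _ mg _ Lg _ _] := apx.
(* The identity is between real parts of extended integrals; it lifts because both integrals are
   finite. *)
have EL := congr1 (fun z : R => z%:E) (Euler_Lagrange H Lf m_le phi_min apx Aphi).
have [ipair _] := pairing_le H mg mgphi Lg LQphi.
have [isrc _] := source_bound H Lf mphi Lphi.
move: EL; rewrite EFinN /pairing /source /Rintegral.
rewrite (fineK (integrable_fin_num mE ipair)) (fineK (integrable_fin_num mE isrc)).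
by [].
Qed.

(* From [G^p <= U F^(p-1)] and [U <= CP G], where [U], [G], [F] are the norms of [u],
   [g], [f]. *)
Definition Neumann_bound : R := CP * CP `^ (p - 1)^-1.

(** The solution itself is not a test function; testing with its approximants of mean zero and
    passing to the limit gives [G ^ p = - source f u]. The Poincare inequality reaches [u] through
    the same approximants. *)
Lemma weak_solution_bound f u g : Lp p w E f -> weak_solution p Q w E f u g ->
  (Lp_norm p w E u <= (Neumann_bound + 1)%:E * Lp_norm p w E f)%E.
Proof.
move=> Lf sol; have weak := weak_solution_pairing Lf sol.
have [psi_ Apsi apx] := H1tilde_approximates sol.1.
have [C1psi mu_ mg Lu Lg cvg_u cvg_g] := apx.
have LF := Lp_weighted_abs H Lf.
rewrite (Lp_norm_weighted_abs H Lu) (Lp_norm_weighted_abs H LF) -EFinM lee_fin.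
have psiA k := admissible_C1 H (Apsi k).
have mpsi k : measurable_fun E (psi_ k) by have [] := psiA k.
have mgpsi k : mfield (grad (psi_ k)) by have [] := psiA k.
have Lpsi k : LpE (aw (psi_ k)) by have [] := psiA k.
have LQpsi k : LpE (aQ (grad (psi_ k))) by have [] := psiA k.
pose U := nrmE (aw u); pose G := nrmE (aQ g); pose F := nrmE (aw f).
have [U0 G0 F0] : [/\ 0 <= U, 0 <= G & 0 <= F] by split; exact: nrm_ge0.
have CP0 : 0 <= CP by rewrite mulr_ge0 ?powR_ge0.
have UG : U <= CP * G.
  have lU : nrmE (aw (psi_ k)) @[k --> \oo] --> U.
    apply/cvgrPdist_le => e e0; move/cvgrPdist_le : cvg_u => /(_ e e0); apply: filterS => k.
    rewrite sub0r normrN distrC => h.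
    apply: le_trans (nrm_weighted_dist (mpsi k) mu_ (Lpsi k) Lu).2 _.
    exact: le_trans (ler_norm _) h.
  have lG : CP * nrmE (aQ (grad (psi_ k))) @[k --> \oo] --> CP * G.
    by apply: cvgMl_tmp; exact: (nrm_form_cvg H mgpsi mg LQpsi Lg cvg_g).
  by apply: (ler_cvg_to lU lG); apply: nearW => k; exact: (zero_mean_Poincare H (Apsi k)).
have Gp : G `^ p = - source f u.
  have lp := pairing_cvg H mg Lg mgpsi mg LQpsi Lg cvg_g.
  have ls : - source f (psi_ k) @[k --> \oo] --> - source f u.
    by apply: cvgN; exact: (source_cvg H Lf mpsi Lpsi mu_ Lu cvg_u).
  have -> : G `^ p = pairing g g.
    apply: EFin_inj; rewrite -(nrm_pow p1 Lg).
    have [ig _] := pairing_le H mg mg Lg Lg.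
    rewrite /pairing /Rintegral (fineK (integrable_fin_num mE ig)).
    apply: eq_integral => x /set_mem Ex; rewrite [(EFin \o _) x]/= (fluxE H _ _ Ex) -sqr_enorm.
    rewrite expr2 mulrA /form_norm; congr EFin.
    have e0 := enorm_ge0 (sqrtmx (Q x) *m g x).
    rewrite -[in LHS](powR_mul_self e0 p0) -[in LHS](powR_mul_self e0 pB0).
    by congr (_ `^ _ * _ * _); ring.
  have eqf : (fun k => pairing g (grad (psi_ k))) = (fun k => - source f (psi_ k)).
    by apply/funext => k; exact: weak (Apsi k).
  move: lp; rewrite eqf => lp.
  exact: (cvg_unique (@norm_hausdorff _ R^o) lp ls).
have GF : G `^ p <= U * F `^ (p - 1).
  rewrite Gp; apply: le_trans (ler_norm _) _; rewrite normrN.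
  exact: (source_bound H Lf mu_ Lu).2.
(* Inserting [U <= CP * G] and dividing by [G > 0] leaves [G ^ (p - 1) <= CP * F ^ (p - 1)]. *)
have GCF : G <= CP `^ (p - 1)^-1 * F.
  move: G0; rewrite le_eqVlt => /predU1P[<-|Ggt0]; first by rewrite mulr_ge0 ?powR_ge0.
  have : G `^ (p - 1) <= CP * F `^ (p - 1).
    rewrite -(ler_pM2r Ggt0) (powR_mul_self (ltW Ggt0) p0); apply: le_trans GF _.
    by rewrite mulrAC ler_wpM2r ?powR_ge0.
  move=> h; have := @ge0_ler_powR R (p - 1)^-1 _ _ _ _ _ h.
  rewrite invr_ge0 !nnegrE mulr_ge0 ?powR_ge0// => /(_ (ltW pB0) isT isT).
  rewrite (powRM _ CP0 (powR_ge0 _ _)) -!(powRrM _ (p - 1)) mulfV ?gt_eqF//.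
  by rewrite !powRr1 ?(ltW Ggt0).
apply: le_trans UG _; apply: le_trans (ler_wpM2l CP0 GCF) _.
by rewrite mulrA mulrDl mul1r lerDl.
Qed.

End Neumann.

(** All sets are null here, so every integral and norm vanishes and the zero pair solves each
    problem. The packing and doubling arguments divide by the unit ball volume and do not reach this
    case. *)
Lemma null_p_Neumann (R : realType) (n : nat) (p : R) (Q : 'rV[R]_n.+1 -> 'M[R]_n.+1)
    (v : 'rV[R]_n.+1 -> R) (E : set 'rV[R]_n.+1) : 1 < p ->
  unit_ball_volume R n = 0 -> p_Neumann p Q v E.
Proof.
move=> p1 /unit_ball_null mu0.
have p0 : 0 < p by exact: lt_trans p1.
have int0 (F : 'rV[R]_n.+1 -> \bar R) : (\int[@lebesgue_rV R n]_(x in E) F x)%E = 0%E.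
  rewrite (@eq_measure_integral _ _ _ _ mzero) ?integral_measure_zero// => A _ _.
  exact: mu0.
have zero_pow : (0 `^ p^-1 = 0 :> \bar R)%E.
  by rewrite poweR_EFin powR0// invr_eq0 gt_eqF.
have norm0 u : Lp_norm p v E u = 0%E by rewrite /Lp_norm int0.
have Qnorm0 g : LQ_norm p Q E g = 0%E by rewrite /LQ_norm int0.
split=> [f Lf|].
  exists (fun=> 0), (fun=> 0); split=> [|phi _ _]; last by rewrite !int0 oppe0.
  split; last exact: int0.
  split.
  - by split; [exact: measurable_cst|rewrite norm0].
  - split; last by rewrite Qnorm0.
    by move=> i; under eq_fun do rewrite mxE; exact: measurable_cst.
  - exists (fun _ _ => 0); split.
    + by move=> k; split; [exact: (C1_cst E 0).1|rewrite norm0 Qnorm0 adde0].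
    + by under eq_fun do rewrite norm0; exact: cvg_cst.
    + by under eq_fun do rewrite Qnorm0; exact: cvg_cst.
by exists 1 => // f _ u g _; rewrite !norm0 mule0.
Qed.

Lemma degenerate_form_p_Neumann (R : realType) (n : nat) (p lambda Lambda C : R)
    (E : set 'rV[R]_n.+1) (Q : 'rV[R]_n.+1 -> 'M[R]_n.+1) (w : 'rV[R]_n.+1 -> R) :
  degenerate_form p lambda Lambda C E Q w -> p_Neumann p Q w E.
Proof.
move=> H; split; first exact: (weak_solution_exists H).
(* The constant must be positive, while [Neumann_bound] is only known to be non-negative. *)
exists (Neumann_bound p lambda C + 1).
  by rewrite ltr_wpDl// !mulr_ge0 ?powR_ge0.
by move=> f Lf u g; exact: (weak_solution_bound H Lf).
Qed.

Lemma Ap_weight_bound (R : realType) (n : nat) (p : R) (w : 'rV[R]_n.+1 -> R) :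
  1 < p -> Ap_weight p w -> exists K : R, Ap_bound p w K.
Proof.
move=> p1 [[w0 mw _] w_gt0]; set S := [set _ | _ in _] => supS.
exists (fine (ereal_sup S)); split=> // c r r0.
have in_S : S (Ap_quotient p w (eball c r)) by exists (c, r).
have q0 : (0 <= Ap_quotient p w (eball c r))%E.
  have av0 (g : 'rV[R]_n.+1 -> R) : (forall x, 0 <= g x) -> (0 <= average (eball c r) g)%E.
    move=> g0; apply: mule_ge0; first by rewrite inve_ge0 measure_ge0.
    by apply: integral_ge0 => x _; rewrite lee_fin.
  by apply: mule_ge0; [exact: av0|exact: poweR_ge0].
have le_S := ereal_sup_ubound in_S.
rewrite fineK// ge0_fin_numE//; exact: le_trans q0 le_S.
Qed.

Theorem corollary5p1 (R : realType) (n : nat) (p : R)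
    (Omega E : set 'rV[R]_n.+1) (Q : 'rV[R]_n.+1 -> 'M[R]_n.+1)
    (w : 'rV[R]_n.+1 -> R) (lambda Lambda : R) :
  1 < p ->
  domain Omega ->
  (forall x, Omega x -> psdmx (Q x)) ->
  (forall i j, measurable_fun Omega (fun x => Q x i j)) ->
  domain E -> bounded_set E -> closure E `<=` Omega -> Boman E ->
  Ap_weight p w ->
  0 < lambda -> lambda < Lambda ->
  {ae lebesgue_rV, forall x, Omega x -> forall xi : 'cV[R]_n.+1,
    lambda * w x `^ (2 / p) * enorm xi ^+ 2 <= quadform (Q x) xi /\
    quadform (Q x) xi <= Lambda * w x `^ (2 / p) * enorm xi ^+ 2} ->
  p_Neumann p Q w E /\
  (forall f, Lp p w E f -> exists u g, weak_solution p Q w E f u g).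
Proof.
move=> p1 [oOmega _ _] psdQ mQ [oE _ _] bE EOmega BE wAp l0 lL ell.
suff N : p_Neumann p Q w E by split; [exact: N|exact: N.1].
have [kappa0|kappa0] := eqVneq (unit_ball_volume R n) 0; first exact: null_p_Neumann.
have {}kappa0 : 0 < unit_ball_volume R n.
  by rewrite lt_neqAle eq_sym kappa0 unit_ball_volume_ge0.
have [K pw] := Ap_weight_bound p1 wAp.
have subE : E `<=` Omega := subset_trans (@subset_closure _ E) EOmega.
have mE : measurable E by exact: open_measurable_rV.
have mOmega : measurable Omega by exact: open_measurable_rV.
have [[w0 mw w_loc] w_gt0 _] := wAp.
have mwE (A : set 'rV[R]_n.+1) : measurable_fun A w by exact: (measurable_weight pw).
(* Local integrability is used on the closure of [E], which is compact. *)
have wE : (\int[lebesgue_rV]_(x in E) (w x)%:E < +oo)%E.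
  apply: le_lt_trans (w_loc _ (compact_closure bE)).
  apply: ge0_subset_integral.
  - exact: mE.
  - by apply: closed_measurable_rV; exact: closed_closure.
  - by apply/measurable_EFinP; exact: mwE.
  - by move=> x _; rewrite lee_fin.
  - exact: subset_closure.
have [tau [M [W [[tau1 M1] [W_gt0 EW] W_overlap [B0 _ W_chain]]]]] := BE.
have [rho rho0 Erho] := bounded_eball bE.
(* The maximum provides the non-negativity asked for by [degenerate_form] and only weakens the
   inequality. *)
pose C := Num.max 0 (Boman_Poincare_const n p K rho M).
apply: (@degenerate_form_p_Neumann _ _ p lambda Lambda C); split.
- exact: p1.
- exact: oE.
- exact: bE.
- exact: w0.
- exact: mwE.
- by apply: filterS w_gt0 => x wx _.
- exact: wE.
- by move=> i j; exact: measurable_funS mOmega subE (mQ i j).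
- by move=> x /subE; exact: psdQ.
- exact: l0.
- exact: lt_trans lL.
- by apply: filterS ell => x xi /subE; exact: xi.
- by rewrite le_max lexx.
- move=> f C1f; exists (ball_mean f B0.1 B0.2).
  apply: le_trans (Boman_Poincare kappa0 pw oE rho0 Erho wE tau1 M1 W_gt0 EW W_overlap
    W_chain (C1_regular_pair oE bE C1f) bE) _.
  apply: lee_wpmul2r; last by rewrite lee_fin le_max lexx orbT.
  by apply: integral_ge0 => x _; rewrite lee_fin mulr_ge0 ?powR_ge0.
Qed.
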